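(* Let $k$ and $n$ be positive integers, let $\overline{PTW_k}$ be a small pure twin group on $k$ arcs, and let $p \in \operatorname{LCS}_n(\overline{PTW_k})$, the $n$th group of the lower central series of $\overline{PTW_k}$. Let $C$ and $C'$ be two rondles that differ by the twin $p$. Let $f$ be a rondle invariant, with values in an abelian group, of order less than $n$ with respect to triple-point modifications. Then $f(C) = f(C')$.
   Context: **Twin groups.** The twin group $TW_k$ on $k$ arcs is generated by $\sigma_1,\dots,\sigma_{k-1}$ with relations $\sigma_i^2=1$ for all $i$ and $\sigma_i\sigma_j=\sigma_j\sigma_i$ for $|i-j|>1$. Its elements are called twins. The pure twin group $PTW_k$ is the kernel of the natural homomorphism $TW_k\to S_k$ sending $\sigma_i$ to the transposition $(i\ i+1)$. **Small pure twin group.** A subgroup $\overline{PTW_k}$ of $PTW_k$ is called a small pure twin group on $k$ arcs if it is generated by elements $p^{(1)},\dots,p^{(\ell)}\in PTW_k$, each of which is reduced to $1$ by applying the Yang-Baxter relation $\sigma_i\sigma_{i+1}\sigma_i=\sigma_{i+1}\sigma_i\sigma_{i+1}$ ($1\le i\le k-2$) exactly once, with the relations of $TW_k$ freely used. That is, for each generator $p^{(j)}$ there are $u,v\in TW_k$ and $i$ such that $p^{(j)}=u\,\tau\,v$ and $u\,\tau'\,v=1$ in $TW_k$, where $\{\tau,\tau'\}=\{\sigma_i\sigma_{i+1}\sigma_i,\ \sigma_{i+1}\sigma_i\sigma_{i+1}\}$. **Lower central series.** For a group $G$: $\operatorname{LCS}_1(G)=G$ and $\operatorname{LCS}_{n+1}(G)=[G,\operatorname{LCS}_n(G)]$,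 where $[H,K]=\langle xyx^{-1}y^{-1}: x\in H,\ y\in K\rangle$. **Geometric realization.** Twins in $TW_k$ are identified with configurations of $k$ arcs in $\mathbb{R}\times[0,1]$ connecting the points $(1,0),\dots,(k,0)$ to the points $(1,1),\dots,(k,1)$, such that each arc projects homeomorphically onto $[0,1]$ in the $y$-coordinate and no three arcs share a common point, up to homotopy through such configurations fixing endpoints. The generator $\sigma_i$ corresponds to the configuration with exactly one double point, between the $i$th and $(i+1)$th arcs. The product is given by putting one configuration on top of the other. **Rondles.** A link projection is the image of a generic immersion $S^1\sqcup\dots\sqcup S^1\to\mathbb{R}^2$ of finitely many circles all of whose intersections are transverse double points. A self-tangency modification is the local move in which two strands are passed through a tangency, creating or removing two double points that bound a bigon. A rondle is an equivalence class of link projections under diffeomorphisms of $\mathbb{R}^2$ with compact support and self-tangency modifications. A rondle invariant is a map from the set of rondles to a set. **Tangle maps and ''differ by''.** A tangle map $T:TW_k\to\{\text{rondles}\}$ is a fixed way of putting a twin into a tangle projection to obtain a rondle: one fixes a tangle projection (the part of a link projection outside an open disc) with $2k$ endpoints on the boundary of the disc, and $T(p)$ is the class of the link projection obtained by inserting into the disc a configuration representing $p$. This is well defined. Two rondles $C,C'$ differ by a twin $p\in TW_k$ if there are a tangle map $T$ and a twin $x\in TW_k$ with $C=T(x)$ and $C'=T(px)$. **Finite order.** A triangle in a link projection is a disc region, with interior disjoint from the curve, bounded by three edges and three double points. The triple-point modification at a triangle is the local move (corresponding to the Yang-Baxter relation) that passes one of the three strands through the double point of the other two, replacing the triangle by the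 opposite triangle. A set of triangles is disjoint if any two of them share no vertex, edge, or face. A rondle invariant $r$ with values in an abelian group satisfies the $N$-vanishing condition ($N\ge 1$) if, for every link projection $D$ with $N$ chosen disjoint triangles numbered $1$ to $N$, $$\sum_{s\subset\{1,\dots,N\}}(-1)^{|s|}\,r(D_s)=0,$$ where $D_s$ is obtained from $D=D_\emptyset$ by applying the triple-point modification to each triangle in $s$. The order of $r$ with respect to triple-point modifications is $N-1$, where $N$ is the smallest positive integer for which the $N$-vanishing condition holds; if there is none, $r$ has infinite order. *)

(* Defs.v *)
From HB Require Import structures.
From mathcomp Require Import all_boot all_order all_algebra all_fingroup.
From mathcomp Require Import all_classical all_reals all_analysis.
From mathcomp Require Import generic_quotient zify.
Set Implicit Arguments.
Unset Strict Implicit.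
Unset Printing Implicit Defensive.
Import Order.TTheory GRing.Theory Num.Theory.
Import numFieldNormedType.Exports.
Local Open Scope classical_set_scope.
Local Open Scope ring_scope.

(* Indices are 0-based: the letter [i : 'I_k.-1] is the generator exchanging
   the arcs [i] and [i.+1] among the arcs [0, ..., k.-1]. *)
Definition tw_word (k : nat) := seq 'I_k.-1.

Inductive tw_eqv (k : nat) : tw_word k -> tw_word k -> Prop :=
| tw_refl w : tw_eqv w w
| tw_sym w1 w2 : tw_eqv w1 w2 -> tw_eqv w2 w1
| tw_trans w1 w2 w3 : tw_eqv w1 w2 -> tw_eqv w2 w3 -> tw_eqv w1 w3
| tw_square (u v : tw_word k) (i : 'I_k.-1) :
    tw_eqv (u ++ [:: i; i] ++ v) (u ++ v)
| tw_comm (u v : tw_word k) (i j : 'I_k.-1) : (i.+1 < j)%N ->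
    tw_eqv (u ++ [:: i; j] ++ v) (u ++ [:: j; i] ++ v).

Section TwinGroup.
Variable k : nat.
Implicit Types u v w : tw_word k.

Definition tw_eqvb : rel (tw_word k) := fun u v => `[< tw_eqv u v >].

Lemma tw_eqvb_refl : reflexive tw_eqvb.
Proof. by move=> w; apply/asboolP; exact: tw_refl. Qed.

Lemma tw_eqvb_sym : symmetric tw_eqvb.
Proof. by move=> u v; apply/asboolP/asboolP; exact: tw_sym. Qed.

Lemma tw_eqvb_trans : transitive tw_eqvb.
Proof.
by move=> v u w /asboolP uv /asboolP vw; apply/asboolP; exact: tw_trans uv vw.
Qed.

Canonical tw_equiv : equiv_rel (tw_word k) :=
  EquivRel tw_eqvb tw_eqvb_refl tw_eqvb_sym tw_eqvb_trans.

Definition twin : Type := {eq_quot tw_equiv}%qT.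
HB.instance Definition _ := Choice.on twin.
HB.instance Definition _ := EqQuotient.on twin.

Local Open Scope quotient_scope.

Definition tw_class (w : tw_word k) : twin := \pi_twin w.

Lemma tw_classP u v : tw_class u = tw_class v <-> tw_eqv u v.
Proof.
by split=> [/eqmodP/asboolP//|uv]; apply/eqmodP/asboolP.
Qed.

Lemma tw_class_repr (p : twin) : tw_class (repr p) = p.
Proof. exact: reprK. Qed.

Definition tw_mul (p q : twin) : twin := tw_class (repr p ++ repr q).
Definition tw_one : twin := tw_class [::].
Definition tw_inv (p : twin) : twin := tw_class (rev (repr p)).

Lemma tw_eqv_catr u v w : tw_eqv u v -> tw_eqv (u ++ w) (v ++ w).
Proof.
elim=> [x|x y _|x y z _ xy _|x y i|x y i j ij].
- exact: tw_refl.
- exact: tw_sym.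
- exact: tw_trans.
- by rewrite -!catA; exact: tw_square.
- by rewrite -!catA; exact: tw_comm.
Qed.

Lemma tw_eqv_catl u v w : tw_eqv u v -> tw_eqv (w ++ u) (w ++ v).
Proof.
elim=> [x|x y _|x y z _ xy _|x y i|x y i j ij].
- exact: tw_refl.
- exact: tw_sym.
- exact: tw_trans.
- by rewrite catA [w ++ (x ++ y)]catA; exact: tw_square.
- by rewrite catA [w ++ (x ++ _)]catA; exact: tw_comm.
Qed.

Lemma tw_eqv_rev u v : tw_eqv u v -> tw_eqv (rev u) (rev v).
Proof.
elim=> [x|x y _|x y z _ xy _|x y i|x y i j ij].
- exact: tw_refl.
- exact: tw_sym.
- exact: tw_trans.
- rewrite !rev_cat -catA; exact: tw_square.
- by rewrite !rev_cat -!catA; apply: tw_sym; exact: tw_comm.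
Qed.

Lemma tw_eqv_repr w : tw_eqv (repr (tw_class w)) w.
Proof. by apply/tw_classP; rewrite tw_class_repr. Qed.

Lemma tw_classM u v : tw_class (u ++ v) = tw_mul (tw_class u) (tw_class v).
Proof.
apply/tw_classP/tw_sym; apply: (tw_trans (w2 := u ++ repr (tw_class v))).
  by apply: tw_eqv_catr; exact: tw_eqv_repr.
by apply: tw_eqv_catl; exact: tw_eqv_repr.
Qed.

Lemma tw_mulA : associative tw_mul.
Proof.
move=> p q r.
by rewrite -[p]tw_class_repr -[q]tw_class_repr -[r]tw_class_repr
  -!tw_classM catA.
Qed.

Lemma tw_mul1 : left_id tw_one tw_mul.
Proof. by move=> p; rewrite -[p]tw_class_repr -tw_classM. Qed.

Lemma tw_mulr1 : right_id tw_one tw_mul.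
Proof. by move=> p; rewrite -[p]tw_class_repr -tw_classM cats0. Qed.

Lemma tw_eqv_revK w : tw_eqv (rev w ++ w) [::].
Proof.
elim: w => [|i w IHw]; first exact: tw_refl.
rewrite rev_cons cat_rcons.
by apply: tw_trans IHw; exact: (tw_square (rev w) w i).
Qed.

Lemma tw_mulV : left_inverse tw_one tw_inv tw_mul.
Proof.
move=> p; rewrite -{2}[p]tw_class_repr /tw_inv -tw_classM.
by apply/tw_classP; exact: tw_eqv_revK.
Qed.

Lemma tw_mulVr : right_inverse tw_one tw_inv tw_mul.
Proof.
move=> p; rewrite -{1}[p]tw_class_repr /tw_inv -tw_classM.
by apply/tw_classP; rewrite -{1}[repr p]revK; exact: tw_eqv_revK.
Qed.

HB.instance Definition _ :=
  isGroup.Build twin tw_mulA tw_mul1 tw_mulr1 tw_mulV tw_mulVr.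

Definition tw_sigma (i : 'I_k.-1) : twin := tw_class [:: i].

Lemma left_arc_subproof (i : 'I_k.-1) : (i < k)%N.
Proof. exact: leq_trans (ltn_ord i) (leq_pred k). Qed.

Lemma right_arc_subproof (i : 'I_k.-1) : (i.+1 < k)%N.
Proof. by case: k i => [[]|n []]. Qed.

Definition left_arc (i : 'I_k.-1) : 'I_k := Ordinal (left_arc_subproof i).
Definition right_arc (i : 'I_k.-1) : 'I_k := Ordinal (right_arc_subproof i).

Definition word_perm (w : tw_word k) : 'S_k :=
  (\prod_(i <- w) tperm (left_arc i) (right_arc i))%g.

Lemma word_perm_eqv u v : tw_eqv u v -> word_perm u = word_perm v.
Proof.
rewrite /word_perm; elim=> // [x y z _ -> _ ->//|x y i|x y i j ij].
  by rewrite !big_cat !big_cons !big_nil /= mulg1 tperm2 mul1g.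
rewrite !big_cat !big_cons !big_nil /= !mulg1; congr (_ * (_ * _))%g.
by rewrite conjgC tpermJ !tpermD // -val_eqE /=; lia.
Qed.

(* The natural homomorphism to the symmetric group; see [tw_permE]. *)
Definition tw_perm (p : twin) : 'S_k := word_perm (repr p).

Lemma tw_permE w : tw_perm (tw_class w) = word_perm w.
Proof. exact/word_perm_eqv/tw_eqv_repr. Qed.

Definition pure_twin (p : twin) : Prop := tw_perm p = 1%g.

(* [p = u t v] and [u t' v = 1] where [{t, t'}] are the two sides of a
   Yang-Baxter relation; both orders are covered by the condition on [i, j]. *)
Definition yb_trivial (p : twin) : Prop :=
  exists (u v : twin) (i j : 'I_k.-1),
    [/\ j = i.+1 :> nat \/ i = j.+1 :> nat,
        p = (u * (tw_sigma i * tw_sigma j * tw_sigma i) * v)%g &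
        (u * (tw_sigma j * tw_sigma i * tw_sigma j) * v)%g = 1%g].

End TwinGroup.

Definition is_subgroup (G : groupType) (H : set G) : Prop :=
  [/\ H 1%g, forall x y, H x -> H y -> H (x * y)%g & forall x, H x -> H x^-1%g].

Definition generated (G : groupType) (S : set G) : set G :=
  smallest (@is_subgroup G) S.

Definition commutators (G : groupType) (H K : set G) : set G :=
  generated [set (x * y * x^-1 * y^-1)%g | x in H & y in K].

(* 1-based: [lcs H 1 = H]. *)
Definition lcs (G : groupType) (H : set G) (n : nat) : set G :=
  iter n.-1 (commutators H) H.

Definition small_pure_twin_group (k : nat) (H : set (twin k)) : Prop :=
  exists ps : seq (twin k),
    (forall p, p \in ps -> pure_twin p /\ yb_trivial p) /\
    H = generated [set` ps].

Section Rondles.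
Variable R : realType.

Fixpoint iterD (V W : normedModType R) (vs : seq V) (f : V -> W) : V -> W :=
  if vs is v :: vs' then iterD vs' (fun x => 'D_v f x) else f.

(* All iterated directional derivatives exist and are differentiable. *)
Definition smooth (V W : normedModType R) (f : V -> W) : Prop :=
  forall (vs : seq V) (x : V), differentiable (iterD vs f) x.

Definition diffeo (phi : R * R -> R * R) : Prop :=
  smooth phi /\
  exists psi : R * R -> R * R, [/\ smooth psi, cancel phi psi & cancel psi phi].

Definition compactly_supported (phi : R * R -> R * R) : Prop :=
  exists K : set (R * R), compact K /\ forall z, ~ K z -> phi z = z.

(* [m] circles [R / Z], the [i]-th one being parametrized by [g i], which has
   period 1; a point of the disjoint union is given by a pair [(i, t)]. *)
Definition same_point (m : nat) (u v : 'I_m * R) : Prop :=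
  u.1 = v.1 /\ u.2 - v.2 \is a Num.int.

Definition transverse (a b : R * R) : Prop := a.1 * b.2 - a.2 * b.1 != 0.

Record generic_immersion (m : nat) (g : 'I_m -> R -> R * R) : Prop := {
  gi_smooth : forall i, smooth (g i : R^o -> R * R) ;
  gi_periodic : forall i t, g i (t + 1) = g i t ;
  gi_immersion : forall i t, derive1 (g i) t != 0 ;
  gi_transverse : forall u v : 'I_m * R,
    g u.1 u.2 = g v.1 v.2 -> ~ same_point u v ->
    transverse (derive1 (g u.1) u.2) (derive1 (g v.1) v.2) ;
  gi_no_triple : forall u v w : 'I_m * R,
    g u.1 u.2 = g v.1 v.2 -> g v.1 v.2 = g w.1 w.2 ->
    [\/ same_point u v, same_point v w | same_point u w] }.

Definition image_of (m : nat) (g : 'I_m -> R -> R * R) : set (R * R) :=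
  \bigcup_i range (g i).

Definition link_projection (D : set (R * R)) : Prop :=
  exists (m : nat) (g : 'I_m -> R -> R * R),
    generic_immersion g /\ D = image_of g.

Definition double_point (D : set (R * R)) (z : R * R) : Prop :=
  exists (m : nat) (g : 'I_m -> R -> R * R) (u v : 'I_m * R),
    [/\ generic_immersion g, D = image_of g, ~ same_point u v,
        g u.1 u.2 = z & g v.1 v.2 = z].

(* A smooth step: 0 on ]-oo, 1/3], 1 on [2/3, +oo[, increasing in between. *)
Definition flat (x : R) : R := if 0 < x then expR (- x^-1) else 0.
Definition step (t : R) : R :=
  flat (3 * t - 1) / (flat (3 * t - 1) + flat (2 - 3 * t)).

(* Abscissae, at height [t] in [0, 1], of the arcs of a configuration of [k]
   arcs representing the generator [i]: the two arcs joining the positions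
   [i.+1] and [i.+2] (1-based) cross once, the others are vertical. *)
Definition crossing (k : nat) (i : 'I_k.-1) (t : R) : set R :=
  [set x | [\/ x = i.+1%:R + step t, x = i.+2%:R - step t |
     exists j : 'I_k, [/\ j != left_arc i, j != right_arc i & x = j.+1%:R]]].

(* The standard configuration representing a word: the configurations of its
   letters are stacked from bottom to top, in layers of equal heights. *)
Definition config (k : nat) (w : tw_word k) : set (R * R) :=
  [set z | if w is [::]
           then 0 <= z.2 <= 1 /\ exists j : 'I_k, z.1 = j.+1%:R
           else exists (a : 'I_(size w)) (t : R),
             [/\ 0 <= t <= 1, z.2 = (a%:R + t) / (size w)%:R &
                 crossing (tnth (in_tuple w) a) t z.1]].

Definition box (k : nat) : set (R * R) :=
  [set z | 2^-1 <= z.1 <= k%:R + 2^-1 /\ 0 <= z.2 <= 1].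

(* Discs in the plane are taken of the form [E @` box k] for a diffeomorphism
   [E] of the plane; [E] may reverse the orientation and need not be compactly
   supported.  [fill E w D] replaces what [D] is inside the disc by the
   configuration [w]; in particular [fill E w D = D] says that, in the
   coordinates [E], [D] is the configuration [w] inside the disc. *)
Definition fill (k : nat) (E : R * R -> R * R) (w : tw_word k)
    (D : set (R * R)) : set (R * R) :=
  (D `\` E @` box k) `|` E @` config w.

Definition projection : Type := {D : set (R * R) | link_projection D}.

(* The left-hand side has two strands bounding a bigon, which is removed. *)
Definition self_tangency (D D' : set (R * R)) : Prop :=
  exists E, [/\ diffeo E, D = fill E ([:: ord0; ord0] : tw_word 2) D &
                D' = fill E ([::] : tw_word 2) D].

Inductive rondle_eqv : projection -> projection -> Prop :=
| req_diffeo (D D' : projection) phi :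
    diffeo phi -> compactly_supported phi ->
    sval D' = phi @` sval D -> rondle_eqv D D'
| req_self_tangency (D D' : projection) :
    self_tangency (sval D) (sval D') -> rondle_eqv D D'
| req_refl D : rondle_eqv D D
| req_sym D D' : rondle_eqv D D' -> rondle_eqv D' D
| req_trans D1 D2 D3 : rondle_eqv D1 D2 -> rondle_eqv D2 D3 -> rondle_eqv D1 D3.

Definition rondle : Type :=
  {C : set projection | exists D, C = [set D' | rondle_eqv D D']}.

Definition rondle_of (D : projection) : rondle :=
  exist _ [set D' | rondle_eqv D D'] (ex_intro _ D erefl).

(* Only the part of [outside] off the disc matters.  Filling the disc with one
   configuration gives a link projection if and only if filling it with any
   other one does, all of them being vertical near their endpoints. *)
Record tangle (k : nat) := Tangle {
  tangle_disc : R * R -> R * R ;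
  tangle_outside : set (R * R) ;
  tangle_diffeo : diffeo tangle_disc ;
  tangle_fill : forall w : tw_word k,
    link_projection (fill tangle_disc w tangle_outside) }.

(* The value does not depend on the word chosen to represent [p]. *)
Definition tangle_map (k : nat) (T : tangle k) (p : twin k) : rondle :=
  rondle_of (exist _ _ (tangle_fill T (repr p))).

Definition differ_by (k : nat) (p : twin k) (C C' : rondle) : Prop :=
  exists (T : tangle k) (x : twin k),
    C = tangle_map T x /\ C' = tangle_map T (p * x)%g.

Definition simplex : set (R * R) :=
  [set z | [/\ 0 <= z.1, 0 <= z.2 & z.1 + z.2 <= 1]].
Definition simplex_interior : set (R * R) :=
  [set z | [/\ 0 < z.1, 0 < z.2 & z.1 + z.2 < 1]].
Definition simplex_vertices : set (R * R) := [set (0, 0); (1, 0); (0, 1)].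

Definition triangle (D Delta : set (R * R)) : Prop :=
  exists h : R * R -> R * R,
    [/\ {within simplex, continuous h}, set_inj simplex h &
        Delta = h @` simplex] /\
    [/\ forall z, simplex_interior z -> ~ D (h z),
        forall z, (simplex `\` simplex_interior) z -> D (h z) &
        forall z, (simplex `\` simplex_interior) z ->
          (double_point D (h z) <-> simplex_vertices z)].

(* A disc around the triangle [Delta] of [D] in which [D] consists of the three
   strands of the configuration [s_1 s_2 s_1].  The opposite form [s_2 s_1 s_2]
   is obtained by composing [E] with a half-turn. *)
Definition triangle_frame (D Delta : set (R * R)) (E : R * R -> R * R) : Prop :=
  [/\ diffeo E, D = fill E ([:: ord0; ord_max; ord0] : tw_word 3) D &
      Delta `<=` E @` box 3].

(* [D_s]: [s_1 s_2 s_1] is replaced by [s_2 s_1 s_2] in the discs of [s]. *)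
Definition triple_point_modification (N : nat) (D : set (R * R))
    (E : 'I_N -> R * R -> R * R) (s : {set 'I_N}) : set (R * R) :=
  (D `\` \bigcup_(j in [set` s]) (E j @` box 3)) `|`
  \bigcup_(j in [set` s])
     (E j @` config ([:: ord_max; ord0; ord_max] : tw_word 3)).

(* Two triangles share no vertex, edge or face if and only if they are disjoint
   as (closed) sets.  Disjoint triangles have frames with disjoint discs; the
   projections [Ds s] are determined by [D] and the frames. *)
Definition vanishing (A : zmodType) (f : rondle -> A) (N : nat) : Prop :=
  forall (D : projection) (Delta : 'I_N -> set (R * R))
      (E : 'I_N -> R * R -> R * R) (Ds : {set 'I_N} -> projection),
    (forall j, triangle (sval D) (Delta j)) ->
    (forall i j, i != j -> Delta i `&` Delta j = set0) ->
    (forall j, triangle_frame (sval D) (Delta j) (E j)) ->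
    (forall i j, i != j -> E i @` box 3 `&` E j @` box 3 = set0) ->
    (forall s, sval (Ds s) = triple_point_modification (sval D) E s) ->
    \sum_(s : {set 'I_N}) f (rondle_of (Ds s)) *~ (-1) ^+ #|s| = 0.

Definition has_order (A : zmodType) (f : rondle -> A) (m : nat) : Prop :=
  vanishing f m.+1 /\
  forall N, (0 < N)%N -> (N <= m)%N -> ~ vanishing f N.

End Rondles.

(* Main.v *)
Require Import Defs.
From HB Require Import structures.
From mathcomp Require Import all_boot all_order all_algebra all_fingroup.
From mathcomp Require Import all_classical all_reals all_analysis.
From mathcomp Require Import generic_quotient zify ring lra.
Set Implicit Arguments.
Unset Strict Implicit.
Unset Printing Implicit Defensive.
Import Order.TTheory GRing.Theory Num.Theory.
Import numFieldNormedType.Exports.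
Local Open Scope classical_set_scope.
Local Open Scope ring_scope.

(** The tangle map turns the rondle invariant [f] into the function
    [F x = f (tangle_map T x)] on the twin group, extended by linearity to its
    integral group ring.  Let [I] be the two-sided ideal generated by the
    differences [s_i s_j s_i - s_j s_i s_j] with [i], [j] adjacent.

    Algebra.  A twin that one Yang-Baxter relation reduces to 1 is
    [u t v] with [u t' v = 1], so it lies in [1 + I], and so does the group that
    such twins generate.  The commutator identity
    [xyx^-1y^-1 - 1 = ((x - 1)(y - 1) - (y - 1)(x - 1))x^-1y^-1] then puts the
    [n]-th term of the lower central series in [1 + I^n] ([lcs_unipotent]).
    Hence [F (p x) = F x] as soon as [F] vanishes on [I^N] for some [N <= n]
    ([kills_unipotent]); [N - 1] will be the order of [f].

    Geometry.  An element of [I^N] is a combination of alternating sums over the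
    [2^N] ways of choosing a side in each of [N] Yang-Baxter subwords of a word.
    These words have the same length, so their standard configurations differ
    only in [N] rectangles, each containing a triangle, and are related by
    triple-point modifications there: with suitable frames the modified
    projections are exactly the fillings of the tangle by the modified words
    ([fill_modification]), and the [N]-vanishing condition kills the alternating
    sum ([alt_sum_vanishing]).

    Three facts about plane curves support this.
    - The rondle obtained by filling a tangle depends only on the twin
      ([tw_eqv_requiv]).  A single crossing can be slid vertically by a compactly
      supported diffeomorphism as long as it meets no crossing of a neighbouring
      letter ([slide]).  Slides exchange distant letters, and spread the
      crossings over layers of equal heights after a self-tangency has removed
      a pair of equal letters.
    - The diffeomorphisms used are [(x, y) |-> (x, F (x, y))] with [F] increasing
      in [y] at a rate bounded below ([shear_diffeo]); they are built from the
      smooth step that also draws the crossings.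
    - In the configuration of [s_1 s_2 s_1] there is a triangle
      ([exists_triangle]).  Double points being defined from a parametrization
      by circles, one has to show that a transverse crossing of the image has
      two preimages ([transverse_graphs_double]), and that a point near which
      the image is a graph has only one ([graph_not_double]). *)

(** * Smooth maps *)

Section SmoothCalculus.
Variable R : realType.
Implicit Types V W U : normedModType R.

(** Smoothness up to a given order, so that closure properties can be proved by
    induction on the order. *)
Fixpoint Ck V W (n : nat) (f : V -> W) : Prop :=
  (forall x, differentiable f x) /\
  if n is n'.+1 then forall v, Ck n' (fun x => 'D_v f x) else True.

Lemma Ck_diff V W n (f : V -> W) x : Ck n f -> differentiable f x.
Proof. by case: n => [|n] []. Qed.

Lemma CkS V W n (f : V -> W) : Ck n.+1 f -> Ck n f.
Proof.
elim: n f => [|n IH] f [fd fD]; split => // v; exact/IH/fD.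
Qed.

Lemma smoothP V W (f : V -> W) : smooth f <-> forall n, Ck n f.
Proof.
split=> [sf n|Cf vs x].
  have H : forall vs x, differentiable (Defs.iterD vs f) x by [].
  elim: n f H {sf} => [|n IH] f H; split => //; try exact: (H [::]).
  by move=> v; apply: IH => vs; exact: (H (v :: vs)).
have {}Cf : Ck (size vs) f by [].
elim: vs f Cf => [|v vs IH] f /= [df Df]; first exact: df.
exact/IH/Df.
Qed.

Lemma Ck_ext V W n (f g : V -> W) : f =1 g -> Ck n f -> Ck n g.
Proof. by move=> /funext ->. Qed.

Lemma Ck_cst V W n (a : W) : Ck n (cst a : V -> W).
Proof.
elim: n a => [|n IH] a; split => // v.
by apply: (Ck_ext _ (IH 0)) => x; rewrite derive_cst.
Qed.

Lemma Ck_D V W n (f g : V -> W) : Ck n f -> Ck n g -> Ck n (fun x => f x + g x).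
Proof.
elim: n f g => [|n IH] f g [df Df] [dg Dg].
  by split=> // x; exact: differentiableD.
split=> [x|v]; first exact: differentiableD.
apply: (Ck_ext _ (IH _ _ (Df v) (Dg v))) => x.
by rewrite -deriveD //; exact: diff_derivable.
Qed.

Lemma Ck_lin_out V W U n (L : {linear W -> U}) (f : V -> W) :
  continuous L -> Ck n f -> Ck n (fun x => L (f x)).
Proof.
move=> cL; have dL y : differentiable L y by exact: linear_differentiable.
elim: n f => [|n IH] f [df Df].
  by split=> // x; exact: differentiable_comp.
split=> [x|v]; first exact: differentiable_comp.
apply: (Ck_ext _ (IH _ (Df v))) => x.
rewrite [RHS]deriveE; last exact: differentiable_comp.
by rewrite diff_comp //= diff_lin //= deriveE.
Qed.

(** The inner map is affine, so the chain rule only renames directions. *)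
Lemma Ck_aff_in V W U n (L : {linear V -> W}) (c : W) (f : W -> U) :
  continuous L -> Ck n f -> Ck n (fun x => f (L x + c)).
Proof.
move=> cL; have dL y : differentiable (fun x => L x + c) y.
  by apply: differentiableD => //; exact: linear_differentiable.
elim: n f => [|n IH] f [df Df].
  by split=> // x; exact: (differentiable_comp (dL x)).
split=> [x|v]; first exact: (differentiable_comp (dL x)).
apply: (Ck_ext _ (IH _ (Df (L v)))) => x.
rewrite [RHS]deriveE; last exact: (differentiable_comp (dL x)).
rewrite (diff_comp (dL x)) //= deriveE //.
congr ('d _ _ _).
rewrite (@diffD _ _ _ L (cst c)) ?diff_cst //; last exact: linear_differentiable.
by rewrite /= diff_lin //= addr0.
Qed.


Lemma Ck_M V n (f g : V -> R^o) :
  Ck n f -> Ck n g -> Ck n ((fun x => f x * g x) : V -> R^o).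
Proof.
elim: n f g => [|n IH] f g Cf Cg; case: (Cf) (Cg) => df Df [dg Dg].
  by split=> // x; exact: differentiableM.
split=> [x|v]; first exact: differentiableM.
have := Ck_D (IH _ _ (CkS Cf) (Dg v)) (IH _ _ (CkS Cg) (Df v)).
by apply: Ck_ext => x; rewrite -deriveM //; exact: diff_derivable.
Qed.

Lemma Ck_V V n (f : V -> R^o) : (forall x, f x != 0) ->
  Ck n f -> Ck n ((fun x => (f x)^-1) : V -> R^o).
Proof.
move=> f0; elim: n => [|n IH] Cf; case: (Cf) => df Df.
  by split=> // x; exact: differentiableV.
split=> [x|v]; first exact: differentiableV.
have Cf' := IH (CkS Cf).
have := Ck_M (Ck_M (Ck_cst V n (-1 : R^o)) (Ck_M Cf' Cf')) (Df v).
apply: Ck_ext => x; rewrite deriveV //; last exact: diff_derivable.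
by rewrite /cst mulN1r -expr2 exprVn /GRing.scale /= expr2.
Qed.

Definition inl_pair V W (x : V) : V * W := (x, 0).
Definition inr_pair V W (x : W) : V * W := (0, x).

Fact inl_pair_linear V W : linear (@inl_pair V W).
Proof. by move=> a x y; congr pair; rewrite /= ?scaler0 ?addr0. Qed.
Fact inr_pair_linear V W : linear (@inr_pair V W).
Proof. by move=> a x y; congr pair; rewrite /= ?scaler0 ?addr0. Qed.
HB.instance Definition _ V W := GRing.isLinear.Build R V (V * W)%type _
  (@inl_pair V W) (@inl_pair_linear V W).
HB.instance Definition _ V W := GRing.isLinear.Build R W (V * W)%type _
  (@inr_pair V W) (@inr_pair_linear V W).

Lemma continuous_inl_pair V W : continuous (@inl_pair V W).
Proof. by move=> x; apply: cvg_pair => //; exact: cvg_cst. Qed.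

Lemma continuous_inr_pair V W : continuous (@inr_pair V W).
Proof. by move=> x; apply: cvg_pair => //; exact: cvg_cst. Qed.

Lemma Ck_pair V W U n (f : V -> W) (g : V -> U) :
  Ck n f -> Ck n g -> Ck n (fun x => (f x, g x)).
Proof.
move=> Cf Cg.
have := Ck_D (Ck_lin_out (@continuous_inl_pair W U) Cf)
  (Ck_lin_out (@continuous_inr_pair W U) Cg).
by apply: Ck_ext => x; congr pair; rewrite /= ?addr0 ?add0r.
Qed.

Lemma Ck_fst V W U n (f : V -> (W * U)%type) : Ck n f -> Ck n (fun x => (f x).1).
Proof.
apply: (Ck_lin_out (L := fst)) => x.
exact: cvg_fst.
Qed.

Lemma Ck_snd V W U n (f : V -> (W * U)%type) : Ck n f -> Ck n (fun x => (f x).2).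
Proof.
apply: (Ck_lin_out (L := snd)) => x.
exact: cvg_snd.
Qed.

Lemma Ck_id V n : Ck n (id : V -> V).
Proof.
case: n => [|n]; split => // v.
by apply: (Ck_ext _ (Ck_cst V n v)) => x; rewrite derive_id.
Qed.

(** Induction on the order: by the chain rule a partial derivative of [f \o g]
    is a sum of products of functions that are one order less smooth. *)
Lemma Ck_comp V n (f : R^o * R^o -> R^o) (g : V -> (R^o * R^o)%type) :
  Ck n f -> Ck n g -> Ck n ((fun x => f (g x)) : V -> R^o).
Proof.
elim: n f g => [|n IH] f g Cf Cg; case: (Cf) (Cg) => df Df [dg Dg].
  by split=> // x; exact: differentiable_comp.
split=> [x|v]; first exact: differentiable_comp.
have Cg' := CkS Cg.
have := Ck_D (Ck_M (Ck_fst (Dg v)) (IH _ _ (Df (1, 0)) Cg'))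
             (Ck_M (Ck_snd (Dg v)) (IH _ _ (Df (0, 1)) Cg')).
apply: Ck_ext => x.
rewrite [RHS]deriveE; last exact: differentiable_comp.
rewrite diff_comp //= (deriveE _ (df _)) (deriveE _ (df _)).
have -> : 'd g x v = ('D_v g x).1 *: (1, 0) + ('D_v g x).2 *: (0, 1).
  rewrite deriveE //; case: ('d g x v) => a b /=.
  rewrite -[RHS]/(a * 1 + b * 0, a * 0 + b * 1).
  by rewrite !(mulr1, mulr0, addr0, add0r).
by rewrite linearD !linearZ.
Qed.

End SmoothCalculus.

Section Differential.
Variable R : realType.
Implicit Types V W U : normedModType R.

Lemma differentiable_eps V W (f : V -> W) x : differentiable f x ->
  forall e : R, 0 < e ->
    \forall h \near (0 : V), `|f (h + x) - f x - 'd f x h| <= e * `|h|.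
Proof.
move=> df e e0; have /eqaddoP/(_ e e0) := diff_locally df.
apply: filterS => h.
have -> // : (f \o shift x - (cst (f x) + 'd f x)) h = f (h + x) - f x - 'd f x h.
by rewrite /= opprD addrA.
Qed.

Lemma eps_differentiable V W (f : V -> W) (L : {linear V -> W}) x :
  continuous L ->
  (forall e : R, 0 < e ->
    \forall h \near (0 : V), `|f (h + x) - f x - L h| <= e * `|h|) ->
  differentiable f x /\ 'd f x = L :> (V -> W).
Proof.
move=> cL H.
have E : f \o shift x = cst (f x) + L +o_ (0 : V) id.
  apply/eqaddoE/eqaddoP => e e0; apply: filterS (H e e0) => h.
  have -> // : (f \o shift x - (cst (f x) + L)) h = f (h + x) - f x - L h.
  by rewrite /= opprD addrA.
have := diff_unique cL E => dE; split => //.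
by apply/diff_locallyP; rewrite dE.
Qed.

End Differential.

Section Flat.
Variable R : realType.
Implicit Types (p : {poly R}) (x t : R).

Local Notation flat := (@flat R).

Lemma flat_ge0 x : 0 <= flat x.
Proof. by rewrite /flat; case: ifP => // _; exact: expR_ge0. Qed.

Lemma flat_gt0 x : (0 < flat x) = (0 < x).
Proof. by rewrite /flat; case: ifP => // _; rewrite ?expR_gt0 ?ltxx. Qed.

Lemma flat_le0 x : x <= 0 -> flat x = 0.
Proof. by rewrite /flat leNgt => /negbTE ->. Qed.

Lemma flat_homo x t : x <= t -> flat x <= flat t.
Proof.
have [x0|x0 xt] := leP x 0; first by rewrite flat_le0 ?flat_ge0.
rewrite /flat x0 (lt_le_trans x0 xt) ler_expR lerN2 lef_pV2 // posrE //.
exact: lt_le_trans x0 xt.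
Qed.

Lemma expn_le_expR n t : 0 <= t -> t ^+ n <= n`!%:R * expR t.
Proof.
move=> t0; case: n => [|n].
  by rewrite expr0 fact0 mul1r -expR0 ler_expR.
have := expR_ge1Dxn n t0.
have f0 : 0 < n.+1`!%:R :> R by rewrite ltr0n fact_gt0.
move=> H; have : t ^+ n.+1 / n.+1`!%:R <= expR t.
  by apply: le_trans H; rewrite lerDr.
by rewrite ler_pdivrMr // mulrC.
Qed.

Lemma horner_le_expR p : exists2 C : R, 0 <= C &
  forall t, 0 <= t -> `|p.[t]| <= C * expR t.
Proof.
exists (\sum_(i < size p) `|p`_i| * i`!%:R).
  by apply: sumr_ge0 => i _; rewrite mulr_ge0.
move=> t t0; rewrite horner_coef mulr_suml.
apply: (le_trans (ler_norm_sum _ _ _)); apply: ler_sum => i _.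
rewrite normrM -mulrA ler_wpM2l // ger0_norm ?exprn_ge0 //.
exact: expn_le_expR.
Qed.

(** The products [p(1/x) flat(x)], with [p] a polynomial, are closed under
    derivation; this is what makes [flat] smooth at 0. *)
Definition pflat p x : R := p.[x^-1] * flat x.

Lemma pflat_le0 p x : x <= 0 -> pflat p x = 0.
Proof. by move=> x0; rewrite /pflat flat_le0 // mulr0. Qed.

(** The exponential dominates the polynomial [p(t) t^2] at [t = 1/x]. *)
Lemma pflat_bound p : exists2 C : R, 0 <= C & forall x, `|pflat p x| <= C * x ^+ 2.
Proof.
have [C C0 H] := horner_le_expR (p * 'X^2); exists C => // x.
have [x0|x0] := leP x 0.
  by rewrite pflat_le0 // normr0 mulr_ge0 // sqr_ge0.
have := H x^-1; rewrite invr_ge0 (ltW x0) => /(_ isT).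
rewrite hornerM hornerXn normrM (@ger0_norm _ (x^-1 ^+ 2));
  last by rewrite exprn_ge0 // invr_ge0 ltW.
move=> Hx; rewrite /pflat /flat x0 normrM (ger0_norm (expR_ge0 _)) expRN.
rewrite ler_pdivrMr ?expR_gt0 // -mulrA [_ ^+ 2 * _]mulrC mulrA.
by rewrite -ler_pdivrMr ?exprn_gt0 // -exprVn.
Qed.

Lemma pflat_derive p x : is_derive x 1 (pflat p) (pflat ('X^2 * (p - p^`())) x).
Proof.
have [x0|x0|->] := ltgtP x 0.
- rewrite pflat_le0; last exact: ltW.
  apply: (@near_eq_is_derive _ _ _ (cst 0)).
  near=> y; rewrite /= pflat_le0 // ltW //.
  by near: y; exact: lt_nbhsl.
- have E : \near x, p.[x^-1] * expR (- x^-1) = pflat p x.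
    near=> y; rewrite /pflat /flat ifT //.
    by near: y; exact: lt_nbhsr.
  have dV : is_derive x 1 (fun y : R => y^-1) (- x ^- 2).
    apply: is_derive_eq (is_deriveV _ _) _ => //=; last by rewrite scaler1.
    by rewrite gt_eqF.
  have dp := is_derive1_comp (is_derive_poly p x^-1) dV.
  have dN : is_derive x 1 (fun y : R => - y^-1) (- - x ^- 2) := is_deriveN dV.
  have de : is_derive x 1 (expR \o (fun y : R => - y^-1)) _ :=
    @is_derive1_comp R expR (fun y : R => - y^-1) x _ _ (is_derive_expR _) dN.
  apply: (near_eq_is_derive E); apply: is_derive_eq (is_deriveM dp de) _.
  rewrite /pflat /flat x0 /= hornerM hornerXn hornerD hornerN.
  by rewrite /GRing.scale /=; rewrite -exprVn; ring.
(* at 0 the difference quotient is O(h), since [pflat p h] is O(h^2) *)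
rewrite pflat_le0 //.
have [C C0 H] := pflat_bound p.
suff HH : h^-1 *: (pflat p (h *: 1 + 0) - pflat p 0) @[h --> 0^'] --> (0 : R).
  by split; [apply/cvg_ex; exists 0 | exact/cvg_lim].
apply: norm_cvg0.
apply: (@squeeze_cvgr _ _ _ _ (cst 0) (fun h : R => C * `|h|)); last 2 first.
- exact: cvg_cst.
- rewrite -[X in _ --> X](mulr0 C); apply: cvgM; first exact: cvg_cst.
  rewrite -[X in _ --> X](@normr0 _ R); apply: cvg_norm.
  by apply: nbhs_dnbhs.
near=> h; rewrite normr_ge0 /= (pflat_le0 p (lexx 0)) subr0 addr0.
rewrite /GRing.scale /= mulr1 normrM normfV.
have h0 : 0 < `|h| by rewrite normr_gt0; near: h; exact: nbhs_dnbhs_neq.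
rewrite mulrC ler_pdivrMr // -mulrA -expr2 (le_trans (H _)) //.
by rewrite real_normK // num_real.
Unshelve. all: by end_near. Qed.

Lemma Ck_pflat n p : Ck n (pflat p : R^o -> R^o).
Proof.
elim: n p => [|n IH] p.
  split => // x; apply/derivable1_diffP.
  by have [] := pflat_derive p x.
split => [x|v].
  by apply/derivable1_diffP; have [] := pflat_derive p x.
have := Ck_M (Ck_cst _ n (v : R^o)) (IH ('X^2 * (p - p^`()))).
apply: Ck_ext => x.
have dx : differentiable (pflat p : R^o -> R^o) x.
  by apply/derivable1_diffP; have [] := pflat_derive p x.
rewrite [RHS]deriveE // -[v in 'd _ _ v]mulr1 [RHS]linearZ -deriveE //.
by have [_ ->] := pflat_derive p x.
Qed.

Lemma flatE : flat =1 pflat 1.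
Proof. by move=> x; rewrite /pflat hornerC mul1r. Qed.

Lemma Ck_flat n : Ck n (flat : R^o -> R^o).
Proof. by apply: (Ck_ext _ (Ck_pflat n 1)) => x; rewrite flatE. Qed.

Lemma flat_derive x : is_derive x 1 flat (x^-1 ^+ 2 * flat x).
Proof.
have -> : flat = pflat 1 by apply/funext => y; rewrite flatE.
apply: is_derive_eq (pflat_derive 1 x) _.
by rewrite /pflat derivC subr0 mulr1 hornerXn hornerC mul1r.
Qed.

End Flat.

Section Step.
Variable R : realType.
Implicit Types (x y t : R).

Local Notation flat := (@flat R).
Local Notation step := (@step R).

Lemma step_den_gt0 t : 0 < flat (3 * t - 1) + flat (2 - 3 * t).
Proof.
have [t0|t0] := ltP 0 (3 * t - 1).
  by rewrite ltr_wpDr ?flat_ge0 ?flat_gt0.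
by rewrite ltr_wpDl ?flat_ge0 ?flat_gt0 //; lra.
Qed.

Lemma step_low t : t <= 3^-1 -> step t = 0.
Proof. by move=> t0; rewrite /step flat_le0 ?mul0r //; lra. Qed.

Lemma step_high t : 2 / 3 <= t -> step t = 1.
Proof.
move=> t0; have := step_den_gt0 t; rewrite /step (@flat_le0 _ (2 - _)); last lra.
by rewrite addr0 => /lt0r_neq0 /divff.
Qed.

Lemma step_sym t : step (1 - t) = 1 - step t.
Proof.
rewrite /step.
have -> : 3 * (1 - t) - 1 = 2 - 3 * t by ring.
have -> : 2 - 3 * (1 - t) = 3 * t - 1 by ring.
rewrite [flat (2 - _) + _]addrC; have /lt0r_neq0 := step_den_gt0 t.
by move=> ?; field.
Qed.

Lemma step_ge0 t : 0 <= step t.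
Proof. by rewrite divr_ge0 ?flat_ge0 // ltW // step_den_gt0. Qed.

Lemma step_le1 t : step t <= 1.
Proof. by have := step_ge0 (1 - t); rewrite step_sym subr_ge0. Qed.

Lemma step_homo x y : x <= y -> step x <= step y.
Proof.
move=> xy; rewrite /step ler_pdivrMr ?step_den_gt0 // mulrAC.
rewrite ler_pdivlMr ?step_den_gt0 // !mulrDr mulrC lerD2l.
by apply: ler_pM; rewrite ?flat_ge0 //; apply: flat_homo; lra.
Qed.

Lemma step_half : step 2^-1 = 2^-1.
Proof.
have := step_sym 2^-1; have -> : 1 - 2^-1 = 2^-1 :> R by lra.
by move=> ?; lra.
Qed.

Lemma step_lt_half t : t < 2^-1 -> step t < 2^-1.
Proof.
move=> t2; rewrite ltr_pdivrMr ?step_den_gt0 //.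
suff : flat (3 * t - 1) < flat (2 - 3 * t) by lra.
have [t0|t0] := ltP 0 (3 * t - 1); last first.
  by rewrite flat_le0 // flat_gt0; lra.
rewrite /flat t0 ifT; last lra.
by rewrite ltr_expR ltrN2 ltf_pV2 ?posrE //; lra.
Qed.

Lemma step_gt_half t : 2^-1 < t -> 2^-1 < step t.
Proof.
move=> t2; have := @step_lt_half (1 - t); rewrite step_sym => H.
by have := H _; lra.
Qed.

Lemma Ck_step n : Ck n (step : R^o -> R^o).
Proof.
have C3 (a b : R) : Ck n ((fun x => flat (a * x + b)) : R^o -> R^o).
  apply: (Ck_aff_in (L := *:%R a)) (Ck_flat R n).
  exact: scaler_continuous.
have C31 := C3 3 (-1).
have C32 := C3 (-3) 2.
have C33 : Ck n ((fun x => flat (2 - 3 * x)) : R^o -> R^o).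
  by apply: (Ck_ext _ C32) => x; congr flat; ring.
apply: Ck_M => //; apply: Ck_V; last exact: Ck_D.
by move=> x; rewrite lt0r_neq0 // step_den_gt0.
Qed.

Lemma step_derive_half : is_derive (2^-1 : R) 1 step 6.
Proof.
set A := fun x => flat (3 * x - 1); set B := fun x => flat (2 - 3 * x).
have dA : is_derive (2^-1 : R) 1 A (12 * flat 2^-1).
  have := @is_derive1_comp _ flat (fun x => 3 * x - 1) 2^-1 _ 3 (flat_derive _).
  have -> : 3 * 2^-1 - 1 = 2^-1 :> R by lra.
  rewrite invrK => H; apply: is_derive_eq (H _) _; last by ring.
  by apply: is_derive_eq; rewrite subr0 scaler1.
have dB : is_derive (2^-1 : R) 1 B (- 12 * flat 2^-1).
  have := @is_derive1_comp _ flat (fun x => 2 - 3 * x) 2^-1 _ (- 3) (flat_derive _).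
  have -> : 2 - 3 * 2^-1 = 2^-1 :> R by lra.
  rewrite invrK => H; apply: is_derive_eq (H _) _; last by ring.
  by apply: is_derive_eq; rewrite !scaler1 add0r mul1r.
have D0 : (A + B) 2^-1 != 0 by rewrite lt0r_neq0 // step_den_gt0.
have := is_deriveM dA (is_deriveV D0 (is_deriveD dA dB)).
have -> : A * (fun y => ((A + B) y)^-1) = step by [].
have AE : A 2^-1 = flat 2^-1 by congr flat; lra.
have BE : B 2^-1 = flat 2^-1 by congr flat; lra.
have -> : (A + B) 2^-1 = 2 * flat 2^-1.
  by rewrite -[LHS]/(A 2^-1 + B 2^-1) AE BE; ring.
move=> H; apply: is_derive_eq H _; rewrite AE /GRing.scale /=.
have : flat 2^-1 != 0 by rewrite lt0r_neq0 // flat_gt0; lra.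
by move=> ?; field.
Qed.

End Step.

(** * Vertical diffeomorphisms *)

Section Shear.
Variable R : realType.
Local Notation plane := (R^o * R^o)%type.
Implicit Types (x y : R) (z : plane).

(** The solution [g] of the equation [a h1 + b^-1 g = h2], linear in [(h1, h2)]. *)
Definition solve_lin (a b : R) (h : plane) : R^o := b * (h.2 - a * h.1).

Fact solve_lin_linear a b : linear (solve_lin a b).
Proof.
move=> r h k; rewrite /solve_lin.
rewrite -[(r *: h + k).1]/(r * h.1 + k.1) -[(r *: h + k).2]/(r * h.2 + k.2).
have E (h1 h2 k1 k2 : R) : b * (r * h2 + k2 - a * (r * h1 + k1)) =
  r * (b * (h2 - a * h1)) + b * (k2 - a * k1) by ring.
exact: E.
Qed.
HB.instance Definition _ a b := GRing.isLinear.Build R plane R^o _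
  (solve_lin a b) (solve_lin_linear a b).

Lemma solve_lin_continuous a b : continuous (solve_lin a b).
Proof.
move=> h; apply: cvgMr; apply: cvgB; first exact: cvg_snd.
by apply: cvgMr; exact: cvg_fst.
Qed.

Variables (F : plane -> R^o) (c : R).
Hypothesis c_gt0 : 0 < c.
Hypothesis CF : forall n, Ck n F.
Hypothesis F_incr : forall x y1 y2, y1 <= y2 ->
  c * (y2 - y1) <= F (x, y2) - F (x, y1).

Let dF z : differentiable F z. Proof. exact: Ck_diff (CF 0). Qed.

Lemma F_expanding x y1 y2 : c * `|y2 - y1| <= `|F (x, y2) - F (x, y1)|.
Proof.
wlog le12 : y1 y2 / y1 <= y2.
  move=> H; have [|/ltW] := leP y1 y2; first exact: H.
  by move=> /H; rewrite distrC [X in _ <= X]distrC.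
have y12 := F_incr x le12.
by rewrite ger0_norm ?subr_ge0 // (le_trans y12) // ler_norm.
Qed.

Lemma F_surj z : exists y, F (z.1, y) = z.2.
Proof.
case: z => x y /=; set M := `|y - F (x, 0)| / c.
have M0 : 0 <= M by rewrite divr_ge0 // ltW.
have cM : c * M = `|y - F (x, 0)| by rewrite /M mulrC divfK // gt_eqF.
have hi := F_incr x M0; have /(F_incr x) lo : - M <= 0 by rewrite oppr_le0.
have NM : - M <= M by lra.
have cts : {within `[- M, M], continuous (fun y => F (x, y))}.
  apply: continuous_subspaceT => u.
  have C := Ck_comp (CF 0) (Ck_pair (Ck_cst R^o 0 (x : R^o)) (Ck_id R^o 0)).
  exact: differentiable_continuous (Ck_diff u C).
have hle := ler_norm (y - F (x, 0)).
have hge : - (y - F (x, 0)) <= c * M by rewrite cM -normrN; exact: ler_norm.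
rewrite -cM in hle.
rewrite subr0 in hi; rewrite sub0r opprK in lo.
have [|u _ <-] := IVT NM cts (v := y); last by exists u.
rewrite ge_min le_max; apply/andP; split.
  by apply/orP; left; lra.
by apply/orP; right; lra.
Qed.

Definition Finv z : R^o := projT1 (cid (F_surj z)).

Lemma FinvK z : F (z.1, Finv z) = z.2.
Proof. by rewrite /Finv; case: cid. Qed.

Lemma F_inj x y1 y2 : F (x, y1) = F (x, y2) -> y1 = y2.
Proof.
move=> E; have := F_expanding x y2 y1; rewrite E subrr normr0 pmulr_rle0 //.
by rewrite normr_le0 subr_eq0 => /eqP.
Qed.

Lemma FK z : Finv (z.1, F z) = z.2.
Proof. by apply: (@F_inj z.1); rewrite (FinvK (z.1, F z)); case: z. Qed.

Let a z : R := 'D_(1, 0) F (z.1, Finv z).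
Let b z : R := 'D_(0, 1) F (z.1, Finv z).

Lemma diff_planeE z h : 'd F z h = h.1 * 'D_(1, 0) F z + h.2 * 'D_(0, 1) F z.
Proof.
rewrite !deriveE //.
have {1}-> : h = h.1 *: (1, 0) + h.2 *: (0, 1).
  case: h => u v; rewrite -[RHS]/(u * 1 + v * 0, u * 0 + v * 1).
  by rewrite !(mulr1, mulr0, addr0, add0r).
by rewrite linearD !linearZ.
Qed.

Lemma vertical_derivative_gt0 z : 0 < 'D_(0, 1) F z.
Proof.
have c2 : 0 < c / 2 by rewrite divr_gt0.
have /nbhs_ballP[d d0' H] := differentiable_eps (dF z) c2.
have d0 : (0 : R) < d := d0'.
have d2 : `|d / 2| = d / 2 by rewrite ger0_norm //; lra.
have /H /= : ball (0 : plane) d (0, d / 2).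
  by split => /=; rewrite -ball_normE /= sub0r normrN ?normr0 ?d2 //; lra.
rewrite diff_planeE /= mul0r add0r.
have -> : `|(0, d / 2) : plane| = d / 2.
  by rewrite prod_normE /= normr0 d2 max_r //; lra.
have d20 : z.2 <= d / 2 + z.2 by lra.
have := F_incr z.1 d20.
have -> : (z.1, z.2) = z by case: (z).
have -> : (0, d / 2) + z = (z.1, d / 2 + z.2) :> plane.
  by rewrite -[LHS]/(0 + z.1, d / 2 + z.2) add0r.
rewrite addrK; set u := F _ - F _ => ule.
rewrite ler_norml => /andP[_ h2].
have : 0 < d / 2 * 'D_(0, 1) F z by nra.
by rewrite pmulr_rgt0 //; lra.
Qed.

(** [F] expands vertical distances, so [Finv] is Lipschitz; then the first
    order expansion of [F] at [(z.1, Finv z)] can be solved for [Finv]. *)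
Lemma diff_Finv z : differentiable Finv z /\
  'd Finv z = solve_lin (a z) (b z)^-1 :> (plane -> R^o).
Proof.
apply: eps_differentiable; first exact: solve_lin_continuous.
move=> e e0; set p : plane := (z.1, Finv z).
have b0 : 0 < b z by exact: vertical_derivative_gt0.
set K := (`|a z| + 2) / c.
have K0 : 0 <= K by rewrite divr_ge0 ?(ltW c_gt0) // addr_ge0.
have Fp : F p = z.2 by exact: FinvK.
pose k (h : plane) : plane := (h.1, Finv (h + z) - Finv z).
have kE h : k h + p = ((h + z).1, Finv (h + z)).
  by rewrite -[LHS]/(h.1 + z.1, Finv (h + z) - Finv z + Finv z) subrK.
have Lip : \forall h \near (0 : plane), `|k h| <= (1 + K) * `|h|.
  have C := Ck_pair (Ck_fst (Ck_id plane 0)) (Ck_cst plane 0 (0 : R^o)).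
  have inj0 := differentiable_continuous (Ck_diff (0 : plane) C).
  have Hn : \forall h \near (0 : plane),
      `|F ((h.1, 0) + p) - F p - 'd F p (h.1, 0)| <= 1 * `|(h.1, 0) : plane|.
    exact: inj0 _ (differentiable_eps (dF p) ltr01).
  apply: (@filterS _ (nbhs (0 : plane)) _ _ _ _ Hn) => h Hh.
  have h1 : `|h.1| <= `|h| by rewrite prod_normE le_max lexx.
  have h2 : `|h.2| <= `|h| by rewrite prod_normE le_max lexx orbT.
  have n1 : `|(h.1, 0) : plane| = `|h.1|.
    by rewrite prod_normE /= normr0 max_l.
  rewrite diff_planeE /= mul0r addr0 n1 mul1r in Hh.
  have E : (h.1, 0) + p = ((h + z).1, Finv z) :> plane.
    by rewrite -[LHS]/(h.1 + z.1, 0 + Finv z) add0r.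
  rewrite {}E in Hh.
  have ex := F_expanding (h + z).1 (Finv z) (Finv (h + z)).
  have Fz : F ((h + z).1, Finv (h + z)) = h.2 + z.2 by rewrite FinvK.
  rewrite Fz Fp -/(a z) in Hh ex.
  set u := F _ in Hh ex.
  have uz : `|u - z.2| <= (`|a z| + 1) * `|h|.
    have -> : u - z.2 = (u - z.2 - h.1 * a z) + h.1 * a z by rewrite subrK.
    apply: (le_trans (ler_normD _ _)); rewrite normrM.
    have := ler_wpM2r (normr_ge0 (a z)) h1.
    by nra.
  have kl : c * `|Finv (h + z) - Finv z| <= (`|a z| + 2) * `|h|.
    apply: (le_trans ex).
    have -> : h.2 + z.2 - u = h.2 - (u - z.2) by rewrite opprB addrA.
    apply: (le_trans (ler_normB _ _)).
    by lra.
  have {}kl : `|Finv (h + z) - Finv z| <= K * `|h|.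
    by rewrite /K mulrAC ler_pdivlMr // mulrC.
  rewrite /k prod_normE /= ge_max; apply/andP; split.
    by have := mulr_ge0 K0 (normr_ge0 h); lra.
  by have := normr_ge0 h; lra.
pose e' := e * b z / (1 + K).
have K1 : 0 < 1 + K by lra.
have e'0 : 0 < e' by rewrite divr_gt0 // mulr_gt0.
have /nbhs_ballP[d d0' Hd] := differentiable_eps (dF p) e'0.
have d0 : (0 : R) < d := d0'.
have dK : 0 < d / (1 + K) by rewrite divr_gt0.
have Hball : \forall h \near (0 : plane), `|h| < d / (1 + K).
  have := @nbhsx_ballx _ _ (0 : plane) _ dK.
  by apply: filterS => h; rewrite -ball_normE /= sub0r normrN.
apply: (@filterS2 _ (nbhs (0 : plane)) _ _ _ _ _ Lip Hball) => h hk hd.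
have /Hd /= : ball (0 : plane) d (k h).
  rewrite -ball_normE /= sub0r normrN; apply: (le_lt_trans hk).
  by rewrite mulrC -ltr_pdivlMr.
have FE : F (k h + p) = h.2 + z.2 by rewrite kE FinvK.
rewrite FE Fp addrK diff_planeE -/(a z) -/(b z) => Hh.
rewrite /solve_lin.
have -> : Finv (h + z) - Finv z - (b z)^-1 * (h.2 - a z * h.1) =
   - (b z)^-1 * (h.2 - ((k h).1 * a z + (k h).2 * b z)).
  have E (w h1 h2 : R) :
      w - (b z)^-1 * (h2 - a z * h1) = - (b z)^-1 * (h2 - (h1 * a z + w * b z)).
    by field; rewrite gt_eqF.
  exact: E.
rewrite normrM normrN normfV (gtr0_norm b0) mulrC ler_pdivrMr //.
apply: (le_trans Hh); apply: (@le_trans _ _ (e' * ((1 + K) * `|h|))).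
  by rewrite ler_wpM2l // ltW.
by rewrite mulrA /e' divfK ?gt_eqF // mulrAC.
Qed.

Lemma Ck_Finv n : Ck n Finv.
Proof.
elim: n => [|n IH]; first by split=> // z; have [] := diff_Finv z.
split=> [z|v]; first by have [] := diff_Finv z.
have Cp := Ck_pair (Ck_fst (Ck_id plane n)) IH.
have [_ DF] := CF n.+1.
have Ca := Ck_comp (DF (1, 0)) Cp; have Cb := Ck_comp (DF (0, 1)) Cp.
have b0 z : b z != 0 by rewrite gt_eqF // vertical_derivative_gt0.
have C := Ck_M (Ck_V b0 Cb) (Ck_D (Ck_cst _ n (v.2 : R^o))
  (Ck_M Ca (Ck_cst _ n (- v.1 : R^o)))).
apply: (Ck_ext _ C) => z.
have [dG dGE] := diff_Finv z.
have -> : 'D_v Finv z = (b z)^-1 * (v.2 - a z * v.1).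
  by rewrite (deriveE _ dG) dGE.
by rewrite -mulrN.
Qed.

End Shear.

Section ShearDiffeo.
Variable R : realType.
Local Notation plane := (R^o * R^o)%type.

(** The rate [c] gives both the bijectivity of the map, by the intermediate value
    theorem, and the smoothness of its inverse. *)
Lemma shear_diffeo (F : plane -> R^o) (c : R) : 0 < c ->
  (forall n, Ck n F) ->
  (forall x y1 y2 : R, y1 <= y2 -> c * (y2 - y1) <= F (x, y2) - F (x, y1)) ->
  diffeo (fun z : R * R => (z.1, F z)).
Proof.
move=> c0 CF Fi; pose G := Finv c0 CF Fi; split.
  apply/smoothP => n.
  exact: Ck_pair (Ck_fst (Ck_id plane n)) (CF n).
exists (fun z => (z.1, G z)); split.
- apply/smoothP => n.
  exact: Ck_pair (Ck_fst (Ck_id plane n)) (Ck_Finv c0 CF Fi n).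
- by case=> x y; congr pair; exact: (FK c0 CF Fi (x, y)).
- by case=> x y; congr pair; exact: (FinvK c0 CF Fi (x, y)).
Qed.

Lemma increasing_inverse (f : R^o -> R^o) (c : R) : 0 < c ->
  (forall n, Ck n f) ->
  (forall y1 y2 : R, y1 <= y2 -> c * (y2 - y1) <= f y2 - f y1) ->
  exists g : R^o -> R^o, [/\ forall n, Ck n g, cancel f g & cancel g f].
Proof.
move=> c0 Cf fi; pose F (z : plane) : R^o := f z.2.
have CF n : Ck n F.
  have cs : continuous (snd : plane -> R^o) by move=> z; exact: cvg_snd.
  have := @Ck_aff_in R plane R^o R^o n snd 0 f cs (Cf n).
  by apply: Ck_ext => z; rewrite addr0.
have Fi (x y1 y2 : R) : y1 <= y2 -> c * (y2 - y1) <= F (x, y2) - F (x, y1).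
  exact: fi.
pose G := Finv c0 CF Fi.
exists (fun y => G (0, y)); split=> [n|y|y].
- exact: Ck_comp (Ck_Finv c0 CF Fi n) (Ck_pair (Ck_cst _ n (0 : R^o)) (Ck_id _ n)).
- exact: (FK c0 CF Fi (0, y)).
- exact: (FinvK c0 CF Fi (0, y)).
Qed.

End ShearDiffeo.

Section Gap.
Variable R : realType.
Implicit Types (x y p q m v : R) (f g h : R^o -> R^o).

Definition expands (c : R) (f : R -> R) :=
  forall y1 y2, y1 <= y2 -> c * (y2 - y1) <= f y2 - f y1.

Lemma expands_glue c (f : R -> R) p :
  (forall y1 y2, y1 <= y2 <= p -> c * (y2 - y1) <= f y2 - f y1) ->
  (forall y1 y2, p <= y1 <= y2 -> c * (y2 - y1) <= f y2 - f y1) ->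
  expands c f.
Proof.
move=> Hl Hr y1 y2 y12.
have [p1|p1] := leP p y1; first by apply: Hr; rewrite p1.
have [p2|p2] := leP y2 p; first by apply: Hl; rewrite y12.
have := Hl y1 p; rewrite lexx (ltW p1) => /(_ isT).
have := Hr p y2; rewrite lexx (ltW p2) => /(_ isT).
lra.
Qed.

Lemma expands_glue3 c (f : R -> R) p q : p <= q ->
  (forall y1 y2, y1 <= y2 <= p -> c * (y2 - y1) <= f y2 - f y1) ->
  (forall y1 y2, p <= y1 -> y1 <= y2 -> y2 <= q -> c * (y2 - y1) <= f y2 - f y1) ->
  (forall y1 y2, q <= y1 <= y2 -> c * (y2 - y1) <= f y2 - f y1) ->
  expands c f.
Proof.
move=> pq Hl Hm Hr; apply: (@expands_glue _ _ p) => // y1 y2 /andP[py1 y12].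
have [q1|q1] := leP q y1; first by apply: Hr; rewrite q1.
have [q2|q2] := leP y2 q; first exact: Hm.
have := Hm y1 q py1 (ltW q1) (lexx q).
have := Hr q y2; rewrite lexx (ltW q2) => /(_ isT).
lra.
Qed.

Lemma expands_derive_gt0 c f y : 0 < c -> differentiable f y -> expands c f ->
  0 < 'D_1 f y.
Proof.
move=> c0 df fi; have c2 : 0 < c / 2 by rewrite divr_gt0.
have /nbhs_ballP[d d0' H] := differentiable_eps df c2.
have d0 : (0 : R) < d := d0'.
have d2 : `|d / 2| = d / 2 by rewrite ger0_norm //; lra.
have /H : ball (0 : R^o) d (d / 2).
  by rewrite -ball_normE /= sub0r normrN d2 //; lra.
rewrite [X in X -> _]/=.
have -> : 'd f y (d / 2) = d / 2 * 'D_1 f y.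
  by rewrite deriveE // -[d / 2 in LHS]mulr1 [LHS]linearZ.
have yd : y <= d / 2 + y by lra.
have := fi _ _ yd; rewrite addrK d2 ler_norml => h1 /andP[h2 h3].
have : 0 < d / 2 * 'D_1 f y by nra.
by rewrite pmulr_rgt0 //; lra.
Qed.

(** The values between [p] and [q] are left free. *)
Definition gap_spec (p q v m : R) (h : R -> R) :=
  (forall y, y <= p -> h y = y) /\ (forall y, q <= y -> h y = v + m * (y - q)).

(** Above [p], the difference between the larger affine function and the identity
    is added with a nondecreasing weight, which keeps the rate of increase. *)
Lemma upward_gap p q v m : p < q -> 0 < m -> q <= v -> p <= v + m * (p - q) ->
  exists2 h, gap_spec p q v m h &
    (forall n, Ck n h) /\ exists2 c : R, 0 < c & expands c h.
Proof.
move=> pq m0 qv pv; pose l y : R := v + m * (y - q).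
pose S y : R := step ((y - p) / (q - p)).
have pq0 : 0 < q - p by lra.
have S0 y : y <= p -> S y = 0.
  move=> yp; rewrite /S step_low // (@le_trans _ _ 0) //.
  by rewrite pmulr_lle0 ?invr_gt0 // subr_le0.
have S1 y : q <= y -> S y = 1.
  move=> qy; rewrite /S step_high // (@le_trans _ _ 1) //; first by lra.
  by rewrite ler_pdivlMr // mul1r; lra.
pose h y : R := y + S y * (l y - y).
have h_lo y : y <= p -> h y = y by move=> yp; rewrite /h S0 // mul0r addr0.
have h_hi y : q <= y -> h y = l y.
  by move=> qy; rewrite /h S1 // mul1r addrC subrK.
exists h => //; split.
  move=> n; have CS : Ck n (S : R^o -> R^o).
    have C := Ck_aff_in (L := *:%R (q - p)^-1) (- p / (q - p) : R^o)
      (@scaler_continuous _ _ _) (Ck_step R n).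
    apply: (Ck_ext _ C) => y; congr step.
    have E : (q - p)^-1 * y + - p / (q - p) = (y - p) / (q - p) by ring.
    exact: E.
  have C1 := Ck_id R^o n.
  have Cm := Ck_aff_in (L := *:%R (m - 1)) (v - m * q : R^o)
    (@scaler_continuous _ _ _) C1.
  apply: (Ck_ext _ (Ck_D C1 (Ck_M CS Cm))) => y.
  rewrite /h /l; congr (_ + _ * _).
  have E : (m - 1) * y + (v - m * q) = v + m * (y - q) - y by ring.
  exact: E.
exists (Num.min 1 m); first by rewrite lt_min ltr01.
set c := Num.min _ _.
have c1 : c <= 1 by rewrite ge_min lexx.
have cm : c <= m by rewrite ge_min lexx orbT.
apply: (@expands_glue3 _ _ p q (ltW pq)) => [y1 y2 /andP[y12 y2p]||].
- rewrite !h_lo //; last exact: le_trans y2p.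
  by rewrite ler_piMl // subr_ge0.
- move=> y1 y2 py1 y12 y2q.
  have S12 : S y1 <= S y2.
    by apply: step_homo; rewrite ler_pM2r ?invr_gt0 // lerD2r.
  have ly1 : 0 <= l y1 - y1.
    by rewrite /l; nra.
  have -> : h y2 - h y1 = (1 - S y2) * (y2 - y1) + S y2 * (m * (y2 - y1))
      + (S y2 - S y1) * (l y1 - y1) by rewrite /h /l; ring.
  have s0 : 0 <= S y2 by exact: step_ge0.
  have s1 : 0 <= 1 - S y2 by rewrite subr_ge0; exact: step_le1.
  have d0 : 0 <= y2 - y1 by lra.
  have t1 : (1 - S y2) * (c * (y2 - y1)) <= (1 - S y2) * (y2 - y1).
    by rewrite ler_wpM2l // ler_piMl.
  have t2 : S y2 * (c * (y2 - y1)) <= S y2 * (m * (y2 - y1)).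
    by rewrite ler_wpM2l // ler_wpM2r.
  have t3 : 0 <= (S y2 - S y1) * (l y1 - y1) by rewrite mulr_ge0 // subr_ge0.
  by lra.
- move=> y1 y2 /andP[qy1 y12]; rewrite !h_hi //; last exact: le_trans y12.
  have -> : l y2 - l y1 = m * (y2 - y1) by rewrite /l; ring.
  by rewrite ler_wpM2r // subr_ge0.
Qed.

Lemma derive_comp1 f g y : differentiable f (g y) -> differentiable g y ->
  'D_1 (fun y => f (g y)) y = 'D_1 f (g y) * 'D_1 g y.
Proof.
move=> /derivable1_diffP df /derivable1_diffP dg.
have := @is_derive1_comp _ f g y _ _ (derivableP df) (derivableP dg).
by case.
Qed.

(** An arbitrary gap is an upward one, towards a far enough translation,
    followed by the inverse of an upward one. *)
Lemma gap p q v m : p < q -> p < v -> 0 < m ->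
  exists2 h, gap_spec p q v m h &
    (forall n, Ck n h) /\ forall y, 0 < 'D_1 h y.
Proof.
move=> pq pv m0.
(* large enough for both upward gaps *)
pose T := `|v - q| + (v - p) / m.
have T0 : 0 <= (v - p) / m by rewrite divr_ge0 ?subr_ge0 // ltW.
have nvq := ler_norm (v - q).
have m1 : 0 < m^-1 by rewrite invr_gt0.
have n0 := normr_ge0 (v - q).
have [||||h [h_lo h_hi] [Ch [c c0 hc]]] := @upward_gap p q (q + T) 1.
- by [].
- by [].
- by rewrite /T; lra.
- by rewrite /T; lra.
have [||||k [k_lo k_hi] [Ck' [d d0 kd]]] := @upward_gap p v (q + T) m^-1.
- by [].
- by [].
- by rewrite /T; lra.
- by rewrite /T mulrC; lra.
have [g [Cg kg gk]] := increasing_inverse d0 Ck' kd.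
have dk y : differentiable k y by exact: Ck_diff (Ck' 0).
have dg y : differentiable g y by exact: Ck_diff (Cg 0).
have dh y : differentiable h y by exact: Ck_diff (Ch 0).
have g'0 y : 0 < 'D_1 g y.
  have E : 'D_1 k (g y) * 'D_1 g y = 1.
    rewrite -derive_comp1 //.
    have -> : (fun y => k (g y)) = id by apply/funext => z; rewrite gk.
    by rewrite derive_id.
  have k0 := expands_derive_gt0 d0 (dk (g y)) kd.
  by rewrite -(pmulr_rgt0 _ k0) E.
exists (fun y => g (h y)); last split.
- split=> y yy.
    by rewrite h_lo // -[in LHS](k_lo y yy); exact: kg.
  rewrite h_hi //; have vy : v <= v + m * (y - q).
    by rewrite lerDl mulr_ge0 ?subr_ge0 // ltW.
  have <- : k (v + m * (y - q)) = q + T + 1 * (y - q).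
    by rewrite k_hi // [v + _]addrC addrK mulKf ?mul1r // gt_eqF.
  exact: kg.
- move=> n; have C := Ck_comp (f := fun z : R^o * R^o => g z.1)
    (g := fun y => (h y, 0 : R^o)) (n := n).
  apply: C; last by apply: Ck_pair => //; exact: Ck_cst.
  have cf : continuous (fst : R^o * R^o -> R^o) by move=> z; exact: cvg_fst.
  have := @Ck_aff_in R _ R^o R^o n fst 0 g cf (Cg n).
  by apply: Ck_ext => z; rewrite addr0.
- move=> y; rewrite derive_comp1 //.
  by rewrite mulr_gt0 // (expands_derive_gt0 c0).
Qed.

End Gap.

Section Slide.
Variable R : realType.
Local Notation plane := (R^o * R^o)%type.
Implicit Types (x y : R).

Lemma Ck_comp1 (V : normedModType R) n (f : R^o -> R^o) (g : V -> R^o) :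
  Ck n f -> Ck n g -> Ck n (fun w => f (g w)).
Proof.
move=> Cf Cg.
have cf : continuous (fst : plane -> R^o) by move=> z; exact: cvg_fst.
have C1 : Ck n ((fun z : plane => f z.1) : plane -> R^o).
  have := @Ck_aff_in R plane R^o R^o n fst 0 f cf Cf.
  by apply: Ck_ext => z; rewrite addr0.
exact: Ck_comp C1 (Ck_pair Cg (Ck_cst _ n (0 : R^o))).
Qed.

Lemma Ck_compP (V : normedModType R) n (f : plane -> plane) (g : V -> plane) :
  Ck n f -> Ck n g -> Ck n (fun w => f (g w)).
Proof.
move=> Cf Cg.
have := Ck_pair (Ck_comp (Ck_fst Cf) Cg) (Ck_comp (Ck_snd Cf) Cg).
by apply: Ck_ext => x; case: (f (g x)).
Qed.

Lemma Ck_affine n (a b : R) : Ck n ((fun x : R => a * x + b) : R^o -> R^o).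
Proof.
exact: Ck_D (Ck_M (Ck_cst _ n (a : R^o)) (Ck_id _ n)) (Ck_cst _ n (b : R^o)).
Qed.

(** The composite of a gap from [A] to [p], which is affine above, with one from
    [q'] to the image of [B], which restores the identity. *)
Lemma reparametrization (A B p q p' q' : R) :
  A < p -> p < q -> q < B -> A < p' -> p' < q' -> q' < B ->
  exists (theta : R^o -> R^o) (c : R), [/\ forall n, Ck n theta, 0 < c /\ expands c theta,
    forall y, y <= A -> theta y = y, forall y, B <= y -> theta y = y &
    forall y, p <= y <= q -> theta y = p' + (q' - p') / (q - p) * (y - p)].
Proof.
move=> Ap pq qB Ap' pq' qB'.
set m := (q' - p') / (q - p).
have m0 : 0 < m by rewrite divr_gt0 // subr_gt0.
have mE : m * (q - p) = q' - p' by rewrite divfK // gt_eqF // subr_gt0.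
pose l y : R := p' + m * (y - p).
have lq : l q = q' by rewrite /l mE; ring.
have lB : q' < l B by rewrite -lq /l ltrD2l ltr_pM2l // ltrD2r.
have l_mono y1 y2 : y1 <= y2 -> l y1 <= l y2.
  by move=> y12; rewrite /l lerD2l ler_pM2l // lerD2r.
have [h1 [h1l h1h] [Ch1 dh1]] := gap Ap Ap' m0.
have m1 : 0 < m^-1 by rewrite invr_gt0.
have [h2 [h2l h2h] [Ch2 dh2]] := gap lB qB' m1.
pose th := (fun y => h2 (h1 y)) : R^o -> R^o.
have Cth n : Ck n th by exact: Ck_comp1.
have lo y : y <= A -> th y = y.
  by move=> yA; rewrite /th h1l // h2l //; lra.
have hi y : B <= y -> th y = y.
  move=> By; have py : p <= y by lra.
  rewrite /th h1h // h2h; last exact: l_mono.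
  have -> : p' + m * (y - p) - l B = m * (y - B) by rewrite /l; ring.
  by rewrite mulKf ?gt_eqF // addrC subrK.
have mid y : p <= y <= q -> th y = l y.
  case/andP=> py yq; rewrite /th h1h // h2l //.
  by rewrite -lq; exact: l_mono.
have AB : A <= B by lra.
have dth y : differentiable th y by exact: Ck_diff (Cth 0).
have dth0 y : 0 < 'D_1 th y.
  rewrite /th derive_comp1; last 2 first.
  - exact: Ck_diff (Ch2 0).
  - exact: Ck_diff (Ch1 0).
  exact: mulr_gt0.
(* the derivative is positive, hence bounded below on the compact [A, B] *)
have [_ Dth] := Cth 1.
have cD : continuous (fun y : R => 'D_1 th y : R).
  by move=> y; have [dD _] := Dth 1; exact: differentiable_continuous (dD y).
have [y0 _ y0min] := EVT_min AB (continuous_subspaceT cD).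
pose c := Num.min 1 ('D_1 th y0 : R).
have c1 : c <= 1 by rewrite ge_min lexx.
have cy : c <= 'D_1 th y0 by rewrite ge_min lexx orbT.
exists th, c; split => //.
split; first by rewrite lt_min ltr01 /=; exact: dth0.
apply: (expands_glue3 AB) => [y1 y2 /andP[y12 y2A]|y1 y2 Ay1 y12 y2B|
                              y1 y2 /andP[By1 y12]].
- rewrite !lo //; last exact: le_trans y2A.
  by rewrite ler_piMl // subr_ge0.
- have := y12; rewrite le_eqVlt => /orP[/eqP ->|lt12].
    by rewrite !subrr mulr0.
  have [||z zin ->] := @MVT _ th (fun y => 'D_1 th y) y1 y2 lt12.
  + by move=> y _; apply: derivableP; apply/derivable1_diffP.
  + apply: continuous_subspaceT => y.
    exact: differentiable_continuous.
  rewrite ler_wpM2r ?subr_ge0 //; apply: (le_trans cy); apply: y0min.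
  by move: zin; rewrite !in_itv /=; lra.
- rewrite !hi //; last exact: le_trans y12.
  by rewrite ler_piMl // subr_ge0.
Qed.

Definition bump (u v x : R) : R := step (2 * (x - u) + 1) * step (2 * (v - x) + 1).

Lemma bump_out u v x : x <= u - 2^-1 \/ v + 2^-1 <= x -> bump u v x = 0.
Proof.
by rewrite /bump => -[?|?]; [rewrite step_low ?mul0r //|
  rewrite mulrC step_low ?mul0r //]; lra.
Qed.

Lemma bump_in u v x : u <= x <= v -> bump u v x = 1.
Proof. by move=> ?; rewrite /bump !step_high ?mulr1 //; lra. Qed.

Lemma bump_ge0 u v x : 0 <= bump u v x.
Proof. by rewrite mulr_ge0 // step_ge0. Qed.

Lemma bump_le1 u v x : bump u v x <= 1.
Proof. by rewrite mulr_ile1 // ?step_ge0 // step_le1. Qed.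

Lemma Ck_bump n u v : Ck n (bump u v : R^o -> R^o).
Proof.
apply: Ck_M; apply: Ck_comp1; try exact: Ck_step.
  apply: (Ck_ext _ (Ck_affine n 2 (- 2 * u + 1))) => x.
  have E : 2 * x + (- 2 * u + 1) = 2 * (x - u) + 1 by ring.
  exact: E.
apply: (Ck_ext _ (Ck_affine n (- 2) (2 * v + 1))) => x.
have E : - 2 * x + (2 * v + 1) = 2 * (v - x) + 1 by ring.
exact: E.
Qed.

(** The reparametrization of the heights is cut off horizontally by [bump]; a convex
    combination with the identity is still increasing at a rate bounded below. *)
Lemma slide_diffeo (u v A B p q p' q' : R) :
  A < p -> p < q -> q < B -> A < p' -> p' < q' -> q' < B ->
  exists s : R -> R -> R,
  [/\ diffeo (fun z : R * R => (z.1, s z.1 z.2)),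
      forall x y1 y2, y1 < y2 -> s x y1 < s x y2,
      forall x y, y <= A \/ B <= y -> s x y = y,
      forall x y, x <= u - 2^-1 \/ v + 2^-1 <= x -> s x y = y &
      forall x y, u <= x <= v -> p <= y <= q ->
        s x y = p' + (q' - p') / (q - p) * (y - p)].
Proof.
move=> Ap pq qB Ap' pq' qB'.
have [th [c [Cth [c0 thc] lo hi mid]]] := reparametrization Ap pq qB Ap' pq' qB'.
pose F (z : plane) : R^o := z.2 + bump u v z.1 * (th z.2 - z.2).
pose c' := Num.min 1 c.
have c'0 : 0 < c' by rewrite lt_min ltr01.
have c'1 : c' <= 1 by rewrite ge_min lexx.
have c'c : c' <= c by rewrite ge_min lexx orbT.
have CF n : Ck n F.
  have C1 := Ck_fst (Ck_id plane n); have C2 := Ck_snd (Ck_id plane n).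
  have := Ck_D C2 (Ck_M (Ck_comp1 (Ck_bump n u v) C1)
    (Ck_D (Ck_comp1 (Cth n) C2) (Ck_M (Ck_cst _ n (-1 : R^o)) C2))).
  by apply: Ck_ext => z; rewrite /F /cst mulN1r.
have Fi x y1 y2 : y1 <= y2 -> c' * (y2 - y1) <= F (x, y2) - F (x, y1).
  move=> y12; rewrite /F /=.
  have b0 := bump_ge0 u v x; have b1 := bump_le1 u v x; set b := bump u v x in b0 b1 *.
  have -> : y2 + b * (th y2 - y2) - (y1 + b * (th y1 - y1)) =
    (1 - b) * (y2 - y1) + b * (th y2 - th y1).
    have E (t1 t2 : R) : y2 + b * (t2 - y2) - (y1 + b * (t1 - y1)) =
      (1 - b) * (y2 - y1) + b * (t2 - t1) by ring.
    exact: E.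
  have d0 : 0 <= y2 - y1 by lra.
  have t1 : (1 - b) * (c' * (y2 - y1)) <= (1 - b) * (y2 - y1).
    by rewrite ler_wpM2l ?subr_ge0 // ler_piMl.
  have t2 : b * (c' * (y2 - y1)) <= b * (th y2 - th y1).
    by rewrite ler_wpM2l // (le_trans _ (thc _ _ y12)) // ler_wpM2r.
  by lra.
exists (fun x y => F (x, y)); split.
- have [sf [psi [sp K1 K2]]] := shear_diffeo c'0 CF Fi.
  have -> : (fun z : R * R => (z.1, F (z.1, z.2))) = (fun z : R * R => (z.1, F z)).
    by apply/funext => -[].
  by split => //; exists psi.
- move=> x y1 y2 y12; rewrite -subr_gt0; apply: lt_le_trans (Fi x _ _ (ltW y12)).
  by rewrite mulr_gt0 // subr_gt0.
- move=> x y yy; rewrite /F /=.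
  have -> : th y = y by case: yy => ?; [exact: lo|exact: hi].
  by rewrite subrr mulr0 addr0.
- by move=> x y xx; rewrite /F /= bump_out // mul0r addr0.
- by move=> x y xx yy; rewrite /F /= bump_in // mid // mul1r addrC subrK.
Qed.

End Slide.

(** * Diffeomorphisms of the plane and link projections *)

Section Diffeo.
Variable R : realType.
Local Notation plane := (R * R)%type.
Implicit Types (phi psi E : R * R -> R * R) (D : set (R * R)).

Lemma smooth_Ck phi : smooth phi ->
  forall n, Ck n (phi : R^o * R^o -> R^o * R^o)%type.
Proof. by move=> /smoothP. Qed.

Lemma diffeo_Ck phi : diffeo phi -> forall n, Ck n (phi : R^o * R^o -> R^o * R^o)%type.
Proof. by case=> /smoothP. Qed.

Lemma diffeo_differentiable phi z : diffeo phi -> differentiable phi z.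
Proof. by move=> /diffeo_Ck/(_ 0) C; exact: Ck_diff C. Qed.

Lemma diffeo_continuous phi : diffeo phi -> continuous phi.
Proof. by move=> dphi z; apply/differentiable_continuous/diffeo_differentiable. Qed.

Lemma diffeo_comp phi psi : diffeo phi -> diffeo psi -> diffeo (phi \o psi).
Proof.
move=> dphi dpsi; case: (dphi) (dpsi) => _ [phi' [sphi' K1 K2]] [_ [psi' [spsi' K3 K4]]].
split; first by apply/smoothP => n; apply: Ck_compP; exact: diffeo_Ck.
exists (psi' \o phi'); split.
- by apply/smoothP => n; apply: Ck_compP; exact: smooth_Ck.
- exact: can_comp.
- exact: can_comp.
Qed.

Lemma diffeo_inv phi : diffeo phi ->
  exists psi, [/\ diffeo psi, cancel phi psi & cancel psi phi].
Proof.
by move=> [sphi [psi [spsi K1 K2]]]; exists psi; split=> //; split=> //; exists phi.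
Qed.

Lemma diffeo_affine (a b c d : R) : a != 0 -> c != 0 ->
  diffeo (fun z : R * R => (a * z.1 + b, c * z.2 + d)).
Proof.
have S (a' b' c' d' : R) : smooth (fun z : R * R => (a' * z.1 + b', c' * z.2 + d')).
  apply/smoothP => n; have C := Ck_id (R^o * R^o)%type n.
  exact: Ck_pair (Ck_comp1 (Ck_affine n a' b') (Ck_fst C))
    (Ck_comp1 (Ck_affine n c' d') (Ck_snd C)).
move=> a0 c0; split; first exact: S.
exists (fun z => (a^-1 * z.1 + - b / a, c^-1 * z.2 + - d / c)).
by split; [exact: S| |] => -[x y] /=; congr pair; field.
Qed.

Lemma diffeo_diff_inj phi z h : diffeo phi -> 'd phi z h = 0 -> h = 0.
Proof.
move=> dphi; have [psi [dpsi K _]] := diffeo_inv dphi => H.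
have dp := diffeo_differentiable z dphi.
have dq := diffeo_differentiable (phi z) dpsi.
have E : 'd (psi \o phi) z h = 'd psi (phi z) ('d phi z h).
  exact: (congr1 (fun f => f h) (diff_comp dp dq)).
have Eid : psi \o phi = id by apply/funext => w /=; rewrite K.
have E1 : 'd (psi \o phi) z h = h.
  by rewrite Eid; exact: (congr1 (fun f => f h) (@diff_val _ _ _ _ _ _ _ (is_diff_id z))).
have E2 : 'd psi (phi z) ('d phi z h) = 0.
  exact: etrans (congr1 ('d psi (phi z)) H) (linear0 _).
exact: etrans (esym E1) (etrans E E2).
Qed.

Lemma differentiable_curve (g : R -> R * R) t : smooth (g : R^o -> R * R) ->
  differentiable (g : R^o -> R * R) t.
Proof. by move=> /smoothP/(_ 0) C; exact: Ck_diff C. Qed.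

Lemma derive1_diffeo phi (g : R -> R * R) t :
  diffeo phi -> smooth (g : R^o -> R * R) ->
  derive1 (fun t => phi (g t)) t = 'd phi (g t) (derive1 g t).
Proof.
move=> dphi sg; have dg := differentiable_curve t sg.
have dp := diffeo_differentiable (g t) dphi.
rewrite !derive1E' //; last exact: (differentiable_comp dg dp).
exact: (congr1 (fun f => f 1) (diff_comp dg dp)).
Qed.

Lemma transverseP (a b : R * R) : ~ transverse a b ->
  exists2 c : R * R, c != 0 & c.1 *: a + c.2 *: b = 0.
Proof.
move=> /negP/negPn/eqP ab0.
case: a b ab0 => a1 a2 [b1 b2] /= ab0.
have H c1 c2 : c1 * a1 + c2 * b1 = 0 -> c1 * a2 + c2 * b2 = 0 ->
    c1 *: (a1, a2) + c2 *: (b1, b2) = 0 :> R * R.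
  by move=> h1 h2; rewrite -[LHS]/(c1 * a1 + c2 * b1, c1 * a2 + c2 * b2) h1 h2.
have [/andP[/eqP a20 /eqP b20]|n2] := boolP ((a2 == 0) && (b2 == 0)).
  have [/andP[/eqP a10 /eqP b10]|n1] := boolP ((a1 == 0) && (b1 == 0)).
    exists (1, 0); first by rewrite -pair_eqE /= oner_eq0.
    by apply: H => /=; rewrite ?a10 ?b10 ?a20 ?b20 !mulr0 addr0.
  exists (b1, - a1); first by rewrite -pair_eqE /= oppr_eq0 andbC.
  by apply: H => /=; rewrite ?a20 ?b20; ring.
exists (b2, - a2); first by rewrite -pair_eqE /= oppr_eq0 andbC.
by apply: H => /=; [rewrite mulrC mulNr; exact: ab0 | ring].
Qed.

Lemma transverse0 (a b c : R * R) : c != 0 -> c.1 *: a + c.2 *: b = 0 ->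
  ~ transverse a b.
Proof.
case: a b c => a1 a2 [b1 b2] [c1 c2] /=; rewrite -pair_eqE /= => c0.
move=> [h1 h2]; rewrite /transverse /=; set d := _ - _ => /negP; apply; apply/eqP.
have h1' : c1 * a1 + c2 * b1 = 0 := h1; have h2' : c1 * a2 + c2 * b2 = 0 := h2.
have e1 : c1 * d = 0.
  have -> : c1 * d = b2 * (c1 * a1 + c2 * b1) - b1 * (c1 * a2 + c2 * b2).
    by rewrite /d; ring.
  by rewrite h1' h2' !mulr0 subr0.
have e2 : c2 * d = 0.
  have -> : c2 * d = a1 * (c1 * a2 + c2 * b2) - a2 * (c1 * a1 + c2 * b1).
    by rewrite /d; ring.
  by rewrite h1' h2' !mulr0 subr0.
have [d0|d0] := eqVneq d 0; first by [].
move: c0; rewrite negb_and => /orP[|] /negP[]; apply/eqP.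
  by apply: (mulIf d0); rewrite e1 mul0r.
by apply: (mulIf d0); rewrite e2 mul0r.
Qed.

Lemma transverse_diffeo phi z a b : diffeo phi ->
  transverse a b -> transverse ('d phi z a) ('d phi z b).
Proof.
move=> dphi tab; apply: contrapT => /transverseP[c c0 E].
suff /(transverse0 c0) : c.1 *: a + c.2 *: b = 0 by [].
by apply: (diffeo_diff_inj dphi (z := z)); rewrite linearD !linearZ.
Qed.

Lemma generic_immersion_diffeo phi m (g : 'I_m -> R -> R * R) :
  diffeo phi -> generic_immersion g ->
  generic_immersion (fun i t => phi (g i t)).
Proof.
move=> dphi [gs gp gi gt g3].
have [psi [_ K _]] := diffeo_inv dphi.
split.
- move=> i; apply/smoothP => n; apply: Ck_compP; first exact: diffeo_Ck.
  by have /smoothP := gs i.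
- by move=> i t; rewrite gp.
- move=> i t; rewrite derive1_diffeo //.
  by apply: contra_neq (gi i t) => /(diffeo_diff_inj dphi).
- move=> u v /(can_inj K) uv nuv; rewrite !derive1_diffeo // uv.
  by apply: transverse_diffeo => //; exact: gt.
- by move=> u v w /(can_inj K) uv /(can_inj K) vw; exact: g3.
Qed.

Lemma link_projection_diffeo phi D :
  diffeo phi -> link_projection D -> link_projection (phi @` D).
Proof.
move=> dphi [m [g [gg ->]]]; exists m, (fun i t => phi (g i t)).
split; first exact: generic_immersion_diffeo.
apply/seteqP; split=> z.
  by move=> [_ [i _ [t _ <-]] <-]; exists i => //; exists t.
by move=> [i _ [t _ <-]]; exists (g i t) => //; exists i => //; exists t.
Qed.

End Diffeo.

(** * Configurations and layouts *)

Section Layout.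
Variables (R : realType) (k : nat).
Local Notation word := (tw_word k).
Implicit Types (i : 'I_k.-1) (x y t : R) (u v w : word).

Definition at_rest x : Prop := exists j : 'I_k, x = j.+1%:R.

(** The smooth step is constant outside the middle third, so the arcs of a layer
    move only there. *)
Lemma crossing_rest i t x : t <= 3^-1 \/ 2 / 3 <= t ->
  crossing i t x <-> at_rest x.
Proof.
have rest_l : at_rest i.+1%:R by exists (Defs.left_arc i).
have rest_r : at_rest i.+2%:R by exists (Defs.right_arc i).
have cases (P : Prop) : at_rest x -> (x = i.+1%:R -> P) -> (x = i.+2%:R -> P) ->
    ((exists j, [/\ j != Defs.left_arc i, j != Defs.right_arc i &
                    x = j.+1%:R]) -> P) -> P.
  move=> [j xj] Hl Hr Ho.
  have [jl|jl] := eqVneq j (Defs.left_arc i); first by apply: Hl; rewrite xj jl.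
  have [jr|jr] := eqVneq j (Defs.right_arc i); first by apply: Hr; rewrite xj jr.
  by apply: Ho; exists j.
have E2 : i.+2%:R = i.+1%:R + 1 :> R by rewrite -natr1.
case=> [/step_low s0|/step_high s1]; rewrite /crossing /= ?s0 ?s1; split.
- by rewrite addr0 subr0 => -[->|->|[j [_ _ ->]]] //; exists j.
- rewrite addr0 subr0 => rx; apply: (cases _ rx) => H.
  + exact: Or31.
  + exact: Or32.
  + exact: Or33.
- rewrite E2 addrK -E2 => -[->|->|[j [_ _ ->]]] //; by exists j.
- rewrite E2 addrK -E2 => rx; apply: (cases _ rx) => H.
  + exact: Or32.
  + exact: Or31.
  + exact: Or33.
Qed.

Lemma configP w (z : R * R) : w != [::] ->
  config w z <-> exists u i v t, [/\ w = u ++ i :: v, 0 <= t <= 1,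
    z.2 = ((size u)%:R + t) / (size w)%:R & crossing i t z.1].
Proof.
case: w => // i0 w' _; set w := i0 :: w'.
split=> [[a [t [t01 zE c]]]|[u [i [v [t [wE t01 zE c]]]]]].
  exists (take a w), (tnth (in_tuple w) a), (drop a.+1 w), t.
  have aw : (a < size w)%N by [].
  split=> //; last by rewrite size_take aw.
  by rewrite (tnth_nth i0) /= -drop_nth // cat_take_drop.
have aw : (size u < size w)%N by rewrite wE size_cat /=; lia.
exists (Ordinal aw), t; split=> //.
by rewrite (tnth_nth i0) /= wE nth_cat ltnn subnn.
Qed.

(** At the common boundary of two layers all the arcs are at rest, so the two
    descriptions of the configuration agree there. *)
Lemma config_layer u i v t x : 0 <= t <= 1 ->
  config (u ++ i :: v) (x, ((size u)%:R + t) / (size (u ++ i :: v))%:R) <->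
  crossing i t x.
Proof.
move=> t01; set w := u ++ i :: v.
have w0 : w != [::] by rewrite /w; case: (u).
have L0 : (size w)%:R != 0 :> R by rewrite pnatr_eq0 size_eq0.
rewrite (configP _ w0); split; last by move=> c; exists u, i, v, t.
move=> [u' [i' [v' [t' [wE t'01 /= yE c]]]]].
move: yE => /(mulIf (invr_neq0 L0)) yE.
have [su|su|su] := ltngtP (size u) (size u').
- have : (size u)%:R + 1 <= (size u')%:R :> R by rewrite natr1 ler_nat.
  move=> su'; have t1 : t = 1 by lra.
  have t'0 : t' = 0 by lra.
  have := c; rewrite (@crossing_rest _ _ _ _); last by left; rewrite t'0; lra.
  by move=> rx; apply/crossing_rest => //; right; lra.
- have : (size u')%:R + 1 <= (size u)%:R :> R by rewrite natr1 ler_nat.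
  move=> su'; have t1 : t = 0 by lra.
  have t'0 : t' = 1 by lra.
  have := c; rewrite (@crossing_rest _ _ _ _); last by right; rewrite t'0; lra.
  by move=> rx; apply/crossing_rest => //; left; lra.
have tt' : t = t' by move: yE; rewrite su; lra.
move/eqP: wE; rewrite eqseq_cat // => /andP[_ /eqP[-> _]].
by rewrite tt'.
Qed.

(** A crossing is recorded by its letter, the height [p] of the bottom of its
    layer and the height [h] of its layer. *)
Definition entry : Type := ('I_k.-1 * R * R)%type.
HB.instance Definition _ := Equality.on entry.
Implicit Types (e : entry) (ls : seq entry).

Definition letter e : 'I_k.-1 := e.1.1.
Definition bottom e : R := e.1.2 + e.2 / 3.
Definition top e : R := e.1.2 + e.2 * (2 / 3).
Definition time e y : R := (y - e.1.2) / e.2.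
Definition active e y : bool := bottom e < y < top e.
Definition strands e (z : R * R) : Prop :=
  z.1 = (letter e).+1%:R + step (time e z.2) \/
  z.1 = (letter e).+2%:R - step (time e z.2).
Definition involved e (j : 'I_k) : bool :=
  (j == Defs.left_arc (letter e)) || (j == Defs.right_arc (letter e)).

(** Layers of arbitrary heights; crossings of distant letters may also occur at
    the same height. *)
Definition layout ls : set (R * R) := [set z | 0 <= z.2 <= 1 /\
  ((exists2 e, e \in ls & active e z.2 /\ strands e z) \/
   (exists2 j : 'I_k, z.1 = j.+1%:R &
      forall e, e \in ls -> active e z.2 -> ~~ involved e j))].

Fixpoint entries (L a : nat) w : seq entry :=
  if w is i :: w' then (i, a%:R / L%:R, L%:R^-1) :: entries L a.+1 w' else [::].

Definition standard w := entries (size w) 0 w.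

Lemma entries_cat L a u v :
  entries L a (u ++ v) = entries L a u ++ entries L (a + size u) v.
Proof.
elim: u a => [|i u IH] a /=; first by rewrite addn0.
by rewrite IH addSnnS.
Qed.

Lemma entriesP L a w e : e \in entries L a w <->
  exists u i v, w = u ++ i :: v /\ e = (i, (a + size u)%:R / L%:R, L%:R^-1).
Proof.
elim: w a => [|i w IH] a /=.
  by split=> // -[[|? ?] [i [v []]]].
rewrite inE; split.
  case/predU1P=> [->|/IH[u [j [v [-> ->]]]]].
    by exists [::], i, w; rewrite addn0.
  by exists (i :: u), j, v; rewrite /= addSnnS.
move=> [[|i' u] [j [v [wE eE]]]].
  by move: wE eE => [<- _] ->; rewrite /= addn0 eqxx.
move: wE => /= [_ wE]; apply/orP; right; apply/IH.
by exists u, j, v; rewrite eE /= addSnnS.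
Qed.

Lemma active_layer (L n : nat) i t : (0 < L)%N ->
  active (i, n%:R / L%:R, L%:R^-1) ((n%:R + t) / L%:R) = (3^-1 < t < 2 / 3).
Proof.
move=> L0; have Li : 0 < (L%:R^-1 : R) by rewrite invr_gt0 ltr0n.
rewrite /active /bottom /top /=.
have -> : n%:R / L%:R + L%:R^-1 / 3 = (n%:R + 3^-1) / L%:R :> R by ring.
have -> : n%:R / L%:R + L%:R^-1 * (2 / 3) = (n%:R + 2 / 3) / L%:R :> R by ring.
by rewrite !ltr_pM2r // !ltrD2l.
Qed.

Lemma time_layer (L n : nat) i t : (0 < L)%N ->
  time (i, n%:R / L%:R, L%:R^-1) ((n%:R + t) / L%:R) = t.
Proof.
move=> L0; rewrite /time /=.
have : L%:R != 0 :> R by rewrite pnatr_eq0 -lt0n.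
by move=> ?; field.
Qed.

Lemma layers_cover (L : nat) y : (0 < L)%N -> 0 <= y <= 1 ->
  exists (a : nat) t, [/\ (a < L)%N, 0 <= t <= 1 & y = (a%:R + t) / L%:R].
Proof.
move=> L0 /andP[y0 y1]; have Lr : 0 < L%:R :> R by rewrite ltr0n.
suff H n : (n < L)%N -> y * L%:R <= n.+1%:R ->
    exists (a : nat) t, [/\ (a < L)%N, 0 <= t <= 1 & y = (a%:R + t) / L%:R].
  by apply: (H L.-1); [rewrite prednK | rewrite prednK // ler_piMl // ltW].
elim: n => [|n IH] nL yn.
  exists 0%N, (y * L%:R); split=> //; last by rewrite add0r mulfK // gt_eqF.
  by rewrite yn mulr_ge0 // ltW.
have [yn'|yn'] := leP (y * L%:R) n.+1%:R; first exact: IH (ltnW nL) yn'.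
exists n.+1, (y * L%:R - n.+1%:R); split=> //.
  by rewrite subr_ge0 (ltW yn') /= lerBlDr addrC natr1.
by rewrite addrC subrK mulfK // gt_eqF.
Qed.

Lemma config_layout w : config w = layout (standard w).
Proof.
have [->|w0] := eqVneq w [::].
  apply/seteqP; split=> z; rewrite /layout /config /=.
    by move=> [z01 [j zj]]; split=> //; right; exists j.
  by move=> [z01 [[]//|[j zj _]]]; split=> //; exists j.
have L0 : (0 < size w)%N by rewrite lt0n size_eq0.
have key (x y : R) : 0 <= y <= 1 -> config w (x, y) <-> layout (standard w) (x, y).
  move=> y01; have [a [t [aL t01 yE]]] := layers_cover L0 y01.
  have i0 : 'I_k.-1 by case: (w) w0.
  pose u := take a w; pose i := nth i0 w a; pose v := drop a.+1 w.
  have su : size u = a by rewrite size_take aL.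
  have wE : w = u ++ i :: v by rewrite -drop_nth // cat_take_drop.
  have -> : config w (x, y) <-> crossing i t x.
    by rewrite yE {1}wE -(config_layer u i v x t01) -wE su.
  pose e : entry := (i, a%:R / (size w)%:R, (size w)%:R^-1).
  have eS : e \in standard w.
    by apply/entriesP; exists u, i, v; rewrite add0n su.
  have uniq_active e' : e' \in standard w -> active e' y -> e' = e.
    move=> /entriesP[u' [i' [v' [wE' ->]]]]; rewrite add0n.
    have -> : y = ((size u')%:R + (a%:R - (size u')%:R + t)) / (size w)%:R.
      by rewrite yE; congr (_ / _); ring.
    rewrite active_layer // => act.
    have su' : size u' = a.
      have [su'|su'|//] := ltngtP (size u') a.
        have : (size u')%:R + 1 <= a%:R :> R by rewrite natr1 ler_nat.
        by move=> ?; exfalso; lra.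
      have : a%:R + 1 <= (size u')%:R :> R by rewrite natr1 ler_nat.
      by move=> ?; exfalso; lra.
    rewrite su' /e; congr (_, _, _).
    move: wE; rewrite {1}wE' => /eqP; rewrite eqseq_cat ?su ?su' //.
    by case/andP => _ /eqP[].
  have act : active e y = (3^-1 < t < 2 / 3) by rewrite yE active_layer.
  have tim : time e y = t by rewrite yE time_layer.
  have [t3|t3] := boolP (3^-1 < t < 2 / 3).
    split.
      move=> c; split=> //; case: c => [xE|xE|[j [jl jr xE]]].
      - by left; exists e => //; rewrite act t3 /strands /= tim; split=> //; left.
      - by left; exists e => //; rewrite act t3 /strands /= tim; split=> //; right.
      - right; exists j => // e' /uniq_active H /H ->.
        by rewrite /involved negb_or jl jr.
    move=> [_ [[e' /uniq_active H [/H ->]]|[j xE H]]].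
      by rewrite /strands /= tim => -[->|->]; [exact: Or31|exact: Or32].
    apply: Or33; exists j; have := H e eS; rewrite act => /(_ t3).
    by rewrite negb_or => /andP[].
  rewrite crossing_rest; last by move: t3; rewrite negb_and -!leNgt => /orP.
  have noact e' : e' \in standard w -> ~~ active e' y.
    move=> e'S; apply/negP => /[dup] /(uniq_active _ e'S) ->.
    by rewrite act; apply/negP.
  split=> [[j xE]|[_ [[e' /noact/negP ? []]//|[j xE _]]]]; last by exists j.
  by split=> //; right; exists j => // e' /noact/negP.
apply/seteqP; split=> -[x y].
  move=> c; apply/key => //; move: c; rewrite (configP _ w0) /=.
  move=> [u [i [v [t [wE /andP[t0 t1] -> _]]]]].
  rewrite divr_ge0 ?addr_ge0 // ler_pdivrMr ?ltr0n // mul1r wE size_cat /=.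
  by rewrite natrD -natr1; have : 0 <= (size v)%:R :> R by []; lra.
by move=> l; apply/key => //; case: l.
Qed.

End Layout.

(** * Sliding a crossing *)

Section Slide.
Variable R : realType.
Local Notation plane := (R * R)%type.

Definition refill (k : nat) (E : plane -> plane) (S D : set plane) : set plane :=
  (D `\` E @` @box R k) `|` E @` S.

(** Rondle equivalence stated for bare sets, as projections are modified by
    operations on sets. *)
Definition requiv (D D' : set plane) : Prop :=
  exists (l : link_projection D) (l' : link_projection D'),
    rondle_eqv (exist _ D l) (exist _ D' l').

Lemma requiv_refl D : link_projection D -> requiv D D.
Proof. by move=> l; exists l, l; exact: req_refl. Qed.

Lemma requiv_sym D D' : requiv D D' -> requiv D' D.
Proof. by move=> [l [l' r]]; exists l', l; exact: req_sym. Qed.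

Lemma requiv_trans D1 D2 D3 : requiv D1 D2 -> requiv D2 D3 -> requiv D1 D3.
Proof.
move=> [l1 [l2 r12]] [l2' [l3 r23]]; exists l1, l3; apply: req_trans r12 _.
by rewrite (Prop_irrelevance l2 l2').
Qed.

Lemma requiv_r D D' : requiv D D' -> link_projection D'.
Proof. by move=> [_ [l _]]. Qed.

Lemma requiv_diffeo D phi : link_projection D -> diffeo phi ->
  compactly_supported phi -> requiv D (phi @` D).
Proof.
move=> l dphi cphi; exists l, (link_projection_diffeo dphi l).
by apply: (@req_diffeo _ _ _ phi).
Qed.

Lemma requiv_refill k (E psi : plane -> plane) (K S S' D : set plane) :
  diffeo E -> diffeo psi -> compact K -> K `<=` @box R k ->
  (forall z, ~ K z -> psi z = z) -> (forall z, S z <-> S' (psi z)) ->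
  link_projection (refill k E S D) ->
  requiv (refill k E S D) (refill k E S' D).
Proof.
move=> dE dpsi cK Kbox psiK SS' lD.
have [Einv [dEinv EK KE]] := diffeo_inv dE.
have [psi' [_ _ psiK']] := diffeo_inv dpsi.
pose phi := E \o psi \o Einv.
have dphi : diffeo phi by do 2 apply: diffeo_comp => //.
have -> : refill k E S' D = phi @` refill k E S D.
  apply/seteqP; split=> w.
    move=> [[Dw nw]|[s S's <-]].
      exists w; first by left.
      rewrite /phi /= psiK ?KE // => Kw; apply: nw.
      by exists (Einv w); [exact: Kbox | exact: KE].
    exists (E (psi' s)); last by rewrite /phi /= EK psiK'.
    by right; exists (psi' s) => //; apply/SS'; rewrite psiK'.
  move=> [x [[Dw nw]|[s Ss <-]] <-].
    left; rewrite /phi /= psiK; first by rewrite KE.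
    by move=> Kw; apply: nw; eexists; [exact: Kbox Kw | exact: KE].
  by right; exists (psi s); [exact/SS' | rewrite /phi /= EK].
apply: requiv_diffeo => //; exists (E @` K); split.
  apply: continuous_compact => //; apply: continuous_subspaceT.
  exact: diffeo_continuous.
move=> w nw; rewrite /phi /= psiK ?KE // => Kw; apply: nw.
by exists (Einv w) => //; rewrite KE.
Qed.

Variable k : nat.
Implicit Types (e : entry R k) (ls : seq (entry R k)) (x y : R).

Lemma layout_mem ls ls' : ls =i ls' -> layout ls = layout ls'.
Proof.
move=> E; apply/seteqP; split=> z [z01 H]; split=> //.
  case: H => [[e el H]|[j zj H]]; first by left; exists e => //; rewrite -E.
  by right; exists j => // e; rewrite -E; exact: H.
case: H => [[e el H]|[j zj H]]; first by left; exists e => //; rewrite E.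
by right; exists j => // e; rewrite E; exact: H.
Qed.

Definition spans e x : bool := (letter e).+1%:R <= x <= (letter e).+2%:R.

Lemma strands_spans e (z : plane) : strands e z -> spans e z.1.
Proof.
rewrite /spans => -[->|->]; have s0 := step_ge0 (time e z.2);
  have s1 := step_le1 (time e z.2).
  rewrite lerDl s0 -[(letter e).+2%:R]natr1 lerD2l //=.
by rewrite -[(letter e).+2%:R]natr1; apply/andP; split; lra.
Qed.

Lemma involved_spans e (j : 'I_k) : involved e j -> spans e j.+1%:R.
Proof.
by rewrite /spans !ler_nat => /orP[] /eqP -> /=; lia.
Qed.

(** The crossing [e] is seen at the point [z] as [e'] is at [z']; nothing is asked
    at the abscissae that the crossing does not reach. *)
Definition agree (z z' : plane) e e' : Prop := letter e = letter e' /\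
  (spans e z.1 -> active e z.2 = active e' z'.2 /\
                  (active e z.2 -> time e z.2 = time e' z'.2)).

Lemma agree_sym z z' e e' : z.1 = z'.1 -> agree z z' e e' -> agree z' z e' e.
Proof.
move=> zz' [le H]; split=> //; rewrite /spans -le -zz' => /H[a t].
by split=> //; rewrite -a => /t.
Qed.

Lemma layout_transport (z z' : plane) ls ls' :
  z.1 = z'.1 -> (0 <= z.2 <= 1 -> 0 <= z'.2 <= 1) ->
  (forall e, e \in ls -> exists2 e', e' \in ls' & agree z z' e e') ->
  (forall e', e' \in ls' -> exists2 e, e \in ls & agree z z' e e') ->
  layout ls z -> layout ls' z'.
Proof.
move=> zz' h01 H1 H2 [z01 H]; split; first exact: h01.
case: H => [[e /H1[e' e'l [le A]] [act st]]|[j zj H]].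
  have [aa /(_ act) tt] := A (strands_spans st).
  left; exists e' => //; rewrite -aa; split=> //.
  by move: st; rewrite /strands le tt zz'.
right; exists j; first by rewrite -zz'.
move=> e' /H2[e el [le A]] act; apply/negP => inv.
have inve : involved e j by rewrite /involved le.
have := involved_spans inve; rewrite -zj => /A[aa _].
by have := H e el; rewrite aa => /(_ act); rewrite inve.
Qed.

Definition near_letters (i j : 'I_k.-1) : bool := (i <= j.+1)%N && (j <= i.+1)%N.

(** The diffeomorphism is vertical and supported around the two positions of the
    crossing, at the heights from [A] to [B]; all that it meets besides this
    crossing is vertical, hence preserved. *)
Lemma slide (E : plane -> plane) (D : set plane) e e' ls (A B : R) :
  diffeo E -> letter e = letter e' -> 0 < e.2 -> 0 < e'.2 ->
  0 <= A -> B <= 1 -> A < bottom e -> top e < B -> A < bottom e' -> top e' < B ->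
  (forall r, r \in ls -> near_letters (letter e) (letter r) ->
     top r <= A \/ B <= bottom r) ->
  link_projection (refill k E (layout (e :: ls)) D) ->
  requiv (refill k E (layout (e :: ls)) D) (refill k E (layout (e' :: ls)) D).
Proof.
move=> dE le h0 h0' A0 B1 Ae eB Ae' e'B free lD.
set i := letter e in free.
have bt : bottom e < top e by rewrite /bottom /top; lra.
have bt' : bottom e' < top e' by rewrite /bottom /top; lra.
have [s [dpsi smono sAB sout smid]] :=
  slide_diffeo i.+1%:R i.+2%:R Ae bt eB Ae' bt' e'B.
have E2 : i.+2%:R = i.+1%:R + 1 :> R by rewrite -natr1.
have E1 : i.+1%:R = i%:R + 1 :> R by rewrite -natr1.
have i0 : 0 <= i%:R :> R by [].
have ik : i.+2%:R <= k%:R :> R.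
  by rewrite ler_nat; case: (i); case: (k) => [[]|n []].
have sA x : s x A = A by rewrite sAB //; left.
have sB x : s x B = B by rewrite sAB //; right.
have s_lt x y1 y2 : (s x y1 < s x y2) = (y1 < y2).
  have [y12|y21|->] := ltgtP y1 y2; last by rewrite ltxx.
    by rewrite smono.
  by apply/negbTE; rewrite -leNgt ltW // smono.
have ABs x y : A < y < B -> A < s x y < B.
  by rewrite -{2}(sA x) -{2}(sB x) !s_lt.
have s01 x y : (0 <= y <= 1) = (0 <= s x y <= 1).
  have [yA|Ay] := leP y A; first by rewrite sAB //; left.
  have [yB|By] := leP B y; first by rewrite sAB //; right.
  have := ABs x y; rewrite Ay By => /(_ isT).
  by move=> /andP[? ?]; apply/idP/idP => _; lra.
have agree_e x y : agree (x, y) (x, s x y) e e'.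
  split=> //; rewrite /spans /= => xe.
  have sb : s x (bottom e) = bottom e'.
    by rewrite smid ?lexx ?(ltW bt) // subrr mulr0 addr0.
  have st : s x (top e) = top e'.
    rewrite smid ?lexx ?(ltW bt) // divfK ?gt_eqF ?subr_gt0 //.
    by rewrite addrC subrK.
  have act : active e y = active e' (s x y).
    by rewrite /active -sb -st !s_lt.
  split=> // /andP[by_ yt]; rewrite smid // ?(ltW by_) ?(ltW yt) //.
  rewrite /time /top /bottom.
  have n1 : e.2 != 0 by rewrite gt_eqF.
  have n2 : e'.2 != 0 by rewrite gt_eqF.
  have -> : e'.1.2 + e'.2 * (2 / 3) - (e'.1.2 + e'.2 / 3) = e'.2 / 3 by ring.
  have -> : e.1.2 + e.2 * (2 / 3) - (e.1.2 + e.2 / 3) = e.2 / 3 by ring.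
  by field; rewrite n1 n2.
have agree_r x y r : r \in ls -> agree (x, y) (x, s x y) r r.
  move=> rl; split=> //=; rewrite /spans => /andP[x1 x2].
  have [nr|far] := boolP (near_letters i (letter r)).
    have [yA|Ay] := leP y A; first by rewrite sAB //; left.
    have [yB|By] := leP B y; first by rewrite sAB //; right.
    have := ABs x y; rewrite Ay By => /(_ isT) /andP[As sB'].
    suff na w : A < w -> w < B -> active r w = false by rewrite !na.
    move=> Aw wB; apply/negbTE; rewrite /active negb_and -!leNgt.
    by case: (free r rl nr) => ?; apply/orP; [right|left]; lra.
  rewrite sout //; move: far; rewrite negb_and -!ltnNge => /orP[far|far].
    left; have : (letter r).+2%:R <= i%:R :> R by rewrite ler_nat.
    by lra.
  right; have : i.+3%:R <= (letter r).+1%:R :> R by rewrite ler_nat ltnS.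
  by rewrite -natr1; lra.
pose K : set plane := `[i.+1%:R - 2^-1, i.+2%:R + 2^-1] `*` `[A, B].
apply: (@requiv_refill k E (fun z => (z.1, s z.1 z.2)) K) => //.
- by apply: compact_setX; exact: segment_compact.
- move=> [x y] [] /=; rewrite !in_itv /= => /andP[x1 x2] /andP[y1 y2].
  by rewrite /box /=; split; apply/andP; split; lra.
- move=> [x y] nK; congr pair => /=.
  have [xu|xu] := leP x (i.+1%:R - 2^-1); first by apply: sout; left.
  have [xv|xv] := leP (i.+2%:R + 2^-1) x; first by apply: sout; right.
  have [yA|Ay] := leP y A; first by apply: sAB; left.
  have [yB|By] := leP B y; first by apply: sAB; right.
  by case: nK; split; rewrite /= in_itv /= !ltW.
- move=> [x y] /=; split.
    apply: layout_transport => //=; first by rewrite -s01.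
      move=> r; rewrite inE => /predU1P[->|rl]; first by exists e'; rewrite ?mem_head.
      by exists r; [rewrite inE rl orbT | exact: agree_r].
    move=> r; rewrite inE => /predU1P[->|rl]; first by exists e; rewrite ?mem_head.
    by exists r; [rewrite inE rl orbT | exact: agree_r].
  apply: layout_transport => //=; first by rewrite -s01.
    move=> r; rewrite inE => /predU1P[->|rl].
      by exists e; rewrite ?mem_head //; exact: agree_sym.
    by exists r; [rewrite inE rl orbT | apply: agree_sym => //; exact: agree_r].
  move=> r; rewrite inE => /predU1P[->|rl].
    by exists e'; rewrite ?mem_head //; exact: agree_sym.
  by exists r; [rewrite inE rl orbT | apply: agree_sym => //; exact: agree_r].
Qed.

End Slide.

(** * Equivalent words give equivalent rondles *)

Section Blocks.
Variable R : realType.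
Local Notation plane := (R * R)%type.

Lemma crossing_shift (m k c : nat) (j : 'I_m.-1) (j' : 'I_k.-1) (t x : R) :
  j' = (c + j)%N :> nat -> (c + m <= k)%N -> 2^-1 <= x <= m%:R + 2^-1 ->
  crossing j t x <-> crossing j' t (c%:R + x).
Proof.
move=> jj cmk xm; rewrite /crossing /= jj.
have -> : (c + j).+1%:R = c%:R + j.+1%:R :> R by rewrite -natrD addnS.
have -> : (c + j).+2%:R = c%:R + j.+2%:R :> R by rewrite -natrD !addnS.
split=> [[->|->|[l [l1 l2 ->]]]|].
- by apply: Or31; ring.
- by apply: Or32; ring.
- have lk : (c + l < k)%N by have := ltn_ord l; lia.
  apply: Or33; exists (Ordinal lk); split; last by rewrite -natrD addnS.
    by move: l1; rewrite -!val_eqE /= jj eqn_add2l.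
  by move: l2; rewrite -!val_eqE /= jj -addnS eqn_add2l.
case=> [E|E|[l [l1 l2 E]]].
- by apply: Or31; lra.
- by apply: Or32; lra.
have E' : x = l.+1%:R - c%:R by lra.
have cl : (c <= l)%N.
  rewrite -ltnS -(@ltr_nat R).
  have : (c%:R : R) + 2^-1 <= l.+1%:R by lra.
  by lra.
have lm : (l - c < m)%N.
  have : l.+1%:R <= (c + m)%:R + 2^-1 :> R by rewrite natrD; lra.
  rewrite -subSn // => h; have : (l.+1%:R : R) < (c + m).+1%:R by rewrite -natr1; lra.
  by rewrite ltr_nat; lia.
apply: Or33; exists (Ordinal lm); split.
- by move: l1; rewrite -!val_eqE /= jj; lia.
- by move: l2; rewrite -!val_eqE /= jj; lia.
- by rewrite E' /= -subSn // natrB // ltnW.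
Qed.

Lemma layout_sub_box k (ls : seq (entry R k)) : layout ls `<=` @box R k.
Proof.
move=> z [z01 H]; split=> //.
have k1 (e : entry R k) : 1 <= (letter e).+1%:R :> R by rewrite ler1n.
have kk (e : entry R k) : (letter e).+2%:R <= k%:R :> R.
  by rewrite ler_nat; case: (letter e); case: (k) => [[]|n []].
case: H => [[e _ [_ /strands_spans]]|[j -> _]].
  by have := k1 e; have := kk e; rewrite /spans; lra.
have : j.+1%:R <= k%:R :> R by rewrite ler_nat.
have : 1 <= j.+1%:R :> R by rewrite ler1n.
by lra.
Qed.

Lemma config_sub_box k (w : tw_word k) : config w `<=` @box R k.
Proof. by rewrite config_layout; exact: layout_sub_box. Qed.

(** The affine map placing the layers of a word of length [n] on [m] arcs at the
    layers [a, ..., a + n - 1], among [L], and at the arcs [c, ..., c + m - 1]. *)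
Definition place (c a n L : nat) (z : plane) : plane :=
  (1 * z.1 + c%:R, n%:R / L%:R * z.2 + a%:R / L%:R).

Lemma diffeo_place c a n L : (0 < n)%N -> (0 < L)%N -> diffeo (place c a n L).
Proof.
move=> n0 L0; apply: diffeo_affine; first exact: oner_neq0.
by rewrite mulf_neq0 ?invr_eq0 // pnatr_eq0 -lt0n.
Qed.

Lemma place_box c a n L m k z : (0 < L)%N -> (a + n <= L)%N -> (c + m <= k)%N ->
  @box R m z -> @box R k (place c a n L z).
Proof.
move=> L0 anL cmk [/andP[x1 x2] /andP[y1 y2]]; rewrite /place /box /=.
have Lr : 0 < L%:R :> R by rewrite ltr0n.
have -> : n%:R / L%:R * z.2 + a%:R / L%:R = (a%:R + n%:R * z.2) / L%:R by ring.
have cmk' : c%:R + m%:R <= k%:R :> R by rewrite -natrD ler_nat.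
have c0 : 0 <= c%:R :> R by [].
split; first by apply/andP; split; lra.
rewrite divr_ge0 ?addr_ge0 ?mulr_ge0 //= ler_pdivrMr // mul1r.
have : (a + n)%:R <= L%:R :> R by rewrite ler_nat.
rewrite natrD; apply: le_trans; rewrite lerD2l ler_piMr //.
Qed.

Lemma config_block (m k c : nat) (b : tw_word m) (u b' v : tw_word k) (z : plane) :
  map val b' = [seq (c + val j)%N | j <- b] -> b != [::] -> (c + m <= k)%N ->
  @box R m z ->
  config b z <->
  config (u ++ b' ++ v) (place c (size u) (size b) (size (u ++ b' ++ v)) z).
Proof.
move=> bb' b0 cmk [xm y01].
have n0 : (0 < size b)%N by rewrite lt0n size_eq0.
have [a [t [an t01 yE]]] := layers_cover n0 y01.
have sbb : size b' = size b by have := congr1 size bb'; rewrite !size_map.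
have j0 : 'I_m.-1 by case: (b) b0.
have j0' : 'I_k.-1 by case: (b') sbb n0 => [/= <-|].
pose b1 := take a b; pose j := nth j0 b a; pose b2 := drop a.+1 b.
pose b1' := take a b'; pose j' := nth j0' b' a; pose b2' := drop a.+1 b'.
have bE : b = b1 ++ j :: b2 by rewrite -drop_nth // cat_take_drop.
have bE' : b' = b1' ++ j' :: b2' by rewrite -drop_nth ?sbb // cat_take_drop.
have sb1 : size b1 = a by rewrite size_take an.
have sb1' : size b1' = a by rewrite size_take sbb an.
have jj : j' = (c + j)%N :> nat.
  have := congr1 (fun s => nth 0%N s a) bb'.
  by rewrite (nth_map j0') ?sbb // (nth_map j0).
have [x y] := z; case: z xm y01 yE => x' y' /= xm y01 yE {x y}.
have nr : (size b)%:R != 0 :> R by rewrite pnatr_eq0 -lt0n.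
have Lr : (size (u ++ b' ++ v))%:R != 0 :> R.
  by rewrite pnatr_eq0 !size_cat; lia.
rewrite /place /= mul1r [x' + _]addrC.
have -> : (size b)%:R / (size (u ++ b' ++ v))%:R * y' +
    (size u)%:R / (size (u ++ b' ++ v))%:R =
    ((size (u ++ b1'))%:R + t) / (size (u ++ b' ++ v))%:R.
  rewrite [size (u ++ b1')]size_cat sb1' natrD yE.
  by move: Lr nr; set L := _%:R; set n := _%:R => *; field; apply/andP.
have -> : u ++ b' ++ v = (u ++ b1') ++ j' :: (b2' ++ v).
  by rewrite [in LHS]bE' -!catA.
rewrite (config_layer _ _ _ _ t01) -(crossing_shift t jj cmk xm) yE -sb1.
by rewrite {1 2}bE; exact: config_layer.
Qed.

(** Local moves take place in a small box inside the disc of the tangle; their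
    effect is again a filling of that disc. *)
Lemma refill_patch (m k : nat) (E A : plane -> plane) (S S' C D : set plane) :
  injective E -> (forall z, @box R m z -> @box R k (A z)) ->
  S `<=` @box R k -> S' `<=` @box R k -> C `<=` @box R m ->
  (forall z, @box R m z -> C z <-> S' (A z)) ->
  (forall z, @box R k z -> ~ (A @` @box R m) z -> S z <-> S' z) ->
  refill k E S' D = refill m (E \o A) C (refill k E S D).
Proof.
move=> iE bA Sb S'b Cb CS' SS'.
apply/seteqP; split=> w.
  have [[z bz <-]|nw] := pselect (((E \o A) @` @box R m) w).
    move=> [[_ []]|[s S's /iE sE]]; first by exists (A z) => //; exact: bA.
    by right; exists z => //; apply/CS' => //; rewrite -sE.
  move=> [[Dw nbw]|[s S's sE]]; left; split=> //; first by left.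
  right; exists s => //; apply/SS' => //; first exact: S'b.
  by move=> [z bz zs]; apply: nw; exists z => //=; rewrite zs.
move=> [[[[Dw nbw]|[s Ss sE]] nw]|[z Cz <-]].
- by left.
- right; exists s => //; apply/SS' => //; first exact: Sb.
  by move=> [z bz zs]; apply: nw; exists z => //=; rewrite zs.
- by right; exists (A z) => //; apply/CS' => //; exact: Cb.
Qed.

End Blocks.

Section Invariance.
Variables (R : realType) (k : nat).
Local Notation plane := (R * R)%type.
Implicit Types (e r : entry R k) (ls X : seq (entry R k)) (u v w : tw_word k).
Variables (E : plane -> plane) (D : set plane).
Hypothesis dE : diffeo E.

Fixpoint stacked (A : R) ls : Prop :=
  if ls is e :: ls' then [/\ A < bottom e, 0 < e.2 & stacked (top e) ls'] else A < 1.

Lemma bottom_lt_top e : 0 < e.2 -> bottom e < top e.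
Proof. by rewrite /bottom /top; lra. Qed.

Lemma stacked_le A A' ls : A' <= A -> stacked A ls -> stacked A' ls.
Proof.
by case: ls => [|e ls] A'A /=; [exact: le_lt_trans | move=> [Ae ? ?]; split=> //; lra].
Qed.

Lemma stacked_room A ls : stacked A ls -> exists B, [/\ A < B, B <= 1 &
  forall r, r \in ls -> B <= bottom r].
Proof.
elim: ls A => [|e ls IH] A /=; first by exists 1.
move=> [Ae e0 /IH[B [eB B1 H]]]; exists (bottom e).
have := bottom_lt_top e0 => bt; split=> //; first by lra.
by move=> r; rewrite inE => /predU1P[->//|/H]; lra.
Qed.

Local Notation filled ls := (refill k E (layout ls) D).

Lemma filled_perm X e ls : filled (X ++ e :: ls) = filled (e :: (X ++ ls)).
Proof.
rewrite (@layout_mem _ _ _ (e :: (X ++ ls))) // => r.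
by rewrite !(inE, mem_cat); case: (r == e); rewrite ?orbT.
Qed.

Lemma slide_lowest X e e' ls A : letter e = letter e' -> 0 < e'.2 -> 0 <= A ->
  (forall r, r \in X -> top r <= A) -> stacked A (e :: ls) ->
  A < bottom e' -> top e' <= top e ->
  link_projection (filled (X ++ e :: ls)) ->
  requiv (filled (X ++ e :: ls)) (filled (X ++ e' :: ls)).
Proof.
rewrite !filled_perm => le e'0 A0 XA [Ae e0 st] Ae' e'e.
have [B [eB B1 HB]] := stacked_room st.
apply: (@slide _ _ _ _ _ _ _ A B) => //; first exact: le_lt_trans e'e eB.
by move=> r; rewrite mem_cat => /orP[/XA|/HB]; [left|right].
Qed.

(** Pushing the crossings down one after the other, both layouts can be brought
    to a common compressed one. *)
Lemma stacked_requiv ls ls' X A : map (@letter R k) ls = map (@letter R k) ls' ->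
  0 <= A -> (forall r, r \in X -> top r <= A) -> stacked A ls -> stacked A ls' ->
  link_projection (filled (X ++ ls)) ->
  requiv (filled (X ++ ls)) (filled (X ++ ls')).
Proof.
elim: ls ls' X A => [|e ls IH] [|e' ls'] //= X A.
  by move=> _ _ _ _ _ /requiv_refl.
move=> [le lls] A0 XA st st' lD; case: (st) (st') => Ae e0 es [Ae' e0' es'].
pose m := Num.min (bottom e) (bottom e').
have Am : A < m by rewrite lt_min Ae.
have me : m <= bottom e by rewrite ge_min lexx.
have me' : m <= bottom e' by rewrite ge_min lexx orbT.
pose e2 : entry R k := (letter e, A, m - A).
have e20 : 0 < e2.2 by rewrite subr_gt0.
have te2 : top e2 < m by rewrite /top /=; lra.
have be2 : A < bottom e2 by rewrite /bottom /=; lra.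
have te : bottom e < top e := bottom_lt_top e0.
have te' : bottom e' < top e' := bottom_lt_top e0'.
have R1 : requiv (filled (X ++ e :: ls)) (filled (X ++ e2 :: ls)).
  by apply: (@slide_lowest _ _ _ _ A) => //; lra.
have R2 : requiv (filled (X ++ e2 :: ls)) (filled (X ++ e2 :: ls')).
  rewrite -!cat_rcons; apply: (IH _ _ (top e2)) => //.
  - by have := bottom_lt_top e20; lra.
  - move=> r; rewrite mem_rcons inE => /predU1P[->//|/XA].
    by have := bottom_lt_top e20; lra.
  - by apply: stacked_le es; lra.
  - by apply: stacked_le es'; lra.
  - by rewrite cat_rcons; exact: requiv_r R1.
apply: requiv_trans R1 (requiv_trans R2 _).
have [B [eB B1 HB]] := stacked_room es'.
rewrite !filled_perm.
apply: (@slide _ _ _ _ _ _ _ A B) => //; first by lra.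
  by move=> r; rewrite mem_cat => /orP[/XA|/HB]; [left|right].
by rewrite -filled_perm; exact: requiv_r R2.
Qed.

Lemma entries_stacked (L a : nat) w ls A : (0 < L)%N -> (a + size w <= L)%N ->
  A < (a%:R + 3^-1) / L%:R -> A < 1 ->
  (forall A', A' < ((a + size w)%:R + 3^-1) / L%:R -> A' < 1 -> stacked A' ls) ->
  stacked A (entries R L a w ++ ls).
Proof.
move=> L0; have Lr : 0 < L%:R :> R by rewrite ltr0n.
elim: w a A => [|i w IH] a A /=.
  by rewrite addn0 => _ Aa A1; apply.
move=> awL Aa A1 Hls; split.
- rewrite /bottom /=; apply: (lt_le_trans Aa); rewrite le_eqVlt; apply/orP; left.
  by apply/eqP; ring.
- by rewrite /= invr_gt0.
have -> : top ((i, a%:R / L%:R, L%:R^-1) : entry R k) = (a%:R + 2 / 3) / L%:R.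
  by rewrite /top /=; ring.
apply: IH; first by lia.
- by rewrite ltr_pM2r ?invr_gt0 // -natr1; lra.
- rewrite ltr_pdivrMr // mul1r.
  have : a.+1%:R <= L%:R :> R by rewrite ler_nat; lia.
  by rewrite -natr1; lra.
- by rewrite addSnnS.
Qed.

Lemma standard_stacked w : stacked 0 (standard R w).
Proof.
have [->|w0] := eqVneq w [::]; first exact: ltr01.
have L0 : (0 < size w)%N by rewrite lt0n size_eq0.
rewrite -[standard R w]cats0; apply: entries_stacked => //.
by rewrite add0r divr_gt0 // ltr0n.
Qed.

Lemma entries_letter (L a : nat) w : map (@letter R k) (entries R L a w) = w.
Proof. by elim: w a => [|i w IH] a //=; rewrite IH. Qed.

Lemma entries_range (L a : nat) w r : r \in entries R L a w ->
  a%:R / L%:R <= bottom r /\ top r <= (a + size w)%:R / L%:R.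
Proof.
move=> /entriesP[u [i [v [-> ->]]]]; rewrite /bottom /top /=.
have Li : 0 <= L%:R^-1 :> R by rewrite invr_ge0.
have -> : (a + size u)%:R / L%:R + L%:R^-1 / 3 = ((a + size u)%:R + 3^-1) / L%:R :> R.
  by ring.
have -> : (a + size u)%:R / L%:R + L%:R^-1 * (2 / 3) =
    ((a + size u)%:R + 2 / 3) / L%:R :> R by ring.
have u0 : 0 <= (size u)%:R :> R by [].
have v0 : 0 <= (size v)%:R :> R by [].
rewrite size_cat /= addnA addnS -[(_ + _).+1%:R]natr1 !natrD.
by split; rewrite ler_wpM2r //; lra.
Qed.

Lemma fill_standard w : fill E w D = filled (standard R w).
Proof. by rewrite /fill /refill config_layout. Qed.

Hypothesis link_fill : forall w, link_projection (fill E w D).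

(** The two crossings slide past each other: the first one goes up to the height
    of the second, which it cannot meet, and then the second one goes down. *)
Lemma comm_requiv u v (i j : 'I_k.-1) : (i.+1 < j)%N ->
  requiv (fill E (u ++ [:: i; j] ++ v) D) (fill E (u ++ [:: j; i] ++ v) D).
Proof.
move=> ij; set w := u ++ [:: i; j] ++ v; set w' := u ++ [:: j; i] ++ v.
pose L := size w; have Lw' : size w' = L by rewrite /L !size_cat.
have wL : L = (size u + (size v).+2)%N by rewrite /L !size_cat.
have L0 : (0 < L)%N by rewrite wL; lia.
have Lr : 0 < L%:R :> R by rewrite ltr0n.
have Li : 0 < L%:R^-1 :> R by rewrite invr_gt0.
have lw := link_fill w; rewrite !fill_standard in lw *.
pose a := size u; pose U := entries R L 0 u; pose V := entries R L a.+2 v.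
pose e1 := (i, a%:R / L%:R, L%:R^-1) : entry R k.
pose e1' := (i, a.+1%:R / L%:R, L%:R^-1) : entry R k.
pose e2 := (j, a.+1%:R / L%:R, L%:R^-1) : entry R k.
pose e2' := (j, a%:R / L%:R, L%:R^-1) : entry R k.
have wE : standard R w = U ++ e1 :: e2 :: V.
  by rewrite /standard -/L !entries_cat add0n /= !addnS addn0.
have wE' : standard R w' = U ++ e2' :: e1' :: V.
  by rewrite /standard Lw' !entries_cat add0n /= !addnS addn0.
have UA r : r \in U -> top r <= a%:R / L%:R.
  by move=> /entries_range[_]; rewrite add0n.
have VB r : r \in V -> a.+2%:R / L%:R <= bottom r.
  by move=> /entries_range[].
have n01 : ~~ near_letters i j by rewrite /near_letters; lia.
have n10 : ~~ near_letters j i by rewrite /near_letters; lia.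
have A0 : 0 <= a%:R / L%:R :> R by rewrite divr_ge0 // ltW.
have B1 : a.+2%:R / L%:R <= 1 :> R.
  by rewrite ler_pdivrMr // mul1r ler_nat wL; lia.
have b1 n : bottom ((i, n%:R / L%:R, L%:R^-1) : entry R k) = (n%:R + 3^-1) / L%:R.
  by rewrite /bottom /=; ring.
have b2 n : bottom ((j, n%:R / L%:R, L%:R^-1) : entry R k) = (n%:R + 3^-1) / L%:R.
  by rewrite /bottom /=; ring.
have t1 n : top ((i, n%:R / L%:R, L%:R^-1) : entry R k) = (n%:R + 2 / 3) / L%:R.
  by rewrite /top /=; ring.
have t2 n : top ((j, n%:R / L%:R, L%:R^-1) : entry R k) = (n%:R + 2 / 3) / L%:R.
  by rewrite /top /=; ring.
have S2 : a.+2%:R = a%:R + 2 :> R by rewrite -addn2 natrD.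
have S1 : a.+1%:R = a%:R + 1 :> R by rewrite -natr1.
have R1 : requiv (filled (e1 :: (U ++ e2 :: V))) (filled (e1' :: (U ++ e2 :: V))).
  apply: (@slide _ _ _ _ e1 e1' _ (a%:R / L%:R) (a.+2%:R / L%:R) dE erefl Li Li A0 B1).
  - by rewrite b1 ltr_pM2r //; lra.
  - by rewrite t1 ltr_pM2r // S2; lra.
  - by rewrite b1 ltr_pM2r // S1; lra.
  - by rewrite t1 ltr_pM2r // S2 S1; lra.
  - move=> r; rewrite mem_cat inE => /or3P[/UA ?|/eqP-> nr|/VB ?]; [by left| |by right].
    by rewrite nr in n01.
  - by rewrite -filled_perm -wE.
have LM : layout (e1' :: U ++ e2 :: V) = layout (e2 :: U ++ e1' :: V).
  apply: layout_mem => r.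
  by rewrite !(mem_cat, inE); do !case: (_ == _); rewrite ?orbT.
have R2 : requiv (filled (e2 :: (U ++ e1' :: V))) (filled (e2' :: (U ++ e1' :: V))).
  apply: (@slide _ _ _ _ e2 e2' _ (a%:R / L%:R) (a.+2%:R / L%:R) dE erefl Li Li A0 B1).
  - by rewrite b2 ltr_pM2r // S1; lra.
  - by rewrite t2 ltr_pM2r // S2 S1; lra.
  - by rewrite b2 ltr_pM2r //; lra.
  - by rewrite t2 ltr_pM2r // S2; lra.
  - move=> r; rewrite mem_cat inE => /or3P[/UA ?|/eqP-> nr|/VB ?]; [by left| |by right].
    by rewrite nr in n10.
  - by rewrite -LM; exact: requiv_r R1.
rewrite wE wE' !filled_perm; apply: (requiv_trans R1).
by rewrite LM; exact: R2.
Qed.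

Lemma entries_inactive (L a : nat) w r y : (0 < L)%N -> r \in entries R L a w ->
  y <= a%:R / L%:R \/ (a + size w)%:R / L%:R <= y -> active r y = false.
Proof.
move=> L0 /entries_range[rb rt] yy; apply/negbTE.
by rewrite /active negb_and -!leNgt; case: yy => ?; apply/orP; [left|right]; lra.
Qed.

Lemma layout_drop ls ls' (z : plane) : {subset ls' <= ls} ->
  (forall e, e \in ls -> e \notin ls' -> active e z.2 -> ~~ spans e z.1) ->
  layout ls z <-> layout ls' z.
Proof.
move=> sub H; split=> -[z01 [[e el [act st]]|[j zj Hj]]]; split=> //.
- left; exists e => //; apply: contraT => el'.
  by have := H e el el' act; rewrite (strands_spans st).
- by right; exists j => // e /sub; exact: Hj.
- by left; exists e => //; exact: sub.
- right; exists j => // e el act; have [/Hj|el'] := boolP (e \in ls'); first exact.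
  apply/negP => /involved_spans; rewrite -zj => s.
  by have := H e el el' act; rewrite s.
Qed.

(** A bigon is removed by a self-tangency; the remaining crossings are then
    spread over layers of equal heights. *)
Lemma square_requiv u v (i : 'I_k.-1) :
  requiv (fill E (u ++ [:: i; i] ++ v) D) (fill E (u ++ v) D).
Proof.
set w := u ++ [:: i; i] ++ v.
pose L := size w; have wL : L = (size u + (size v).+2)%N by rewrite /L !size_cat.
have L0 : (0 < L)%N by rewrite wL; lia.
have Lr : 0 < L%:R :> R by rewrite ltr0n.
have Li : 0 < L%:R^-1 :> R by rewrite invr_gt0.
have ik : (i + 2 <= k)%N by case: (i) => n /=; lia.
pose a := size u; pose U := entries R L 0 u; pose V := entries R L a.+2 v.
pose e1 := (i, a%:R / L%:R, L%:R^-1) : entry R k.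
pose e2 := (i, a.+1%:R / L%:R, L%:R^-1) : entry R k.
have wE : standard R w = U ++ e1 :: e2 :: V.
  by rewrite /standard -/L !entries_cat add0n /= !addnS addn0.
have R1 : requiv (fill E (u ++ v) D) (filled (U ++ V)).
  have lv := link_fill (u ++ v); rewrite !fill_standard in lv *.
  have [uv0|uv0] := eqVneq (u ++ v) [::].
    move: uv0 lv; rewrite /U /V /standard; case: (u) (v) => [|? ?] [|? ?] //= _ lv.
    exact: requiv_refl.
  apply: (@stacked_requiv _ _ [::] 0) => //=.
  - by rewrite entries_letter map_cat !entries_letter.
  - exact: standard_stacked.
  - apply: entries_stacked => //; first by rewrite wL; lia.
      by rewrite add0r divr_gt0.
    move=> A A1 A2; rewrite -[V]cats0; apply: entries_stacked => //.
      by rewrite wL; lia.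
    apply: (lt_trans A1); rewrite add0n ltr_pM2r // ltrD2r ltr_nat.
    by rewrite -/a; lia.
apply: requiv_sym; apply: (requiv_trans R1); apply: requiv_sym.
have lw := link_fill w; have lUV := requiv_r R1.
pose P := place i a 2 L : plane -> plane.
have dP : diffeo P by exact: diffeo_place.
have iE : injective E by have [? [_ /can_inj]] := diffeo_inv dE.
have [P' [_ PK PK']] := diffeo_inv dP.
have Pbox z : @box R 2 z -> @box R k (P z).
  by apply: place_box => //; rewrite wL; lia.
have noUV r (z : plane) : r \in U ++ V -> (P @` @box R 2) z -> active r z.2 = false.
  move=> rUV [[x y] [/= _ /andP[y0 y1]] <-]; rewrite /P /place /=.
  have Py : a%:R / L%:R <= 2 / L%:R * y + a%:R / L%:R <= a.+2%:R / L%:R.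
    have -> : 2 / L%:R * y + a%:R / L%:R = (2 * y + a%:R) / L%:R by ring.
    by rewrite !ler_pM2r // -addn2 natrD; apply/andP; split; lra.
  case/andP: Py => Py1 Py2; move: rUV; rewrite mem_cat => /orP[rU|rV].
    by apply: (entries_inactive L0 rU); right; rewrite add0n.
  by apply: (entries_inactive L0 rV); left.
have not_box (z : plane) e : @box R k z -> ~ (P @` @box R 2) z ->
    e = e1 \/ e = e2 -> active e z.2 -> ~~ spans e z.1.
  move=> _ nz ee act; apply/negP => sp; apply: nz.
  have y12 : a%:R / L%:R <= z.2 <= a.+2%:R / L%:R.
    have q1 : a.+1%:R / L%:R = a%:R / L%:R + L%:R^-1 :> R.
      by rewrite -natr1 mulrDl mul1r.
    have q2 : a.+2%:R / L%:R = a%:R / L%:R + 2 * L%:R^-1 :> R.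
      by rewrite -addn2 natrD mulrDl.
    move: act; rewrite /active /bottom /top q2.
    by case: ee => ->; rewrite /= ?q1 => /andP[? ?]; apply/andP; split; lra.
  have x12 : i.+1%:R <= z.1 <= i.+2%:R by case: ee sp => ->.
  exists (P' z); last exact: PK'.
  have := PK' z; case: (P' z) => x y; rewrite /P /place /= => zE.
  move: y12 x12; rewrite -zE /= => y12 x12.
  have x12' : i%:R + 1 <= 1 * x + i%:R <= i%:R + 2.
    by move: x12; rewrite -[i.+2%:R]natr1 -natr1; lra.
  split; apply/andP; split; rewrite /=; try lra.
    have : 0 <= 2 / L%:R * y by lra.
    by rewrite pmulr_rge0 // divr_gt0.
  have : 2 / L%:R * y <= 2 / L%:R * 1 by move: y12; rewrite -addn2 natrD; lra.
  by rewrite ler_pM2l // divr_gt0.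
exists lw, lUV; apply: req_self_tangency; exists (E \o P) => /=.
split; first exact: diffeo_comp.
- rewrite -[RHS]/(refill 2 (E \o P) (config ([:: ord0; ord0] : tw_word 2))
    (refill k E (config w) D)).
  apply: refill_patch => //; try exact: config_sub_box.
  move=> z bz.
  apply: (@config_block _ 2 k i ([:: ord0; ord0] : tw_word 2) u [:: i; i] v) => //=.
  by rewrite addn0.
- rewrite -[RHS]/(refill 2 (E \o P) (config ([::] : tw_word 2))
    (refill k E (config w) D)).
  apply: refill_patch => //; try exact: config_sub_box; try exact: layout_sub_box.
  + move=> z bz; have Pz : (P @` @box R 2) (P z) by exists z.
    have [_ /= Pz01] := Pbox _ bz.
    rewrite [X in _ <-> X]/layout /config /=; split=> [[z01 [j zj]]|[_ H]].
      split=> //; right.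
      have jk : (i + j < k)%N by have := ltn_ord j; lia.
      exists (Ordinal jk); first by rewrite /= zj mul1r -natrD addSn addnC.
      by move=> e eUV; rewrite (noUV _ _ eUV Pz).
    case: bz => x12 z01; split=> //.
    case: H => [[e eUV [act _]]|[j zj _]].
      by rewrite (noUV _ _ eUV Pz) in act.
    move: zj; rewrite mul1r => zj.
    have zE : z.1 = j.+1%:R - i%:R by lra.
    have ij : (i < j.+1)%N by rewrite -(@ltr_nat R); lra.
    have ji : (j.+1 < i + 3)%N by rewrite -(@ltr_nat R) natrD; lra.
    have j2 : (j - i < 2)%N by lia.
    exists (Ordinal j2); rewrite zE /=.
    have -> : (j - i).+1 = (j.+1 - i)%N by lia.
    by rewrite natrB // ltnW.
  + move=> z bz nz; rewrite config_layout wE; apply: layout_drop.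
      move=> r; rewrite !mem_cat !inE => /orP[->//|->].
      by rewrite !orbT.
    move=> e; rewrite !mem_cat !inE => /or4P[|/eqP ee|/eqP ee|] H1 H2.
    * by rewrite H1 in H2.
    * by apply: not_box => //; left.
    * by apply: not_box => //; right.
    * by rewrite H1 orbT in H2.
Qed.

(** Of the two defining relations of the twin group, one is a self-tangency and the
    other a pair of slides. *)
Lemma tw_eqv_requiv u v : tw_eqv u v -> requiv (fill E u D) (fill E v D).
Proof.
elim=> [w|w1 w2 _|w1 w2 w3 _ r12 _|x y i|x y i j ij].
- exact: requiv_refl.
- exact: requiv_sym.
- exact: requiv_trans r12.
- exact: square_requiv.
- exact: comm_requiv.
Qed.

End Invariance.

(** * Double points *)

Section DoublePoints.
Variable R : realType.
Local Notation plane := (R * R)%type.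

Lemma derive_lin_out (L : {linear (R^o * R^o)%type -> R^o}) (q : R^o -> R^o * R^o) t :
  continuous L -> differentiable q t ->
  'D_1 (fun t => L (q t)) t = L ('D_1 q t).
Proof.
move=> cL dq.
have dL : differentiable L (q t) by exact: linear_differentiable.
rewrite (deriveE _ dq) (deriveE _ (differentiable_comp dq dL)).
rewrite (congr1 (fun f => f 1) (diff_comp dq dL)) /=.
exact: (congr1 (fun f => f ('d q t 1)) (diff_lin (q t) cL)).
Qed.

Lemma derive_fst (q : R^o -> R^o * R^o) t : differentiable q t ->
  'D_1 (fun t => (q t).1) t = ('D_1 q t).1.
Proof. by move=> dq; apply: (@derive_lin_out fst q t) => // z; exact: cvg_fst. Qed.

Lemma derive_snd (q : R^o -> R^o * R^o) t : differentiable q t ->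
  'D_1 (fun t => (q t).2) t = ('D_1 q t).2.
Proof. by move=> dq; apply: (@derive_lin_out snd q t) => // z; exact: cvg_snd. Qed.

Lemma differentiable_fst (q : R^o -> R^o * R^o) t : differentiable q t ->
  differentiable (fun t => (q t).1) t.
Proof.
move=> dq; apply: (differentiable_comp dq).
by apply: (@linear_differentiable _ _ _ fst) => z; exact: cvg_fst.
Qed.

Lemma differentiable_snd (q : R^o -> R^o * R^o) t : differentiable q t ->
  differentiable (fun t => (q t).2) t.
Proof.
move=> dq; apply: (differentiable_comp dq).
by apply: (@linear_differentiable _ _ _ snd) => z; exact: cvg_snd.
Qed.

Lemma first_order (f : R^o -> R^o) t0 (e : R) : 0 < e -> differentiable f t0 ->
  exists2 d : R, 0 < d & forall t : R, `|t - t0| < d ->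
    `|f t - f t0 - 'D_1 f t0 * (t - t0)| <= e * `|t - t0|.
Proof.
move=> e0 df; have /nbhs_ballP[d d0 H] := differentiable_eps df e0.
exists d; first exact: d0.
move=> t td; have /H : ball (0 : R^o) d (t - t0).
  by rewrite -ball_normE /= sub0r normrN.
rewrite /= subrK.
have -> : 'd f t0 (t - t0) = 'D_1 f t0 * (t - t0).
  by rewrite (deriveE _ df) -[t - t0 in LHS]mulr1 [LHS]linearZ mulrC.
by [].
Qed.

(** Otherwise the curve would leave the tangent line of the graph at a rate of the
    order of [|t - t0|], hence of at least the order of [|y - y0|], whereas the
    points of the graph stay at a distance [o(|y - y0|)] from it. *)
Lemma tangent_graph (q : R^o -> R^o * R^o) (phi : R^o -> R^o) (t0 y0 : R) :
  differentiable q t0 -> differentiable phi y0 -> q t0 = (phi y0, y0) ->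
  (forall e : R, 0 < e -> exists2 d : R, 0 < d & forall y : R, `|y - y0| < d ->
     exists2 t : R, `|t - t0| < e & q t = (phi y, y)) ->
  ('D_1 q t0).1 = 'D_1 phi y0 * ('D_1 q t0).2.
Proof.
move=> dq dphi q0 H; apply/eqP/negPn/negP => neq.
set a := 'D_1 q t0 in neq *; set c := 'D_1 phi y0 in neq *.
pose D0 := `|a.1 - c * a.2|; have D00 : 0 < D0 by rewrite normr_gt0 subr_eq0.
pose M := `|a.2| + 1; have M0 : 0 < M by rewrite ltr_wpDl.
pose N := 1 + `|c|; have N0 : 0 < N by rewrite ltr_pwDl.
pose e1 := D0 / (4 * N); have e10 : 0 < e1 by rewrite divr_gt0 ?mulr_gt0.
pose e2 := D0 / (4 * M); have e20 : 0 < e2 by rewrite divr_gt0 ?mulr_gt0.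
have [d1 d10 H1] := first_order e10 (differentiable_fst dq).
have [d2 d20 H2] := first_order e10 (differentiable_snd dq).
have [d3 d30 H3] := first_order ltr01 (differentiable_snd dq).
have [d4 d40 H4] := first_order e20 dphi.
pose d := Num.min d1 (Num.min d2 d3).
have d0 : 0 < d by rewrite !lt_min d10 d20.
have [d5 d50 H5] := H _ d0.
pose h := Num.min d4 d5 / 2.
have h0 : 0 < h by rewrite divr_gt0 // lt_min d40.
have h4 : h < d4.
  have : Num.min d4 d5 <= d4 by rewrite ge_min lexx.
  by rewrite /h; lra.
have h5 : h < d5.
  have : Num.min d4 d5 <= d5 by rewrite ge_min lexx orbT.
  by rewrite /h; lra.
have hh : `|y0 + h - y0| = h by rewrite addrC addKr gtr0_norm.
have [|t td qt] := H5 (y0 + h); first by rewrite hh.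
have := H4 (y0 + h); rewrite hh => /(_ h4) B4.
have /H1 B1 : `|t - t0| < d1 by apply: lt_le_trans td _; rewrite ge_min lexx.
have /H2 B2 : `|t - t0| < d2.
  by apply: lt_le_trans td _; rewrite !ge_min lexx orbT.
have /H3 B3 : `|t - t0| < d3.
  by apply: lt_le_trans td _; rewrite !ge_min lexx !orbT.
rewrite qt q0 derive_fst //= -/a in B1.
rewrite qt q0 derive_snd //= -/a in B2.
rewrite qt q0 derive_snd //= -/a in B3.
have yy : y0 + h - y0 = h by rewrite addrC addKr.
rewrite yy in B2 B3 B4.
set u := `|t - t0| in B1 B2 B3 *.
have u0 : 0 <= u by exact: normr_ge0.
have hu : h <= M * u.
  rewrite -(gtr0_norm h0) -[X in `|X|](subrK (a.2 * (t - t0))).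
  apply: (le_trans (ler_normD _ _)); rewrite normrM -/u /M.
  by lra.
have main : D0 * u <= e1 * u + `|c| * (e1 * u) + e2 * h.
  rewrite /D0 /u -normrM -/u.
  have -> : (a.1 - c * a.2) * (t - t0) =
     - (phi (y0 + h) - phi y0 - a.1 * (t - t0)) + c * (h - a.2 * (t - t0))
     + (phi (y0 + h) - phi y0 - c * h) by ring.
  apply: (le_trans (ler_normD _ _)); apply: lerD => //.
  apply: (le_trans (ler_normD _ _)); apply: lerD; first by rewrite normrN.
  by rewrite normrM ler_wpM2l.
have t1 : e1 * u + `|c| * (e1 * u) = D0 / 4 * u.
  by rewrite /e1; have /lt0r_neq0 := N0; rewrite /N => ?; field.
have t2 : e2 * h <= D0 / 4 * u.
  apply: (@le_trans _ _ (e2 * (M * u))); first by rewrite ler_wpM2l // ltW.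
  rewrite le_eqVlt; apply/orP; left; apply/eqP.
  by rewrite /e2; have /lt0r_neq0 := M0; rewrite /M => ?; field.
have : D0 * u <= 0 by lra.
rewrite pmulr_rle0 // => u00; have uE : u = 0 by apply/eqP; rewrite eq_le u00.
by move: hu; rewrite uE mulr0 leNgt h0.
Qed.

Lemma tangent_of_near_graph (q : R^o -> R^o * R^o) (phi : R^o -> R^o) (t0 y0 : R) :
  differentiable q t0 -> differentiable phi y0 -> (q t0).2 = y0 ->
  (\forall t \near t0, (q t).1 = phi (q t).2) ->
  ('D_1 q t0).1 = 'D_1 phi y0 * ('D_1 q t0).2.
Proof.
move=> dq dphi q2 qphi.
rewrite -(derive_fst dq) -(derive_snd dq).
rewrite (near_eq_derive (g := fun t => phi (q t).2) _ qphi).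
rewrite (@derive_comp1 _ phi (fun t => (q t).2)) ?q2 //.
exact: differentiable_snd.
Qed.

Lemma periodic_int (f : R -> plane) : (forall t, f (t + 1) = f t) ->
  forall (n : int) t, f (t + n%:~R) = f t.
Proof.
move=> f1; have fn (n : nat) t : f (t + n%:R) = f t.
  by elim: n t => [|n IH] t; rewrite ?addr0 // -natr1 addrA f1.
case=> n t; first exact: fn.
by rewrite NegzE mulrNz -[in RHS](subrK n.+1%:R t) fn.
Qed.

(** By compactness of the circles, the points of the projection close to a point
    with a single preimage have preimages close to that one. *)
Lemma near_preimage m (g : 'I_m -> R -> plane) (i0 : 'I_m) (t0 e : R) :
  generic_immersion g -> 0 < e ->
  (forall v : 'I_m * R, g v.1 v.2 = g i0 t0 -> same_point (i0, t0) v) ->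
  \forall w \near g i0 t0, image_of g w ->
    exists2 t : R, `|t - t0| < e & g i0 t = w.
Proof.
move=> [gs gp _ _ _] e0 single.
have cg i : continuous (g i).
  by move=> t; exact: differentiable_continuous (differentiable_curve t (gs i)).
pose K i : set R := 
  if i == i0 then `[t0 + e, t0 + 1 - e]%classic else `[0, 1]%classic.
have cK i : closed (g i @` K i).
  apply: compact_closed; first exact: norm_hausdorff.
  apply: continuous_compact; first by apply: continuous_subspaceT.
  by rewrite /K; case: ifP => _; exact: segment_compact.
have nK i : ~ (g i @` K i) (g i0 t0).
  move=> [t Kt gt]; have [/= ii /intrP[n nE]] := single (i, t) gt.
  move: Kt; rewrite /K -ii eqxx /= in_itv /= => /andP[h1 h2].
  have n0 : (n%:~R : R) < 0 by rewrite -nE; lra.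
  have n1 : ((-1)%:~R : R) < n%:~R by rewrite -nE; lra.
  by move: n0 n1; rewrite ltr_int ltrz0; lia.
have /filter_forall : forall i, \forall w \near g i0 t0, ~ (g i @` K i) w.
  move=> i; have : open (~` (g i @` K i)) by rewrite openC.
  by rewrite openE => /(_ _ (nK i)).
apply: filterS => w nKw [i _ [s _ gsw]].
have red (a : R) : exists2 s', a <= s' < a + 1 & g i s' = w.
  exists (s - (Num.floor (s - a))%:~R).
    have := floor_itv (s - a).
    by rewrite intrD => /andP[h1 h2]; apply/andP; split; lra.
  by rewrite -mulrNz periodic_int.
have [ii|ii] := eqVneq i i0; last first.
  have [s' /andP[s0 s1] gs'] := red 0.
  case: (nKw i); exists s' => //; rewrite /K (negbTE ii) /= in_itv /= s0.
  by rewrite add0r in s1; rewrite ltW.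
have [s' /andP[s0 s1] gs'] := red t0.
have [st|st] := ltP s' (t0 + e).
  exists s'; last by rewrite -ii.
  by rewrite ger0_norm ?subr_ge0 //; lra.
have [st'|st'] := leP s' (t0 + 1 - e).
  by case: (nKw i); exists s' => //; rewrite /K ii eqxx /= in_itv /= st.
exists (s' - 1); last by rewrite -ii -[g i (s' - 1)]gp subrK.
by rewrite ler0_norm; lra.
Qed.

Lemma parallel_not_transverse (a b : R * R) (c : R) :
  a.1 = c * a.2 -> b.1 = c * b.2 -> ~ transverse a b.
Proof.
move=> ta tb; rewrite /transverse ta tb => /negP; apply; apply/eqP.
by ring.
Qed.

Variables (E : plane -> plane) (D : set plane).
Hypothesis dE : diffeo E.

(** At a double point, the two tangent directions would both be that of the
    graph. *)
Lemma graph_not_double (phi : R^o -> R^o) (y0 : R) : differentiable phi y0 ->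
  (\forall z \near (phi y0, y0), D (E z) -> z.1 = phi z.2) ->
  ~ double_point D (E (phi y0, y0)).
Proof.
move=> dphi near_graph [m [g [u [v [gg DE nuv gu gv]]]]].
have [gs _ _ gt _] := gg.
have [Einv [dEinv EK KE]] := diffeo_inv dE.
have tangent (w : 'I_m * R) : g w.1 w.2 = E (phi y0, y0) ->
    (derive1 (fun t => Einv (g w.1 t)) w.2).1 =
    'D_1 phi y0 * (derive1 (fun t => Einv (g w.1 t)) w.2).2.
  rewrite derive1E => gw; have dg := differentiable_curve w.2 (gs w.1).
  have de := diffeo_differentiable (g w.1 w.2) dEinv.
  have dq := differentiable_comp dg de.
  apply: (tangent_of_near_graph dq dphi) => /=; first by rewrite gw EK.
  have cq : Einv (g w.1 t) @[t --> w.2] --> Einv (g w.1 w.2).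
    exact: differentiable_continuous dq.
  rewrite gw EK in cq.
  have n : \forall t \near w.2, D (E (Einv (g w.1 t))) ->
      (Einv (g w.1 t)).1 = phi (Einv (g w.1 t)).2 by exact: cq _ near_graph.
  apply: (@filterS _ (nbhs (w.2 : R^o)) _ _ _ _ n) => t; apply.
  by rewrite KE DE; exists w.1 => //; exists t.
have deriveq (w : 'I_m * R) : derive1 (fun t => Einv (g w.1 t)) w.2 =
    'd Einv (g w.1 w.2) (derive1 (g w.1) w.2) by exact: derive1_diffeo.
have := tangent u gu; have := tangent v gv.
set a := derive1 _ u.2; set b := derive1 _ v.2; set c := 'D_1 phi y0.
have : transverse a b.
  have guv : g u.1 u.2 = g v.1 v.2 by rewrite gu gv.
  rewrite /a /b !deriveq guv; apply: (transverse_diffeo _ dEinv).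
  exact: gt.
by move=> tab tb ta; exact: parallel_not_transverse ta tb tab.
Qed.

(** A single preimage would give the projection the same tangent direction along
    both graphs. *)
Lemma transverse_graphs_double (phi1 phi2 : R^o -> R^o) (x0 y0 : R) :
  link_projection D -> differentiable phi1 y0 -> differentiable phi2 y0 ->
  phi1 y0 = x0 -> phi2 y0 = x0 -> 'D_1 phi1 y0 != 'D_1 phi2 y0 ->
  (\forall y \near y0, D (E (phi1 y, y))) ->
  (\forall y \near y0, D (E (phi2 y, y))) ->
  double_point D (E (x0, y0)).
Proof.
move=> [m [g [gg DE]]] d1 d2 e1 e2 neq n1 n2; apply: contrapT => ndbl.
have [gs _ gi _ _] := gg.
have [Einv [dEinv EK KE]] := diffeo_inv dE.
have : D (E (x0, y0)) by rewrite -e1; exact: nbhs_singleton n1.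
rewrite DE => -[i0 _ [t0 _ gt0]].
have single (v : 'I_m * R) : g v.1 v.2 = g i0 t0 -> same_point (i0, t0) v.
  move=> gv; apply: contrapT => nsp; apply: ndbl.
  by exists m, g, (i0, t0), v; split => //; rewrite gv.
pose q t := Einv (g i0 t).
have dg := differentiable_curve t0 (gs i0).
have dq : differentiable (q : R^o -> R^o * R^o) t0.
  exact: differentiable_comp dg (diffeo_differentiable (g i0 t0) dEinv).
have tangent (phi : R^o -> R^o) : differentiable phi y0 -> phi y0 = x0 ->
    (\forall y \near y0, D (E (phi y, y))) ->
    ('D_1 q t0).1 = 'D_1 phi y0 * ('D_1 q t0).2.
  move=> dphi ephi nphi; apply: tangent_graph => //.
    by rewrite /q gt0 EK ephi.
  move=> e e0; have := near_preimage gg e0 single; rewrite gt0 => near_w.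
  have cphi : {for y0, continuous (fun y : R => E (phi y, y))}.
    apply: (@continuous_comp _ _ _ (fun y : R => (phi y, y)) E).
      apply: differentiable_continuous.
      exact: (differentiable_pair dphi (@ex_diff _ _ _ _ _ _ _ (is_diff_id y0))).
    exact: diffeo_continuous.
  have cphi' : E (phi y, y) @[y --> y0] --> E (phi y0, y0) by exact: cphi.
  rewrite ephi in cphi'; 
  have near_y : \forall y \near y0, image_of g (E (phi y, y)) ->
    exists2 t : R, `|t - t0| < e & g i0 t = E (phi y, y) by exact: cphi' _ near_w.
  have [d /= d0 Hd] : exists2 d : R, 0 < d & forall y : R, `|y - y0| < d ->
      D (E (phi y, y)) /\ (image_of g (E (phi y, y)) ->
        exists2 t : R, `|t - t0| < e & g i0 t = E (phi y, y)).
    have N : \forall y \near y0, D (E (phi y, y)) /\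
        (image_of g (E (phi y, y)) ->
         exists2 t : R, `|t - t0| < e & g i0 t = E (phi y, y)).
      exact: filterI nphi near_y.
    case/nbhs_ballP: N => d d0 Hd.
    exists d; first exact: d0.
    by move=> y yd; apply: Hd; rewrite -ball_normE /= distrC.
  exists d => // y /Hd[Dy]; rewrite DE in Dy => /(_ Dy)[t td gt].
  by exists t => //; rewrite /q gt EK.
have T1 := tangent _ d1 e1 n1; have T2 := tangent _ d2 e2 n2.
have : 'D_1 q t0 = 0.
  have a2 : ('D_1 q t0).2 = 0.
    apply/eqP; have : ('D_1 phi1 y0 - 'D_1 phi2 y0) * ('D_1 q t0).2 = 0.
      by rewrite mulrBl -T1 -T2 subrr.
    by move/eqP; rewrite mulf_eq0 subr_eq0 (negbTE neq).
  move: T1; rewrite a2 mulr0; move: a2; case: ('D_1 q t0) => a b /= -> -> //.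
have <- : derive1 q t0 = 'D_1 q t0 by exact: derive1E.
move=> H.
have := diffeo_diff_inj dEinv (etrans (esym (derive1_diffeo t0 dEinv (gs i0))) H).
by apply/eqP; exact: gi.
Qed.

End DoublePoints.

(** * The triangle of a Yang-Baxter word *)

Section Triangle.
Variable R : realType.
Local Notation plane := (R * R)%type.
Implicit Types (x y : R) (z : plane).

Definition yb_word : tw_word 3 := [:: ord0; ord_max; ord0].

(** The three arcs of [yb_word], as graphs over the vertical axis. *)
Definition arcP y : R := 1 + step (3 * y) + step (3 * y - 1).
Definition arcQ y : R := 2 - step (3 * y) + step (3 * y - 2).
Definition arcS y : R := 3 - step (3 * y - 1) - step (3 * y - 2).

Lemma yb_layer (a : nat) (t x : R) (i : 'I_3.-1) : (a < 3)%N -> 0 <= t <= 1 ->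
  i = (a == 1)%N :> nat ->
  config yb_word (x, (a%:R + t) / 3) <-> crossing i t x.
Proof.
move=> a3 t01 ia.
pose u := take a yb_word; pose v := drop a.+1 yb_word.
have wE : yb_word = u ++ i :: v.
  rewrite /u /v; move: a a3 ia {u v} => [|[|[|]]] //= _ ia; congr [:: _; _; _];
  by apply: val_inj; rewrite /= ia.
have su : size u = a by rewrite size_take a3.
by have := config_layer u i v x t01; rewrite -wE su.
Qed.

Lemma yb_arcs x y : config yb_word (x, y) <->
  0 <= y <= 1 /\ [\/ x = arcP y, x = arcQ y | x = arcS y].
Proof.
split=> [c|[y01 arcs]].
  have [y01 _] := config_sub_box c; have [_ /= y01'] := config_sub_box c.
  split=> // {y01}.
  have [a [t [a3 t01 yE]]] := @layers_cover R 3 y isT y01'.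
  have ai : ((a == 1)%N < 3.-1)%N by case: (a == 1%N).
  move: c; rewrite yE (@yb_layer _ _ _ (Ordinal ai)) // /arcP /arcQ /arcS.
  have -> : 3 * ((a%:R + t) / 3) = a%:R + t by field.
  case/andP: t01 => t0 t1.
  move: a a3 ai {yE} => [|[|[|]]] //= _ ai; rewrite /crossing /=.
  + rewrite add0r !(@step_low _ (t - _)); try lra.
    case=> [->|->|[j [j1 j2 ->]]].
    * by apply: Or31; ring.
    * by apply: Or32; ring.
    * have -> : nat_of_ord j = 2%N.
        by move: j1 j2; rewrite -!val_eqE /=; case: j => [[|[|[|]]]].
      by apply: Or33; ring.
  + rewrite (@step_high _ (1 + t)); last lra.
    rewrite [1 + t - 1]addrAC subrr add0r (@step_low _ (1 + t - 2)); last lra.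
    case=> [->|->|[j [j1 j2 ->]]].
    * by apply: Or31; ring.
    * by apply: Or33; ring.
    * have -> : nat_of_ord j = 0%N.
        by move: j1 j2; rewrite -!val_eqE /=; case: j => [[|[|[|]]]].
      by apply: Or32; ring.
  + rewrite (@step_high _ (2 + t)); last lra.
    rewrite (@step_high _ (2 + t - 1)); last lra.
    rewrite [2 + t - 2]addrAC subrr add0r.
    case=> [->|->|[j [j1 j2 ->]]].
    * by apply: Or32; ring.
    * by apply: Or33; ring.
    * have -> : nat_of_ord j = 2%N.
        by move: j1 j2; rewrite -!val_eqE /=; case: j => [[|[|[|]]]].
      by apply: Or31; ring.
have [a [t [a3 t01 yE]]] := @layers_cover R 3 y isT y01.
have ai : ((a == 1)%N < 3.-1)%N by case: (a == 1%N).
move: arcs; rewrite yE (@yb_layer _ _ _ (Ordinal ai)) // /arcP /arcQ /arcS.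
have -> : 3 * ((a%:R + t) / 3) = a%:R + t by field.
case/andP: t01 => t0 t1.
move: a a3 ai {yE} => [|[|[|]]] //= _ ai; rewrite /crossing /=.
+ rewrite add0r !(@step_low _ (t - _)); try lra.
  case=> ->.
  * by apply: Or31; ring.
  * by apply: Or32; ring.
  * by apply: Or33; exists ord_max; split=> //=; ring.
+ rewrite (@step_high _ (1 + t)); last lra.
  rewrite [1 + t - 1]addrAC subrr add0r (@step_low _ (1 + t - 2)); last lra.
  case=> ->.
  * by apply: Or31; ring.
  * by apply: Or33; exists ord0; split=> //=; ring.
  * by apply: Or32; ring.
+ rewrite (@step_high _ (2 + t)); last lra.
  rewrite (@step_high _ (2 + t - 1)); last lra.
  rewrite [2 + t - 2]addrAC subrr add0r.
  case=> ->.
  * by apply: Or33; exists ord_max; split=> //=; ring.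
  * by apply: Or31; ring.
  * by apply: Or32; ring.
Qed.

Lemma arcQ_lt_arcP y : 6^-1 < y -> arcQ y < arcP y.
Proof.
move=> y6; rewrite /arcQ /arcP.
have := @step_gt_half R (3 * y); have := @step_homo R (3 * y - 2) (3 * y - 1).
move=> H1 H2; have {H1} := H1 _; have {H2} := H2 _.
by move=> H1 H2; have := H1 ltac:(lra); have := H2 ltac:(lra); lra.
Qed.

Lemma arcQ_lt_arcS y : y < 5 / 6 -> arcQ y < arcS y.
Proof.
move=> y6; rewrite /arcQ /arcS.
have h1 : step (3 * y - 2) < 2^-1 by apply: step_lt_half; lra.
have h2 : step (3 * y - 1) <= step (3 * y) by apply: step_homo; lra.
by lra.
Qed.

Lemma arcP_lt_arcS y : y < 2^-1 -> arcP y < arcS y.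
Proof.
move=> y2; rewrite /arcP /arcS.
have h1 : step (3 * y - 1) < 2^-1 by apply: step_lt_half; lra.
have h2 : step (3 * y - 2) = 0 by apply: step_low; lra.
have h3 := step_le1 (3 * y).
by rewrite h2; lra.
Qed.

Lemma arcS_lt_arcP y : 2^-1 < y -> arcS y < arcP y.
Proof.
move=> y2; rewrite /arcP /arcS.
have h1 : 2^-1 < step (3 * y - 1) by apply: step_gt_half; lra.
have h2 : step (3 * y) = 1 by apply: step_high; lra.
have h3 := step_ge0 (3 * y - 2).
by rewrite h2; lra.
Qed.

Lemma arcPQ_bottom : arcP 6^-1 = 3 / 2 /\ arcQ 6^-1 = 3 / 2.
Proof.
rewrite /arcP /arcQ; have -> : 3 * 6^-1 = 2^-1 :> R by lra.
by rewrite step_half !step_low; lra.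
Qed.

Lemma arcPS_middle : arcP 2^-1 = 5 / 2 /\ arcS 2^-1 = 5 / 2.
Proof.
rewrite /arcP /arcS; have -> : 3 * 2^-1 - 1 = 2^-1 :> R by lra.
by rewrite step_half step_high ?step_low; lra.
Qed.

Lemma arcQS_top : arcQ (5 / 6) = 3 / 2 /\ arcS (5 / 6) = 3 / 2.
Proof.
rewrite /arcQ /arcS; have -> : 3 * (5 / 6) - 2 = 2^-1 :> R by lra.
by rewrite step_half !step_high; lra.
Qed.

Lemma arcQ_ge1 y : 1 <= arcQ y.
Proof.
by rewrite /arcQ; have := step_le1 (3 * y); have := step_ge0 (3 * y - 2); lra.
Qed.

Lemma arcP_le3 y : arcP y <= 3.
Proof.
by rewrite /arcP; have := step_le1 (3 * y); have := step_le1 (3 * y - 1); lra.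
Qed.

Lemma Ck_step_affine n (a b : R) :
  Ck n ((fun y => step (a * y + b)) : R^o -> R^o).
Proof. exact: Ck_comp1 (Ck_step R n) (Ck_affine n a b). Qed.

Lemma Ck_opp n (f : R^o -> R^o) : Ck n f -> Ck n ((fun y => - f y) : R^o -> R^o).
Proof.
move=> Cf; apply: (Ck_ext _ (Ck_M (Ck_cst _ n (-1 : R^o)) Cf)) => y.
by rewrite /cst mulN1r.
Qed.

Lemma Ck_arcP n : Ck n (arcP : R^o -> R^o).
Proof.
have := Ck_D (Ck_D (Ck_cst R^o n (1 : R^o)) (Ck_step_affine n 3 0))
  (Ck_step_affine n 3 (-1)).
by apply: Ck_ext => y; rewrite addr0.
Qed.

Lemma Ck_arcQ n : Ck n (arcQ : R^o -> R^o).
Proof.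
have := Ck_D (Ck_D (Ck_cst R^o n (2 : R^o)) (Ck_opp (Ck_step_affine n 3 0)))
  (Ck_step_affine n 3 (-2)).
by apply: Ck_ext => y; rewrite addr0.
Qed.

Lemma Ck_arcS n : Ck n (arcS : R^o -> R^o).
Proof.
exact: Ck_D (Ck_D (Ck_cst R^o n (3 : R^o)) (Ck_opp (Ck_step_affine n 3 (-1))))
  (Ck_opp (Ck_step_affine n 3 (-2))).
Qed.

Variables (E : plane -> plane) (D : set plane).
Hypotheses (dE : diffeo E) (lD : link_projection D) (DE : D = fill E yb_word D).

Lemma in_frame z : @box R 3 z -> D (E z) <-> config yb_word z.
Proof.
have [Einv [_ EK _]] := diffeo_inv dE.
move=> bz; split=> [|c]; rewrite DE; last by right; exists z.
by move=> [[_ []]|[z' cz' /(can_inj EK) <-]] //; exists z.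
Qed.

Lemma near_gt0 (F : R^o * R^o -> R^o) z : Ck 0 F -> 0 < F z ->
  \forall w \near z, 0 < F w.
Proof.
move=> CF F0.
have cF : F w @[w --> z] --> F z by exact: differentiable_continuous (Ck_diff z CF).
exact: (@cvgr_gt R _ _ _ F (F z) cF 0 F0).
Qed.

Lemma box3 z : 0 < z.1 - 2^-1 -> 0 < -1 * z.1 + (3 + 2^-1) -> 0 < z.2 ->
  0 < -1 * z.2 + 1 -> @box R 3 z.
Proof. by move=> *; split; apply/andP; split; lra. Qed.

(** Near a point of one arc that is on neither of the two others, the projection
    is the graph of that arc. *)
Lemma simple_point (f g h : R^o -> R^o) y : (forall n, Ck n f) -> (forall n, Ck n g) ->
  (forall n, Ck n h) ->
  (forall x y, config yb_word (x, y) -> [\/ x = f y, x = g y | x = h y]) ->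
  0 < y < 1 -> 1 <= f y <= 3 -> f y != g y -> f y != h y ->
  ~ double_point D (E (f y, y)).
Proof.
move=> Cf Cg Ch fgh /andP[y0 y1] /andP[f1 f3] fg fh.
apply: (@graph_not_double R E D dE f y); first exact: Ck_diff (Cf 0).
have C1 := Ck_fst (Ck_id (R^o * R^o)%type 0).
have C2 := Ck_snd (Ck_id (R^o * R^o)%type 0).
have Cc (a : R) := Ck_cst (R^o * R^o)%type 0 (a : R^o).
have Copp F (CF : Ck 0 (F : R^o * R^o -> R^o)) := Ck_M (Cc (-1)) CF.
have sq F (CF : Ck 0 (F : R^o * R^o -> R^o)) := Ck_M CF CF.
have n1 := @near_gt0 _ (f y, y) (Ck_D C1 (Cc (- 2^-1))).
have n2 := @near_gt0 _ (f y, y) (Ck_D (Copp _ C1) (Cc (3 + 2^-1))).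
have n3 := @near_gt0 _ (f y, y) C2.
have n4 := @near_gt0 _ (f y, y) (Ck_D (Copp _ C2) (Cc 1)).
have n5 := @near_gt0 _ (f y, y) (sq _ (Ck_D C1 (Copp _ (Ck_comp1 (Cg 0) C2)))).
have n6 := @near_gt0 _ (f y, y) (sq _ (Ck_D C1 (Copp _ (Ck_comp1 (Ch 0) C2)))).
rewrite /cst /= in n1 n2 n3 n4 n5 n6.
have sq_gt0 (a b : R) : a != b -> 0 < (a + -1 * b) * (a + -1 * b).
  by move=> ab; rewrite mulN1r -expr2 exprn_even_gt0 //= subr_eq0.
have m1 := n1 ltac:(lra); have m2 := n2 ltac:(lra); have m3 := n3 y0.
have m4 := n4 ltac:(lra); have m5 := n5 (sq_gt0 _ _ fg); have m6 := n6 (sq_gt0 _ _ fh).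
near=> w.
have w1 : 0 < w.1 - 2^-1 by near: w.
have w2 : 0 < -1 * w.1 + (3 + 2^-1) by near: w.
have w3 : 0 < w.2 by near: w.
have w4 : 0 < -1 * w.2 + 1 by near: w.
have w5 : 0 < (w.1 + -1 * g w.2) * (w.1 + -1 * g w.2) by near: w.
have w6 : 0 < (w.1 + -1 * h w.2) * (w.1 + -1 * h w.2) by near: w.
have bw : @box R 3 w.
  exact: box3 w1 w2 w3 w4.
move=> /(in_frame bw); rewrite [w in config _ w]surjective_pairing => /fgh[//|e|e].
  by move: w5; rewrite e mulN1r subrr mul0r ltxx.
by move: w6; rewrite e mulN1r subrr mul0r ltxx.
Unshelve. all: by end_near. Qed.

Lemma step_affine_derive (a : nat) :
  'D_1 ((fun y : R => step (3 * y + - a%:R)) : R^o -> R^o) ((a%:R + 2^-1) / 3) = 18.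
Proof.
have d1 : is_derive (((a%:R + 2^-1) / 3) : R) 1 (fun y : R => 3 * y + - a%:R) 3.
  by apply: is_derive_eq; rewrite ?(subr0, oppr0, addr0) scaler1.
have E0 : 3 * ((a%:R + 2^-1) / 3) + - a%:R = 2^-1 :> R by field.
have := @is_derive1_comp R (@step R) (fun y : R => 3 * y + - a%:R)
  ((a%:R + 2^-1) / 3) 6 3.
rewrite E0 => /(_ (step_derive_half R) d1) [_ ->].
by ring.
Qed.

Lemma crossing_point (a : nat) (i : 'I_3.-1) : (a < 3)%N -> i = (a == 1)%N :> nat ->
  double_point D (E (i.+1%:R + 2^-1, (a%:R + 2^-1) / 3)).
Proof.
move=> a3 ia; set y0 : R := (a%:R + 2^-1) / 3.
pose s y : R := step (3 * y + - a%:R).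
have s0 : s y0 = 2^-1 by rewrite -step_half /s; congr step; rewrite /y0; field.
have Cs n : Ck n (s : R^o -> R^o) by exact: Ck_step_affine.
have C1 n := Ck_D (Ck_cst R^o n (i.+1%:R : R^o)) (Cs n).
have C2 n := Ck_D (Ck_cst R^o n (i.+2%:R : R^o)) (Ck_opp (Cs n)).
have nearby : \forall y \near y0, 0 < 3 * y - a%:R < 1.
  have c3 : 3 * y - a%:R @[y --> y0] --> 3 * y0 - a%:R.
    by apply: cvgB; [apply: cvgMr|exact: cvg_cst].
  have E0 : 3 * y0 - a%:R = 2^-1 by rewrite /y0; field.
  rewrite E0 in c3; near=> y; apply/andP; split; near: y.
    by apply: (cvgr_gt _ c3); lra.
  by apply: (cvgr_lt _ c3); lra.
have yE y : y = (a%:R + (3 * y - a%:R)) / 3 by field.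
have inD y x : 0 < 3 * y - a%:R < 1 -> crossing i (3 * y - a%:R) x -> D (E (x, y)).
  move=> y01; have y01' : 0 <= 3 * y - a%:R <= 1 by lra.
  rewrite -(yb_layer x a3 y01' ia) -yE => c.
  by apply/in_frame => //; exact: config_sub_box c.
apply: (@transverse_graphs_double R E D dE (fun y => i.+1%:R + s y)
          (fun y => i.+2%:R + - s y) _ _ lD).
- exact: Ck_diff (C1 0).
- exact: Ck_diff (C2 0).
- by rewrite s0.
- by rewrite s0 -[i.+2%:R]natr1; lra.
- have ds := step_affine_derive a.
  have dfs : derivable (s : R^o -> R^o) y0 1.
    by apply: diff_derivable; exact: Ck_diff (Cs 0).
  have iS : is_derive (y0 : R^o) 1 (s : R^o -> R^o) 18 by split.
  have D1 : 'D_1 ((fun y : R => i.+1%:R + s y) : R^o -> R^o) y0 = 18.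
    have [_ H] := is_deriveD (is_derive_cst (i.+1%:R : R^o) (y0 : R^o) 1) iS.
    by rewrite -[RHS]add0r; exact: H.
  have D2 : 'D_1 ((fun y : R => i.+2%:R + - s y) : R^o -> R^o) y0 = - 18.
    have [_ H] := is_deriveB (is_derive_cst (i.+2%:R : R^o) (y0 : R^o) 1) iS.
    by rewrite -[RHS]add0r; exact: H.
  have n18 : (18 : R) != - 18 by rewrite gt_eqF //; lra.
  by rewrite D1 D2; exact: n18.
- near=> y; apply: inD; first by near: y.
  by apply: Or31.
- near=> y; apply: inD; first by near: y.
  by apply: Or32.
Unshelve. all: by end_near. Qed.

End Triangle.

Section TriangleMap.
Variable R : realType.
Local Notation plane := (R * R)%type.
Implicit Types (x y : R) (z : plane).
Local Notation arcP := (@arcP R).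
Local Notation arcQ := (@arcQ R).
Local Notation arcS := (@arcS R).

(** The triangle lies between the arc Q on its left and the arcs P, S on its
    right.  The simplex, seen as the triangle with vertices (0, 0), (0, 2) and
    (1, 1) in the coordinates [z.1] and [level z], has width [width z] at that
    level; it is stretched horizontally. *)
Definition level z : R := z.1 + 2 * z.2.
Definition height z : R := 6^-1 + level z / 3.
Definition width z : R := Num.min (level z) (2 - level z).
Definition gap_QPS y : R := Num.min (arcP y) (arcS y) - arcQ y.
Definition tri_map z : plane :=
  (arcQ (height z) + z.1 / width z * gap_QPS (height z), height z).

Lemma simplex_width z : simplex z -> 0 <= z.1 <= width z.
Proof. by move=> [z1 z2 z12]; rewrite z1 le_min /level; apply/andP; split; lra. Qed.

Lemma simplex_height z : simplex z -> 6^-1 <= height z <= 5 / 6.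
Proof. by move=> [z1 z2 z12]; rewrite /height /level; apply/andP; split; lra. Qed.

Lemma width_gt0 z : 0 < width z -> 6^-1 < height z < 5 / 6.
Proof.
by rewrite lt_min /height => /andP[? ?]; apply/andP; split; lra.
Qed.

Lemma gap_gt0 y : 6^-1 < y < 5 / 6 -> 0 < gap_QPS y.
Proof.
by case/andP=> y1 y2; rewrite subr_gt0 lt_min arcQ_lt_arcP ?arcQ_lt_arcS.
Qed.

Lemma gap_bottom : gap_QPS 6^-1 = 0.
Proof.
rewrite /gap_QPS; have [-> ->] := arcPQ_bottom R; rewrite min_l ?subrr //.
have [<- _] := arcPQ_bottom R; apply/ltW/arcP_lt_arcS.
by lra.
Qed.

Lemma gap_top : gap_QPS (5 / 6) = 0.
Proof.
rewrite /gap_QPS; have [-> ->] := arcQS_top R; rewrite min_r ?subrr //.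
have [_ <-] := arcQS_top R; apply/ltW/arcS_lt_arcP.
by lra.
Qed.

Lemma width0_gap z : simplex z -> width z = 0 -> z.1 = 0 /\ gap_QPS (height z) = 0.
Proof.
move=> sz w0; have := simplex_width sz; rewrite w0 => z10.
split; first by apply/eqP; rewrite eq_le; move: z10; rewrite andbC.
move: w0; rewrite /width /height; case: leP => _ E; rewrite ?E.
  by rewrite mul0r addr0 gap_bottom.
have -> : level z = 2 by lra.
have -> : 6^-1 + 2 / 3 = 5 / 6 :> R by lra.
exact: gap_top.
Qed.

Lemma gap_ge0 z : simplex z -> 0 <= gap_QPS (height z).
Proof.
move=> sz; have := simplex_width sz; have [/width_gt0/gap_gt0/ltW //|] := ltP 0 (width z).
move=> w0 zw; have w00 : width z = 0 by lra.
by have [_ ->] := width0_gap sz w00.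
Qed.

Lemma tri_map_left z : z.1 = 0 -> (tri_map z).1 = arcQ (height z).
Proof. by move=> z0; rewrite /= z0 !mul0r addr0. Qed.

Lemma tri_map_right z : 0 < z.1 -> z.1 = width z ->
  (tri_map z).1 = Num.min (arcP (height z)) (arcS (height z)).
Proof.
by move=> z0 zw; rewrite /= -zw divff ?mul1r ?gt_eqF // /gap_QPS addrC subrK.
Qed.

Lemma tri_map_inj : set_inj (@simplex R) tri_map.
Proof.
move=> z z' /[!inE] sz sz' [E1 E2].
have Lz : level z = level z' by move: E2; rewrite /height; lra.
have wz : width z = width z' by rewrite /width Lz.
have z1 : z.1 = z'.1.
  have := simplex_width sz; have [w0|w0 zw] := ltP 0 (width z).
    move=> _; move: E1; rewrite E2 -wz => /addrI/mulIf H.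
    have /H/mulIf : gap_QPS (height z') != 0.
      by rewrite gt_eqF // gap_gt0 // width_gt0 // -wz.
    by apply; rewrite invr_eq0 gt_eqF.
  have w00 : width z = 0 by lra.
  have [-> _] := width0_gap sz w00.
  by have [|-> _] := width0_gap sz'; rewrite -?wz.
have z2 : z.2 = z'.2 by move: Lz; rewrite /level z1; lra.
by move: z1 z2; case: (z) (z') => a b [a' b'] /= -> ->.
Qed.

Lemma continuous_tri_map : {within @simplex R, continuous tri_map}.
Proof.
have cP : continuous arcP.
  by move=> y; exact: differentiable_continuous (Ck_diff (y : R^o) (Ck_arcP R 0)).
have cQ : continuous arcQ.
  by move=> y; exact: differentiable_continuous (Ck_diff (y : R^o) (Ck_arcQ R 0)).
have cS : continuous arcS.
  by move=> y; exact: differentiable_continuous (Ck_diff (y : R^o) (Ck_arcS R 0)).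
have cL : continuous level.
  move=> z; have C := Ck_id (R^o * R^o)%type 0.
  exact: differentiable_continuous (Ck_diff z
    (Ck_D (Ck_fst C) (Ck_M (Ck_cst _ 0 (2 : R^o)) (Ck_snd C)))).
have cH : continuous height.
  by move=> z; apply: cvgD; [exact: cvg_cst|apply: cvgMl; exact: cL].
have cW : continuous width.
  move=> z; apply: continuous_min; first exact: cL.
  by apply: cvgB; [exact: cvg_cst|exact: cL].
have cG : continuous gap_QPS.
  move=> y; apply: cvgB; last exact: cQ.
  by apply: continuous_min; [exact: cP|exact: cS].
have cGH z : gap_QPS (height w) @[w --> z] --> gap_QPS (height z).
  by apply: continuous_comp; [exact: cH|exact: cG].
have cQH z : arcQ (height w) @[w --> z] --> arcQ (height z).
  by apply: continuous_comp; [exact: cH|exact: cQ].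
apply/subspace_continuousP => z sz.
have wc (f : plane -> R) : {for z, continuous f} ->
    f w @[w --> within (@simplex R) (nbhs z)] --> f z.
  by move=> cf; apply: cvg_trans cf; apply: cvg_app; exact: cvg_within.
pose x_of w := arcQ (height w) + w.1 / width w * gap_QPS (height w).
suff cx : x_of w @[w --> within (@simplex R) (nbhs z)] --> x_of z.
  exact: cvg_pair cx (wc height (@cH z)).
apply: cvgD; first by apply: wc; exact: cQH.
have := simplex_width sz; have [w0 _|w0 zw] := ltP 0 (width z).
  apply: (wc (fun w => w.1 / width w * gap_QPS (height w))).
  apply: cvgM; last exact: cGH.
  apply: cvgM; first exact: cvg_fst.
  by apply: cvgV; [rewrite gt_eqF | exact: cW].
have w00 : width z = 0 by lra.
have [z10 g0] := width0_gap sz w00.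
rewrite z10 !mul0r.
apply: (@squeeze_cvgr _ _ _ _ (cst 0) (gap_QPS \o height)); last 2 first.
- exact: cvg_cst.
- by rewrite -[X in _ --> X]g0; apply: (wc (gap_QPS \o height)); exact: cGH.
have /= : within (@simplex R) (nbhs z) (@simplex R) by exact: withinT.
apply: filterS => w sw; have gw := gap_ge0 sw; have /andP[w1 ww] := simplex_width sw.
have [W0|W0] := ltP 0 (width w).
  rewrite mulr_ge0 ?divr_ge0 //= ?(ltW W0) // ler_piMl // ler_pdivrMr // mul1r //.
have W00 : width w = 0 by lra.
by rewrite W00 invr0 mulr0 mul0r lexx.
Qed.

Lemma tri_map_box z : simplex z -> @box R 3 (tri_map z).
Proof.
move=> sz; have /andP[h1 h2] := simplex_height sz.
have Q1 := arcQ_ge1 (height z); have P3 := arcP_le3 (height z).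
have := gap_ge0 sz; have /andP[z0 zw] := simplex_width sz => g0.
have r01 : 0 <= z.1 / width z <= 1.
  have [w0|w0] := ltP 0 (width z).
    by rewrite divr_ge0 ?(ltW w0) //= ler_pdivrMr // mul1r.
  have -> : width z = 0 by lra.
  by rewrite invr0 mulr0 lexx ler01.
have g1 : z.1 / width z * gap_QPS (height z) <= gap_QPS (height z).
  by case/andP: r01 => _ ?; rewrite ler_piMl.
have g2 : 0 <= z.1 / width z * gap_QPS (height z).
  by case/andP: r01 => ? _; rewrite mulr_ge0.
have g3 : gap_QPS (height z) <= arcP (height z) - arcQ (height z).
  by rewrite lerD2r ge_min lexx.
by rewrite /box /tri_map /=; split; apply/andP; split; lra.
Qed.

Lemma simplex_boundary z : (@simplex R `\` @simplex_interior R) z ->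
  [\/ z.1 = 0, z.2 = 0 | z.1 + z.2 = 1].
Proof.
move=> [[z1 z2 z12] ni].
have [z10|z10] := eqVneq z.1 0; first exact: Or31.
have [z20|z20] := eqVneq z.2 0; first exact: Or32.
apply: Or33; apply/eqP; rewrite eq_le z12 /= leNgt; apply/negP => lt1.
by apply: ni; split => //; rewrite lt_def ?z10 ?z20.
Qed.

Variables (E : plane -> plane) (D : set plane).
Hypotheses (dE : diffeo E) (lD : link_projection D) (DE : D = fill E yb_word D).

Lemma arcQ_simple y : 6^-1 < y < 5 / 6 -> ~ double_point D (E (arcQ y, y)).
Proof.
move=> /andP[y1 y2].
have QP := arcQ_lt_arcP y1; have QS := arcQ_lt_arcS y2.
apply: (@simple_point R E D dE DE arcQ arcP arcS) => //; try exact: Ck_arcQ;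
  try exact: Ck_arcP; try exact: Ck_arcS.
- by move=> x' y' /yb_arcs[_ [] ->]; [exact: Or32|exact: Or31|exact: Or33].
- by apply/andP; split; lra.
- have := arcQ_ge1 y; have := arcP_le3 y; lra.
- by rewrite lt_eqF.
- by rewrite lt_eqF.
Qed.

Lemma arcP_simple y : 6^-1 < y < 2^-1 -> ~ double_point D (E (arcP y, y)).
Proof.
move=> /andP[y1 y2].
have QP := arcQ_lt_arcP y1; have PS := arcP_lt_arcS y2.
apply: (@simple_point R E D dE DE arcP arcQ arcS) => //; try exact: Ck_arcQ;
  try exact: Ck_arcP; try exact: Ck_arcS.
- by move=> x' y' /yb_arcs[_ [] ->]; [exact: Or31|exact: Or32|exact: Or33].
- by apply/andP; split; lra.
- have := arcQ_ge1 y; have := arcP_le3 y; lra.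
- by rewrite gt_eqF.
- by rewrite lt_eqF.
Qed.

Lemma arcS_simple y : 2^-1 < y < 5 / 6 -> ~ double_point D (E (arcS y, y)).
Proof.
move=> /andP[y1 y2].
have QS := arcQ_lt_arcS y2; have SP := arcS_lt_arcP y1.
apply: (@simple_point R E D dE DE arcS arcQ arcP) => //; try exact: Ck_arcQ;
  try exact: Ck_arcP; try exact: Ck_arcS.
- by move=> x' y' /yb_arcs[_ [] ->]; [exact: Or33|exact: Or32|exact: Or31].
- by apply/andP; split; lra.
- have := arcQ_ge1 y; have := arcP_le3 y; lra.
- by rewrite gt_eqF.
- by rewrite lt_eqF.
Qed.

(** On the boundary of the simplex, the left side goes to the arc Q, the lower side
    to the arc P and the upper side to the arc S; the vertices go to the three
    crossings. *)
Lemma exists_triangle : exists Delta : set plane,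
  triangle D Delta /\ Delta `<=` E @` @box R 3.
Proof.
have [Einv [_ EK _]] := diffeo_inv dE.
have cE := diffeo_continuous dE.
have right_end z : simplex z -> 0 < z.1 -> z.2 = 0 \/ z.1 + z.2 = 1 ->
    z.1 = width z.
  move=> [_ z2 z12] z1 H; apply/esym; rewrite /width /level.
  by case: H => ?; [rewrite min_l | rewrite min_r]; lra.
exists ((E \o tri_map) @` @simplex R); split; last first.
  by move=> _ [z sz <-]; exists (tri_map z) => //; exact: tri_map_box.
exists (E \o tri_map); split; split => //.
- apply/subspace_continuousP => z sz.
  have /subspace_continuousP/(_ z sz) ct := continuous_tri_map.
  have ce : E w @[w --> tri_map z] --> E (tri_map z) by exact: cE.
  exact: (cvg_comp _ _ ct ce).
- by move=> z z' sz sz' /(can_inj EK); exact: tri_map_inj.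
- move=> z [z1 z2 z12]; have sz : simplex z by split; lra.
  move=> /(in_frame dE DE (tri_map_box sz)).
  have w0 : z.1 < width z by rewrite lt_min /level; apply/andP; split; lra.
  have w00 : 0 < width z by lra.
  have g0 := gap_gt0 (width_gt0 w00).
  have r0 : 0 < z.1 / width z by rewrite divr_gt0.
  have r1 : z.1 / width z < 1 by rewrite ltr_pdivrMr // mul1r.
  have gr0 : 0 < z.1 / width z * gap_QPS (height z) by rewrite mulr_gt0.
  have gr1 : z.1 / width z * gap_QPS (height z) < gap_QPS (height z).
    by rewrite -[ltRHS]mul1r ltr_pM2r.
  have gP : gap_QPS (height z) <= arcP (height z) - arcQ (height z).
    by rewrite lerD2r ge_min lexx.
  have gS : gap_QPS (height z) <= arcS (height z) - arcQ (height z).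
    by rewrite lerD2r ge_min lexx orbT.
  by rewrite /tri_map => /yb_arcs[_ [] ?]; lra.
- move=> z bz; have [sz _] := bz; have sb := simplex_boundary bz.
  apply/(in_frame dE DE (tri_map_box sz)); rewrite [tri_map z]surjective_pairing.
  have /andP[h1 h2] := simplex_height sz.
  apply/yb_arcs; split; first by rewrite /=; apply/andP; split; lra.
  have [z1 _ _] := sz; move: z1; rewrite le_eqVlt => /orP[/eqP z10|z1].
    by apply: Or32; rewrite tri_map_left.
  have zw : z.1 = width z.
    by apply: right_end => //; case: sb => ?; [lra|left|right].
  rewrite (tri_map_right z1 zw); case: leP => _; [exact: Or31|exact: Or33].
- move=> z bz; have [sz _] := bz; have sb := simplex_boundary bz.
  have [z1 z2 z12] := sz.
  split; last first.
    have pt (a b : R) : tri_map z = (a, b) -> double_point D (E (a, b)) ->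
        double_point D ((E \o tri_map) z) by rewrite /= => ->.
    have x0 : (0%N).+1%:R + 2^-1 = 3 / 2 :> R by lra.
    have x1 : (1%N).+1%:R + 2^-1 = 5 / 2 :> R by lra.
    have y0 : (0%:R + 2^-1) / 3 = 6^-1 :> R by lra.
    have y1 : (1%:R + 2^-1) / 3 = 2^-1 :> R by lra.
    have y2 : (2%:R + 2^-1) / 3 = 5 / 6 :> R by lra.
    have h00 : height (0, 0) = 6^-1 by rewrite /height /level /=; lra.
    have h10 : height (1, 0) = 2^-1 by rewrite /height /level /=; lra.
    have h01 : height (0, 1) = 5 / 6 by rewrite /height /level /=; lra.
    have w10 : (1 : R) = width (1, 0) by rewrite /width /level /= min_l; lra.
    have D0 := crossing_point dE lD DE (a := 0) (i := ord0) isT erefl.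
    have D1 := crossing_point dE lD DE (a := 1) (i := ord_max) isT erefl.
    have D2 := crossing_point dE lD DE (a := 2) (i := ord0) isT erefl.
    rewrite /= x0 y0 in D0; rewrite /= x1 y1 in D1; rewrite /= x0 y2 in D2.
    move=> [[|]|] zE.
    + apply: pt D0; rewrite zE [tri_map _]surjective_pairing tri_map_left //=.
      by rewrite h00; have [_ ->] := arcPQ_bottom R.
    + apply: pt D1; rewrite zE [tri_map _]surjective_pairing tri_map_right //=.
      by rewrite h10; have [-> ->] := arcPS_middle R; rewrite minxx.
    + apply: pt D2; rewrite zE [tri_map _]surjective_pairing tri_map_left //=.
      by rewrite h01; have [-> _] := arcQS_top R.
  move=> dbl; apply: contrapT => nv.
  have n00 : ~ (z.1 = 0 /\ z.2 = 0).
    move=> [a b]; apply: nv; left; left.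
    by case: (z) a b => ? ? /= -> ->.
  have n10 : ~ (z.1 = 1 /\ z.2 = 0).
    move=> [a b]; apply: nv; left; right.
    by case: (z) a b => ? ? /= -> ->.
  have n01 : ~ (z.1 = 0 /\ z.2 = 1).
    move=> [a b]; apply: nv; right.
    by case: (z) a b => ? ? /= -> ->.
  move: dbl; rewrite /= [tri_map z]surjective_pairing.
  move: z1; rewrite le_eqVlt => /orP[/eqP z10|z1].
    have z10' := esym z10.
    rewrite tri_map_left //; apply: arcQ_simple; rewrite /height /level -z10.
    have z20 : 0 < z.2.
      by rewrite lt_def z2 andbT; apply/eqP => z20; apply: n00.
    have z21 : z.2 < 1.
      rewrite lt_neqAle; apply/andP; split; last by lra.
      by apply/eqP => z21; apply: n01.
    by apply/andP; split; lra.
  have zb : z.2 = 0 \/ z.1 + z.2 = 1 by case: sb => ?; [lra|left|right].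
  rewrite (tri_map_right z1 (right_end z sz z1 zb)).
  have [z20|z20] := eqVneq z.2 0.
    have z11 : z.1 < 1.
      rewrite lt_neqAle; apply/andP; split; last by lra.
      by apply/eqP => z11; apply: n10.
    have hz : 6^-1 < height z < 2^-1.
      by rewrite /height /level z20; apply/andP; split; lra.
    rewrite min_l; first exact: arcP_simple.
    by apply/ltW/arcP_lt_arcS; case/andP: hz.
  have z20' : 0 < z.2 by rewrite lt_def z20.
  have zs : z.1 + z.2 = 1 by case: zb => // ?; lra.
  have hz : 2^-1 < height z < 5 / 6.
    by rewrite /height /level; apply/andP; split; lra.
  rewrite min_r; first exact: arcS_simple.
  by apply/ltW/arcS_lt_arcP; case/andP: hz.
Qed.

End TriangleMap.

(** * Functions killed by powers of an ideal of a group ring *)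

Section Augmentation.
Variables (G : groupType) (A : zmodType) (P : set (G * G)).
Implicit Types (F : G -> A) (x y u p : G) (H : set G).

(** Extended by linearity to the group ring, [F] vanishes on the [N]-th power of
    the ideal generated by the differences [a - b], for [(a, b)] in [P]. *)
Fixpoint kills (N : nat) F : Prop :=
  if N is N'.+1 then
    forall u ab, P ab ->
      kills N' (fun x => F (u * ab.1 * x)%g - F (u * ab.2 * x)%g)
  else forall x, F x = 0.

(** Dual form of the membership of [p - 1] in the [n]-th power of this ideal. *)
Definition unipotent (n : nat) p : Prop :=
  forall N F, kills N F -> kills (N - n) (fun x => F (p * x)%g - F x).

Lemma eq_kills N F F' : F =1 F' -> kills N F -> kills N F'.
Proof. by move=> /funext ->. Qed.

Lemma kills_sub N F F' : kills N F -> kills N F' -> kills N (fun x => F x - F' x).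
Proof.
elim: N F F' => [|N IH] F F' /= KF KF'; first by move=> x; rewrite KF KF' subr0.
move=> u ab Pab; apply: (eq_kills _ (IH _ _ (KF u ab Pab) (KF' u ab Pab))) => x.
by rewrite !opprD !opprK !addrA; congr (_ + _); exact: addrAC.
Qed.

Lemma kills0 N : kills N (fun=> 0).
Proof.
elim: N => [|N IH] //= u ab _; apply: eq_kills IH => x.
by rewrite subr0.
Qed.

Lemma kills_opp N F : kills N F -> kills N (fun x => - F x).
Proof.
by move=> KF; apply: (eq_kills _ (kills_sub (kills0 N) KF)) => x; rewrite sub0r.
Qed.

Lemma kills_add N F F' : kills N F -> kills N F' -> kills N (fun x => F x + F' x).
Proof.
move=> KF KF'; apply: (eq_kills _ (kills_sub KF (kills_opp KF'))) => x.
by rewrite opprK.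
Qed.

Lemma kills_transl N F y : kills N F -> kills N (fun x => F (y * x)%g).
Proof.
case: N => [|N] /= KF; first by move=> x.
move=> u ab Pab; apply: eq_kills (KF (y * u)%g ab Pab) => x.
by rewrite !mulgA.
Qed.

Lemma unipotent1 n : unipotent n 1%g.
Proof.
by move=> N F _; apply: (eq_kills _ (kills0 _)) => x; rewrite mul1g subrr.
Qed.

Lemma unipotentM n x y : unipotent n x -> unipotent n y -> unipotent n (x * y)%g.
Proof.
move=> ux uy N F KF.
have := kills_add (kills_transl y (ux N F KF)) (uy N F KF).
by apply: eq_kills => z; rewrite addrA subrK mulgA.
Qed.

Lemma unipotentV n x : unipotent n x -> unipotent n x^-1%g.
Proof.
move=> ux N F KF; apply: eq_kills (kills_opp (kills_transl x^-1%g (ux N F KF))) => z.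
by rewrite mulgA mulgV mul1g opprB.
Qed.

Lemma unipotent_generated n (S : set G) :
  (forall x, S x -> unipotent n x) -> forall x, Defs.generated S x -> unipotent n x.
Proof.
move=> HS x; apply; split=> //; split.
- exact: unipotent1.
- exact: unipotentM.
- exact: unipotentV.
Qed.

(** In the group ring,
    [xyx^-1y^-1 - 1 = ((x - 1)(y - 1) - (y - 1)(x - 1))x^-1y^-1]. *)
Lemma unipotent_commutator m n x y : unipotent m x -> unipotent n y ->
  unipotent (m + n) (x * y * x^-1 * y^-1)%g.
Proof.
move=> ux uy N F KF.
have K1 := uy _ _ (ux _ _ KF); have K2 := ux _ _ (uy _ _ KF).
rewrite -subnDA in K1; rewrite -subnDA addnC in K2.
apply: (eq_kills _ (kills_transl (x^-1 * y^-1)%g (kills_sub K1 K2))) => z.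
have E1 : (y * (x * (x^-1 * y^-1 * z)) = z)%g by rewrite !mulgA mulgK mulgV mul1g.
have E2 : (x * (y * (x^-1 * y^-1 * z)) = x * y * x^-1 * y^-1 * z)%g.
  by rewrite !mulgA.
rewrite E1 E2.
have alg (a b c d e : A) : a - b - (c - d) - (e - c - (b - d)) = a - e.
  have -> : a - b - (c - d) = a - (b + (c - d)) by rewrite [in RHS]opprD addrA.
  have -> : e - c - (b - d) = e - (b + (c - d)) by rewrite (addrCA b) [in RHS]opprD addrA.
  by rewrite opprB addrA subrK.
exact: alg.
Qed.

(** By induction, the generators of each term being commutators with the previous
    one. *)
Lemma lcs_unipotent H n : (0 < n)%N -> (forall x, H x -> unipotent 1 x) ->
  forall p, lcs H n p -> unipotent n p.
Proof.
case: n => // n _ HU; rewrite /lcs /=.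
elim: n => [|n IH] //= p; apply: unipotent_generated => _ [x Hx [y Ky <-]].
exact: (unipotent_commutator (HU x Hx) (IH y Ky)).
Qed.

Lemma kills_unipotent N n F p x : (N <= n)%N -> kills N F -> unipotent n p ->
  F (p * x)%g = F x.
Proof.
move=> Nn KF up; have := up N F KF; have /eqP -> : (N - n == 0)%N by [].
by move=> /(_ x)/eqP; rewrite subr_eq0 => /eqP.
Qed.

Lemma unipotent_relator u v ab : P ab -> (u * ab.2 * v)%g = 1%g ->
  unipotent 1 (u * ab.1 * v)%g.
Proof.
move=> Pab uv1 [|N] F KF.
  by move=> x; rewrite KF KF subr0.
rewrite subn1 /=; apply: eq_kills (kills_transl v (KF u ab Pab)) => x.
by rewrite !mulgA uv1 mul1g.
Qed.

End Augmentation.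

(** * Frames around Yang-Baxter subwords *)

Section Frames.
Variables (R : realType) (k : nat).
Local Notation plane := (R * R)%type.
Implicit Types (i j : 'I_k.-1) (x t : R) (z : plane).

Definition yb_word' : tw_word 3 := [:: ord_max; ord0; ord_max].

Lemma config_nth m (w : tw_word m) (j0 : 'I_m.-1) (l : nat) t x :
  (l < size w)%N -> 0 <= t <= 1 ->
  config w (x, (l%:R + t) / (size w)%:R) <-> crossing (nth j0 w l) t x.
Proof.
move=> lw t01; have := config_layer (take l w) (nth j0 w l) (drop l.+1 w) x t01.
by rewrite -drop_nth // cat_take_drop size_take lw.
Qed.

Definition flip z : plane := (-1 * z.1 + 4, 1 * z.2 + 0).

Lemma diffeo_flip : diffeo flip.
Proof. by apply: diffeo_affine; rewrite ?oppr_eq0 oner_neq0. Qed.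

Lemma box_flip z : @box R 3 z -> @box R 3 (flip z).
Proof.
by move=> [/andP[? ?] /andP[? ?]]; split; apply/andP; split; rewrite /flip /=; lra.
Qed.

Lemma flipK z : flip (flip z) = z.
Proof. by case: z => x y; congr pair => /=; ring. Qed.

Lemma crossing_flip (j j' : 'I_3.-1) t x : (j + j' = 1)%N ->
  crossing j t x -> crossing j' t (4 - x).
Proof.
move=> jj; have jr : (j%:R + j'%:R = 1 :> R) by rewrite -natrD jj.
rewrite /crossing /= -!natr1 => -[->|->|[l [l1 l2 ->]]].
- by apply: Or32; lra.
- by apply: Or31; lra.
rewrite /= in jj; apply: Or33; exists (rev_ord l); split.
- move: l2; rewrite -!val_eqE /= => /eqP l2; apply/eqP; have := ltn_ord l; lia.
- move: l1; rewrite -!val_eqE /= => /eqP l1; apply/eqP; have := ltn_ord l; lia.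
have -> : (rev_ord l).+1 = (3 - l)%N by rewrite /= subnSK.
by rewrite natrB ?(ltnW (ltn_ord l)) // -natr1; lra.
Qed.

Lemma config_flip (w w' : tw_word 3) z : size w = size w' -> w != [::] ->
  (forall l, (l < size w)%N -> nth ord0 w l + nth ord0 w' l = 1)%N ->
  @box R 3 z -> config w z <-> config w' (flip z).
Proof.
move=> ss w0 H [_ y01]; have n0 : (0 < size w)%N by rewrite lt0n size_eq0.
have [l [t [lw t01]]] := layers_cover n0 y01.
case: z y01 => x y /= _ yE; rewrite /flip /= mul1r addr0 mulN1r [- x + 4]addrC yE.
rewrite (config_nth (ord0 : 'I_3.-1) _ lw t01).
rewrite ss (config_nth (ord0 : 'I_3.-1)) -?ss //.
split; first exact: crossing_flip (H l lw).
move=> c; have -> : x = 4 - (4 - x) by ring.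
by apply: crossing_flip c; rewrite addnC; exact: H.
Qed.

Definition adjacent i j : Prop := j = i.+1 :> nat \/ i = j.+1 :> nat.

(** The disc on which the letters [i, j, i] starting at layer [o] look like
    [yb_word]; a reflection is needed when [j < i]. *)
Definition frame i j (o L : nat) : plane -> plane :=
  if (j == i.+1 :> nat) then place i o 3 L else place j o 3 L \o flip.

Lemma diffeo_frame i j o L : (0 < L)%N -> diffeo (@frame i j o L).
Proof.
move=> L0; rewrite /frame; case: ifP => _; first exact: diffeo_place.
by apply: diffeo_comp; [exact: diffeo_place | exact: diffeo_flip].
Qed.

Lemma adjacent_bound i j : adjacent i j -> (minn i j + 3 <= k)%N.
Proof. by rewrite /adjacent; case: i j => i ? [j ?] /=; lia. Qed.

Lemma frame_box i j o L z : (0 < L)%N -> (o + 3 <= L)%N -> adjacent i j ->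
  @box R 3 z -> @box R k (frame i j o L z).
Proof.
move=> L0 oL adj bz; have bd := adjacent_bound adj; rewrite /frame.
case: eqP => [ji|ji].
  have ik : (i + 3 <= k)%N by move: bd; rewrite ji; lia.
  exact: (place_box L0 oL ik bz).
have jk : (j + 3 <= k)%N by move: bd; case: adj => // ->; lia.
exact: (place_box L0 oL jk (box_flip bz)).
Qed.

Lemma frame_config i j (pre post : tw_word k) z : adjacent i j -> @box R 3 z ->
  let W := pre ++ [:: i; j; i] ++ post in
  config yb_word z <-> config W (frame i j (size pre) (size W) z).
Proof.
move=> adj bz W; have bd := adjacent_bound adj; rewrite /frame.
case: eqP => [ji|ji].
  apply: (@config_block _ 3 k i yb_word pre [:: i; j; i] post) => //=.
    by rewrite ji addn0 addn1.
  by move: bd; rewrite ji; lia.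
have ij : i = j.+1 :> nat by case: adj.
rewrite (@config_flip yb_word yb_word') //; last by case=> [|[|[|]]].
apply: (@config_block _ 3 k j yb_word' pre [:: i; j; i] post) => //=.
- by rewrite ij addn0 addn1.
- by move: bd; rewrite ij; lia.
- exact: box_flip.
Qed.

Lemma frame_config' i j (pre post : tw_word k) z : adjacent i j -> @box R 3 z ->
  let W := pre ++ [:: j; i; j] ++ post in
  config yb_word' z <-> config W (frame i j (size pre) (size W) z).
Proof.
move=> adj bz W; have bd := adjacent_bound adj; rewrite /frame.
case: eqP => [ji|ji].
  apply: (@config_block _ 3 k i yb_word' pre [:: j; i; j] post) => //=.
    by rewrite ji addn0 addn1.
  by move: bd; rewrite ji; lia.
have ij : i = j.+1 :> nat by case: adj.
rewrite (@config_flip yb_word' yb_word) //; last by case=> [|[|[|]]].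
apply: (@config_block _ 3 k j yb_word pre [:: j; i; j] post) => //=.
- by rewrite ij addn0 addn1.
- by move: bd; rewrite ij; lia.
- exact: box_flip.
Qed.

Lemma place_image c o L (y : plane) : (0 < L)%N ->
  (place c o 3 L @` @box R 3) y <->
  c%:R + 2^-1 <= y.1 <= c%:R + (3 + 2^-1) /\ o%:R / L%:R <= y.2 <= (o + 3)%:R / L%:R.
Proof.
move=> L0; have Lr : 0 < L%:R :> R by rewrite ltr0n.
have -> : (o + 3)%:R / L%:R = o%:R / L%:R + 3 / L%:R :> R by rewrite natrD mulrDl.
have q0 : 0 < 3 / L%:R :> R by rewrite divr_gt0.
set q : R := 3 / L%:R in q0 *; set p : R := o%:R / L%:R.
rewrite /place -/p -/q; split=> [[z [/andP[x1 x2] /andP[y1 y2]] <-] /=|].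
  have h1 : 0 <= q * z.2 by rewrite mulr_ge0 // ltW.
  have h2 : q * z.2 <= q by rewrite ler_piMr // ltW.
  by split; apply/andP; split; lra.
move=> [/andP[x1 x2] /andP[y1 y2]].
exists (y.1 - c%:R, (y.2 - p) / q).
  split; apply/andP; split => /=; try lra.
    by rewrite divr_ge0 ?(ltW q0) // subr_ge0.
  by rewrite ler_pdivrMr // mul1r; lra.
have q1 : q != 0 by rewrite gt_eqF.
case: y {x1 x2 y1 y2} => a b /=; congr pair; first by ring.
by field.
Qed.

Lemma frame_image i j o L (y : plane) : (0 < L)%N -> adjacent i j ->
  (frame i j o L @` @box R 3) y <->
  (minn i j)%:R + 2^-1 <= y.1 <= (minn i j)%:R + (3 + 2^-1) /\
  o%:R / L%:R <= y.2 <= (o + 3)%:R / L%:R.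
Proof.
move=> L0 adj; rewrite /frame; case: eqP => [ji|ji].
  have -> : minn i j = i by lia.
  by apply: place_image.
have -> : minn i j = j by case: adj => ?; lia.
rewrite -place_image //; split=> [[z bz <-]|[z bz <-]].
  by exists (flip z) => //; exact: box_flip.
by exists (flip z); [exact: box_flip | rewrite /= flipK].
Qed.

Lemma crossing_far i t x : ~~ (i.+1%:R <= x <= i.+2%:R) ->
  crossing i t x <-> at_rest k x.
Proof.
move=> far; split=> [[xE|xE|[j [_ _ ->]]]|[j xE]]; last 2 first.
- by exists j.
- apply: Or33; exists j; split => //; apply: contraNneq far => jE;
    by rewrite xE jE !ler_nat /=; lia.
- case/negP: far; have := @strands_spans R k (i, 0, 1) (x, t).
  by rewrite /strands /spans /time /letter /= subr0 divr1; apply; left.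
- case/negP: far; have := @strands_spans R k (i, 0, 1) (x, t).
  by rewrite /strands /spans /time /letter /= subr0 divr1; apply; right.
Qed.

Lemma crossing_off_frame i j t x : adjacent i j ->
  ~~ ((minn i j)%:R + 2^-1 <= x <= (minn i j)%:R + (3 + 2^-1)) ->
  forall l, l = i \/ l = j -> crossing l t x <-> at_rest k x.
Proof.
move=> adj off l lij; apply: crossing_far; apply: contra off => /andP[x1 x2].
have l1 : (minn i j)%:R <= (l%:R : R) by rewrite ler_nat; case: lij => ->; lia.
have l2 : (l%:R : R) <= (minn i j)%:R + 1.
  by rewrite natr1 ler_nat; case: adj; case: lij => -> ?; lia.
by move: x1 x2; rewrite -[l.+2%:R]natr1 -[l.+1%:R]natr1 => ? ?;
  apply/andP; split; lra.
Qed.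

End Frames.

(** * Alternating sums over Yang-Baxter modifications *)

Section Words.
Variable k : nat.
Implicit Types (x u v : tw_word k) (s : nat -> bool).

(** [(u, i, j)] stands for the word [u] followed by one of the two sides of the
    Yang-Baxter relation between the letters [i] and [j]. *)
Definition segment : Type := (tw_word k * 'I_k.-1 * 'I_k.-1)%type.
Implicit Types (d : segment) (ds : seq segment).

Definition yb_side d (b : bool) : tw_word k :=
  if b then [:: d.2; d.1.2; d.2] else [:: d.1.2; d.2; d.1.2].

Fixpoint word_of ds s x : tw_word k :=
  if ds is d :: ds' then
    d.1.1 ++ yb_side d (s 0%N) ++ word_of ds' (fun n => s n.+1) x
  else x.

Fixpoint offset ds (a : nat) : nat :=
  if ds is d :: ds' then
    if a is a'.+1 then size d.1.1 + 3 + offset ds' a' else size d.1.1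
  else 0.

(** Nonempty words between the Yang-Baxter subwords make the triangles disjoint. *)
Definition spaced d : Prop := adjacent d.1.2 d.2 /\ d.1.1 != [::].

Lemma size_yb_side d b : size (yb_side d b) = 3%N.
Proof. by case: b. Qed.

Lemma size_word_of ds s s' x : size (word_of ds s x) = size (word_of ds s' x).
Proof.
elim: ds s s' => [|d ds IH] s s' //=.
by rewrite !size_cat !size_yb_side (IH _ (fun n => s' n.+1)).
Qed.

Lemma word_of_split d0 ds s x a : (a < size ds)%N -> exists pre post,
  word_of ds s x = pre ++ yb_side (nth d0 ds a) (s a) ++ post /\
  size pre = offset ds a.
Proof.
elim: ds a s => [|d ds IH] [|a] s //= ads.
  by exists d.1.1, (word_of ds (fun n => s n.+1) x).
have [pre [post [-> <-]]] := IH a (fun n => s n.+1) ads.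
exists (d.1.1 ++ yb_side d (s 0%N) ++ pre), post; rewrite -!catA; split=> //.
by rewrite !size_cat size_yb_side addnA.
Qed.

Lemma nth_word_of i0 d0 ds s s' x l :
  nth i0 (word_of ds s x) l = nth i0 (word_of ds s' x) l \/
  exists a, [/\ (a < size ds)%N, s a != s' a, (offset ds a <= l < offset ds a + 3)%N &
    forall t, let e := nth d0 ds a in
      nth i0 (word_of ds t x) l = e.1.2 \/ nth i0 (word_of ds t x) l = e.2].
Proof.
elim: ds s s' l => [|d ds IH] s s' l /=; first by left.
rewrite !nth_cat !size_yb_side; case: ltnP => lu; first by left.
case: ltnP => l3.
  have [->|ss] := eqVneq (s 0%N) (s' 0%N); first by left.
  right; exists 0%N; split=> // [|t]; first by rewrite lu /=; lia.
  rewrite !nth_cat !size_yb_side ltnNge lu /= l3 /yb_side.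
  move: l3; case: (l - _)%N => [|[|[|]]] //; case: (t 0%N) => /=; by [left|right].
have [->|[a [ads ss lo H]]] := IH (fun n => s n.+1) (fun n => s' n.+1)
  (l - size d.1.1 - 3)%N; first by left.
right; exists a.+1; split=> //; first by move: lo => /andP[? ?]; apply/andP; split; lia.
by move=> t /=; rewrite !nth_cat !size_yb_side ltnNge lu /= ltnNge l3 /=; exact: H.
Qed.

Lemma offset_lt ds a b : (forall d, d \in ds -> spaced d) -> (a < b < size ds)%N ->
  (offset ds a + 3 < offset ds b)%N.
Proof.
elim: ds a b => [|d ds IH] a b sp; first by rewrite andbF.
have sp' d' : d' \in ds -> spaced d' by move=> h; apply: sp; rewrite inE h orbT.
case: b => [|b] //; case: a => [|a] /= ab; last first.
  by have := IH a b sp' ab; lia.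
case: ds sp sp' ab {IH} => [|d' ds] // sp sp' _.
have [_ d'0] := sp' d' (mem_head _ _).
have d'1 : (0 < size d'.1.1)%N by rewrite lt0n size_eq0.
by case: b => [|b] /=; lia.
Qed.

Lemma offset_end d0 ds s x a : (a < size ds)%N ->
  (offset ds a + 3 <= size (word_of ds s x))%N.
Proof.
move=> ads; have [pre [post [-> <-]]] := word_of_split d0 s x ads.
by rewrite !size_cat size_yb_side; lia.
Qed.

End Words.

Section AlternatingSums.
Variable A : zmodType.
Implicit Types (Phi Psi : (nat -> bool) -> A) (s : nat -> bool).

Definition scons (b : bool) s (n : nat) : bool := if n is n'.+1 then s n' else b.

Fixpoint alt_sum (N : nat) Phi : A :=
  if N is N'.+1 then
    alt_sum N' (fun s => Phi (scons false s)) - alt_sum N' (fun s => Phi (scons true s))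
  else Phi (fun=> false).

Lemma alt_sumB N Phi Psi :
  alt_sum N (fun s => Phi s - Psi s) = alt_sum N Phi - alt_sum N Psi.
Proof.
elim: N Phi Psi => [|N IH] Phi Psi //=.
by rewrite !IH !opprD !opprK !addrA; congr (_ + _); exact: addrAC.
Qed.

Definition indicator N (s : {set 'I_N}) (n : nat) : bool :=
  [exists i : 'I_N, (i \in s) && (i == n :> nat)].

Lemma indicatorE N (s : {set 'I_N}) (a : 'I_N) : indicator s a = (a \in s).
Proof.
apply/existsP/idP => [[i /andP[si /eqP ia]]|sa]; last by exists a; rewrite sa /=.
by rewrite -(val_inj ia).
Qed.

Definition set_cons N (p : bool * {set 'I_N}) : {set 'I_N.+1} :=
  [set i | if unlift ord0 i is Some j then j \in p.2 else p.1].

Lemma set_cons_bij N : bijective (@set_cons N).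
Proof.
exists (fun s : {set 'I_N.+1} => (ord0 \in s, [set j | lift ord0 j \in s]%SET)).
  move=> [b s]; congr pair; first by rewrite inE unlift_none.
  by apply/setP => j; rewrite !inE liftK.
by move=> s; apply/setP => i; rewrite inE; case: unliftP => [j ->|->]; rewrite ?inE.
Qed.

Lemma indicator_cons N b (s : {set 'I_N}) :
  indicator (set_cons (b, s)) = scons b (indicator s).
Proof.
apply/funext => -[|n] /=.
  by rewrite (indicatorE _ ord0) inE unlift_none.
apply/existsP/existsP => [[i /andP[]]|[j /andP[sj /eqP jn]]].
  rewrite inE; case: unliftP => [j ->|-> //] /= sj; rewrite eqSS => jn.
  by exists j; rewrite sj.
by exists (lift ord0 j); rewrite inE liftK sj /= -jn.
Qed.

Lemma card_set_cons N b (s : {set 'I_N}) : #|set_cons (b, s)| = (b + #|s|)%N.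
Proof.
have -> : set_cons (b, s) = ((if b then [set ord0] else finset.set0) :|:
    [set lift ord0 j | j in s])%SET.
  apply/setP => i; rewrite !inE; case: unliftP => [j ->|->] /=.
    rewrite mem_imset; last exact: lift_inj.
    by case: b; rewrite !inE.
  case: b => /=; rewrite !inE //.
  by apply/esym/negbTE/imsetP => -[j _ /eqP]; rewrite (negbTE (neq_lift _ _)).
rewrite cardsU card_imset; last exact: lift_inj.
have -> : ((if b then [set ord0] else finset.set0) :&:
    [set lift ord0 j | j in s])%SET = finset.set0.
  apply/setP => i; rewrite !inE; case: b; rewrite !inE //.
  apply/negbTE/negP => /andP[/eqP -> /imsetP[j _ /eqP]].
  by rewrite (negbTE (neq_lift _ _)).
by rewrite cards0 subn0; case: b; rewrite ?cards1 ?cards0.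
Qed.

Lemma alt_sumE N Phi :
  alt_sum N Phi = \sum_(s : {set 'I_N}) Phi (indicator s) *~ (-1) ^+ #|s|.
Proof.
elim: N Phi => [|N IH] Phi /=.
  rewrite (big_pred1 finset.set0) => [|s]; last first.
    by rewrite /=; apply/esym/eqP/setP => -[].
  rewrite cards0 expr0 mulr1z; congr Phi; apply/funext => n.
  by apply/esym/existsP => -[[]].
rewrite (reindex _ (onW_bij _ (set_cons_bij N))) /=.
rewrite -(pair_bigA _ (fun (b : bool) (S : {set 'I_N}) =>
  Phi (indicator (set_cons (b, S))) *~ (-1) ^+ #|set_cons (b, S)|)) /=.
rewrite big_bool /= !IH addrC; congr (_ + _).
  by apply: eq_bigr => s _; rewrite indicator_cons card_set_cons.
rewrite -sumrN; apply: eq_bigr => s _.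
by rewrite indicator_cons card_set_cons exprS mulN1r mulrNz.
Qed.

End AlternatingSums.

(** * The theorem *)

Section TangleInvariant.
Variables (R : realType) (k : nat) (A : zmodType) (f : rondle R -> A).
Local Notation plane := (R * R)%type.
Implicit Types (x u v : tw_word k) (s : nat -> bool) (ds : seq (segment k)).

(** The two sides of the Yang-Baxter relations; the ideal generated by their
    differences is what triple-point modifications see. *)
Definition yb_relators : set (twin k * twin k) :=
  [set ab | exists i j : 'I_k.-1, adjacent i j /\
     ab = (@tw_sigma k i * @tw_sigma k j * @tw_sigma k i,
           @tw_sigma k j * @tw_sigma k i * @tw_sigma k j)%g].

Lemma tw_class_yb_side d b : tw_class (yb_side d b) =
  (if b then @tw_sigma k d.2 * @tw_sigma k d.1.2 * @tw_sigma k d.2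
   else @tw_sigma k d.1.2 * @tw_sigma k d.2 * @tw_sigma k d.1.2)%g.
Proof.
have H (i j l : 'I_k.-1) : tw_class [:: i; j; l] =
    (@tw_sigma k i * @tw_sigma k j * @tw_sigma k l)%g.
  by rewrite -[[:: i; j; l]]/(([:: i] ++ [:: j]) ++ [:: l]) !tw_classM.
by case: b; rewrite H.
Qed.

Lemma kills_of_alt_sum N (F : twin k -> A) :
  (forall ds x, size ds = N -> (forall d, d \in ds -> spaced d) ->
    alt_sum N (fun s => F (tw_class (word_of ds s x))) = 0) ->
  kills yb_relators N F.
Proof.
elim: N F => [|N IH] F H /=.
  by move=> x; rewrite -(tw_class_repr x); exact: (H [::]).
move=> u _ [i [j [adj ->]]] /=; apply: IH => ds x sds sp.
(* the trivial prefix [i i] makes the word nonempty *)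
pose d : segment k := (([:: i; i] ++ repr u), i, j).
have du : tw_class d.1.1 = u.
  rewrite -[RHS]tw_class_repr; apply/tw_classP.
  exact: (tw_square [::] (repr u) i).
have wE b s : tw_class (word_of (d :: ds) (scons b s) x) =
    (u * tw_class (yb_side d b) * tw_class (word_of ds s x))%g.
  rewrite -[word_of _ _ _]/(d.1.1 ++ (yb_side d b ++ word_of ds s x)).
  rewrite (tw_classM d.1.1) (tw_classM (yb_side d b)) du; exact: mulgA.
have := H (d :: ds) x; rewrite [size _]/= sds => /(_ erefl) H0.
rewrite alt_sumB -[RHS]H0; last first.
  by move=> d'; rewrite inE => /predU1P[->|/sp].
rewrite -[RHS]/(alt_sum N (fun s => F (tw_class (word_of (d :: ds) (scons false s) x))) -
  alt_sum N (fun s => F (tw_class (word_of (d :: ds) (scons true s) x)))).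
congr (_ - _); congr alt_sum; apply/funext => s.
  by rewrite wE tw_class_yb_side.
by rewrite wE tw_class_yb_side.
Qed.

Lemma rondle_of_eq (D D' : projection R) :
  rondle_eqv D D' -> rondle_of D = rondle_of D'.
Proof.
move=> r; apply: eq_exist; apply/seteqP; split=> D2 /= h.
  exact: req_trans (req_sym r) h.
exact: req_trans r h.
Qed.

Lemma tangle_map_class (T : tangle R k) w :
  tangle_map T (tw_class w) = rondle_of (exist _ _ (tangle_fill T w)).
Proof.
apply: rondle_of_eq.
have [l [l' r]] := tw_eqv_requiv (tangle_diffeo T) (tangle_fill T) (tw_eqv_repr w).
by rewrite (Prop_irrelevance (tangle_fill T _) l) (Prop_irrelevance (tangle_fill T w) l').
Qed.

Variables (T : tangle R k) (N : nat) (ds : seq (segment k)) (x : tw_word k).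
Hypotheses (sds : size ds = N) (spds : forall d, d \in ds -> spaced d).
Local Notation E := (tangle_disc T).
Local Notation O := (tangle_outside T).

Let w s := word_of ds s x.
Let w0 := w (fun=> false).
Let L := size w0.
Let D : set plane := fill E w0 O.

Variable d0 : segment k.
Let seg (a : nat) := nth d0 ds a.
Let P (a : nat) : plane -> plane := @frame R k (seg a).1.2 (seg a).2 (offset ds a) L.

Hypothesis N_gt0 : (0 < N)%N.

Let size_w s : size (w s) = L.
Proof. exact: size_word_of. Qed.

Let seg_spaced a : (a < N)%N -> adjacent (seg a).1.2 (seg a).2.
Proof. by move=> aN; have [] := spds (@mem_nth _ d0 ds a ltac:(by rewrite sds)). Qed.

Let offset_L a : (a < N)%N -> (offset ds a + 3 <= L)%N.
Proof. by rewrite -sds; exact: offset_end. Qed.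

Let L_gt0 : (0 < L)%N.
Proof. by have := offset_L N_gt0; lia. Qed.

Lemma frame_side s a z : (a < N)%N -> @box R 3 z ->
  config (if s a then yb_word' else yb_word) z <-> config (w s) (P a z).
Proof.
move=> aN bz; have adj := seg_spaced aN.
have aN' : (a < size ds)%N by rewrite sds.
have [pre [post [wE so]]] := word_of_split d0 s x aN'.
rewrite /P -so -(size_w s) /w wE /yb_side -/(seg a).
by case: (s a); [exact: frame_config' | exact: frame_config].
Qed.

Lemma frames_disjoint (a b : nat) : (a < N)%N -> (b < N)%N -> a != b ->
  (P a @` @box R 3) `&` (P b @` @box R 3) = set0.
Proof.
wlog ab : a b / (a < b)%N => [H aN bN ab|aN bN _].
  have [lt|lt|E0] := ltngtP a b; first exact: H.
    by rewrite setIC; apply: H => //; rewrite eq_sym.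
  by rewrite E0 eqxx in ab.
rewrite -subset0 => y [].
move=> /(frame_image _ _ L_gt0 (seg_spaced aN))[_ /andP[_ h1]].
move=> /(frame_image _ _ L_gt0 (seg_spaced bN))[_ /andP[h2 _]].
have := le_trans h2 h1; rewrite ler_pM2r ?invr_gt0 ?ltr0n // ler_nat.
have := @offset_lt _ ds a b spds; rewrite ab sds bN => /(_ isT).
lia.
Qed.

(** At the heights of a modified subword but off its frame, the letters of the
    subword do not matter, since all the arcs are vertical there. *)
Lemma off_frames s y : @box R k y ->
  (forall a, (a < N)%N -> s a -> ~ (P a @` @box R 3) y) ->
  config (w s) y <-> config w0 y.
Proof.
case: y => x1 y1 [_ /= y01] H.
have [l [t [lL t01 yE]]] := layers_cover L_gt0 y01.
have lw s' : config (w s') (x1, y1) <-> crossing (nth d0.2 (w s') l) t x1.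
  by rewrite yE -(size_w s'); apply: config_nth => //; rewrite size_w.
rewrite (lw s) (lw (fun=> false)).
have [->//|[a [aN sa lo side]]] := nth_word_of d0.2 d0 ds s (fun=> false) x l.
rewrite sds in aN; have adj := seg_spaced aN.
have sa' : s a by move: sa; case: (s a).
have Lr : 0 < L%:R :> R by rewrite ltr0n.
have off : ~~ ((minn (seg a).1.2 (seg a).2)%:R + 2^-1 <= x1 <=
               (minn (seg a).1.2 (seg a).2)%:R + (3 + 2^-1)).
  apply/negP => xin; apply: (H a aN sa'); apply/(frame_image _ _ L_gt0 adj).
  split; first exact: xin.
  rewrite /= yE !ler_pM2r ?invr_gt0 //.
  case/andP: lo => lo1 lo2; case/andP: t01 => t0 t1.
  have r1 : (offset ds a)%:R <= (l%:R : R) by rewrite ler_nat.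
  have r2 : (l%:R : R) + 1 <= (offset ds a + 3)%:R by rewrite natr1 ler_nat.
  by apply/andP; split; lra.
have far := crossing_off_frame t adj off.
by rewrite (far _ (side s)) (far _ (side (fun=> false))).
Qed.

(** The words have equal lengths, so the layers do not move when a side is changed
    and the equality holds on the nose. *)
Lemma fill_modification (S : {set 'I_N}) :
  fill E (w (indicator S)) O =
  triple_point_modification D (fun a : 'I_N => E \o P a) S.
Proof.
have [Einv [_ EK _]] := diffeo_inv (tangle_diffeo T); have iE := can_inj EK.
have Pbox (a : 'I_N) z : @box R 3 z -> @box R k (P a z).
  by apply: frame_box => //; [exact: offset_L | exact: seg_spaced].
apply/seteqP; split=> y.
  have [[a aS [z bz zy]]|ny] := pselect ((\bigcup_(j in [set` S])
      ((fun a : 'I_N => E \o P a) j @` @box R 3)) y).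
    case=> [[_ ny]|[y' cy' yE]].
      by case: ny; exists (P a z) => //; exact: Pbox.
    right; exists a => //; exists z => //.
    have E1 : y' = P a z by apply: iE; rewrite yE -zy.
    have := frame_side (indicator S) (ltn_ord a) bz.
    by rewrite indicatorE aS => ->; rewrite -E1.
  case=> [[Oy nb]|[y' cy' yE]]; left; split=> //; first by left.
  right; exists y' => //; apply/(off_frames (s := indicator S)) => //.
    exact: config_sub_box cy'.
  move=> a aN aS [z bz zy']; apply: ny; exists (Ordinal aN) => /=.
    by move: aS; rewrite (indicatorE _ (Ordinal aN)).
  by exists z => //=; rewrite zy'.
case=> [[Dy ny]|[a aS [z cz <-]]].
  case: Dy => [[Oy nb]|[y' cy' yE]]; first by left.
  right; exists y' => //; apply/off_frames => //; first exact: config_sub_box cy'.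
  move=> a aN aS [z bz zy']; apply: ny; exists (Ordinal aN) => /=.
    by move: aS; rewrite (indicatorE _ (Ordinal aN)).
  by exists z => //=; rewrite zy'.
right; exists (P a z) => //.
have bz := config_sub_box cz.
have := frame_side (indicator S) (ltn_ord a) bz.
by rewrite indicatorE aS => <-.
Qed.

Lemma alt_sum_vanishing : vanishing f N ->
  alt_sum N (fun s => f (tangle_map T (tw_class (w s)))) = 0.
Proof.
move=> van.
have dE := tangle_diffeo T.
have [Einv [_ EK _]] := diffeo_inv dE; have iE := can_inj EK.
have lD : link_projection D := tangle_fill T w0.
have dP a : diffeo (E \o P a) by apply: diffeo_comp => //; exact: diffeo_frame.
have DE (a : 'I_N) : D = fill (E \o P a) yb_word D.
  rewrite -[RHS]/(refill 3 (E \o P a) (config yb_word) (refill k E (config w0) O)).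
  apply: refill_patch => //; try exact: config_sub_box.
    by move=> z; apply: frame_box => //; [exact: offset_L | exact: seg_spaced].
  by move=> z bz; exact: (frame_side (fun=> false) (ltn_ord a) bz).
pose tri (a : 'I_N) := cid (exists_triangle (dP a) lD (DE a)).
pose Delta a := projT1 (tri a).
have HDelta a : triangle D (Delta a) /\ Delta a `<=` (E \o P a) @` @box R 3.
  exact: projT2 (tri a).
have boxes (a b : 'I_N) : a != b ->
    (E \o P a) @` @box R 3 `&` (E \o P b) @` @box R 3 = set0.
  move=> ab; rewrite -subset0 => y [[z bz <-] [z' bz' /iE zz]].
  have := frames_disjoint (ltn_ord a) (ltn_ord b) ab; rewrite -subset0.
  by move=> /(_ (P a z)); apply; split; [exists z | exists z'].
rewrite alt_sumE.
rewrite -[RHS](van (exist _ _ lD) Delta (fun a : 'I_N => E \o P a)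
  (fun S => exist _ _ (tangle_fill T (w (indicator S))))).
- by apply: eq_bigr => S _; rewrite tangle_map_class.
- by move=> a; have [] := HDelta a.
- move=> a b ab; rewrite -subset0 => y [ya yb].
  have := boxes a b ab; rewrite -subset0 => /(_ y); apply.
  by split; [exact: (HDelta a).2 | exact: (HDelta b).2].
- by move=> a; split; [exact: dP | exact: DE | exact: (HDelta a).2].
- exact: boxes.
- by move=> S; exact: fill_modification.
Qed.

End TangleInvariant.

Theorem theorem1 (R : realType) (k n : nat) (hk : (0 < k)%N) (hn : (0 < n)%N)
    (PTW : set (twin k)) (hPTW : small_pure_twin_group PTW)
    (p : twin k) (hp : lcs PTW n p)
    (C C' : rondle R) (hCC' : differ_by p C C')
    (A : zmodType) (f : rondle R -> A)
    (hf : exists m : nat, has_order f m /\ (m < n)%N) :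
  f C = f C'.
Proof.
have [m [[van _] mn]] := hf; have [T [x [-> ->]]] := hCC'.
have [ps [Hps PTWE]] := hPTW.
pose F y := f (tangle_map T y).
have KF : kills (@yb_relators k) m.+1 F.
  apply: kills_of_alt_sum => -[|d ds] y sds sp //.
  exact: (@alt_sum_vanishing R k A f T m.+1 (d :: ds) y sds sp d isT van).
have Up : unipotent A (@yb_relators k) n p.
  apply: lcs_unipotent hp => // q; rewrite PTWE; apply: unipotent_generated => r.
  move=> /Hps[_ [u [v [i [j [adj -> uv1]]]]]].
  have ab : @yb_relators k (tw_sigma i * tw_sigma j * tw_sigma i,
      tw_sigma j * tw_sigma i * tw_sigma j)%g by exists i, j.
  exact: (@unipotent_relator _ A _ u v (_, _) ab uv1).
exact/esym/(kills_unipotent x mn KF Up).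
Qed.
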